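(* Let $\delta_0$ denote the supremum of all numbers $\delta>0$ with the following property: every function $f\in\mathcal{A}$ satisfying $e^{-\delta/2}<|zf'(z)/f(z)|<e^{\delta/2}$ for all $z\in\mathbb{D}$ is univalent on $\mathbb{D}$. Then $$\frac{\pi}{3}<\delta_0<\frac{5\pi}{7}.$$
   Context: $\mathbb{D}=\{z\in\mathbb{C}:|z|<1\}$. $\mathcal{A}$ denotes the class of analytic functions $f$ on $\mathbb{D}$ normalized by $f(0)=0$, $f'(0)=1$. The value of $zf'(z)/f(z)$ at $z=0$ is understood as $\lim_{z\to0}zf'(z)/f(z)=1$. *)

(* Defs.v *)
From Stdlib Require Import Reals.
From Coquelicot Require Import Coquelicot.
Open Scope R_scope.

Definition inD (z : C) : Prop := Cmod z < 1.

Definition has_deriv_on_D (f f' : C -> C) : Prop :=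
  forall z : C, inD z -> @is_derive C_AbsRing C_NormedModule f z (f' z).

Definition analytic_on_D (f : C -> C) : Prop :=
  exists f' : C -> C, has_deriv_on_D f f'.

Definition univalent_on_D (f : C -> C) : Prop :=
  forall z w : C, inD z -> inD w -> f z = f w -> z = w.

(* z f'(z) / f(z), with value 1 at z = 0 (the limit, by convention) *)
Definition zf'_over_f (f f' : C -> C) (z : C) : C :=
  if Ceq_dec z 0 then 1%C else Cdiv (Cmult z (f' z)) (f z).

(* delta has the property: every f in A with e^{-delta/2} < |z f'/f| < e^{delta/2}
   on D (in particular f z <> 0 for z <> 0, so that the quotient is defined)
   is univalent on D. *)
Definition univalence_property (delta : R) : Prop :=
  forall f f' : C -> C,
    has_deriv_on_D f f' -> f 0%C = 0%C -> f' 0%C = 1%C ->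
    (forall z : C, inD z -> z <> 0%C -> f z <> 0%C) ->
    (forall z : C, inD z ->
        exp (- (delta / 2)) < Cmod (zf'_over_f f f' z) < exp (delta / 2)) ->
    univalent_on_D f.

Definition delta_set (delta : R) : Prop := 0 < delta /\ univalence_property delta.

(* Main.v *)
(* Put [c = delta / pi] and, on the left half-plane, [F(w) = log f(e^w)] and [P = F'], so
   that [exp(-c pi / 2) < |P| < exp(c pi / 2)]. As [F(w + 2 pi i) = F(w) + 2 pi i], [f] is
   univalent iff [F] is injective.

   Lower bound. Schwarz-Pick for the harmonic function [log |P|] gives
   [|(log P)'| <= c / |Re w|], i.e. [log P] is [c]-Lipschitz for the hyperbolic metric. To
   compare [F a] and [F b], integrate [P] along the hyperbolic geodesic from [a] to [b] and
   compare it with its value at the point [m] of this arc farthest from the boundary: at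
   hyperbolic distance [s] from [m] one has [|P / P m - 1| <= exp(c s) - 1]. For [c] slightly
   above [1 / 3] the resulting error is still smaller than [|P m| |b - a|].

   Upper bound. Take [z f' / f = ((1 + z) / (1 - z))^(i c)]. Then [f] commutes with the
   reflection in the imaginary axis, so it is not univalent if it takes an imaginary value
   off that axis. With [u = log ((1 + z) / (1 - z))], going along [Im u = - pi / 2] from
   [Re u = 0], where [f] lies on the negative imaginary axis, to [Re u = pi / (2 c)], the
   argument of [f] increases by the integral of [exp(c pi / 2) cos(c t) / cosh t], which
   exceeds [pi] for [c = 0.714 < 5 / 7]. *)

Require Import Defs.
From Stdlib Require Import Reals Lra Lia Psatz ZArith ClassicalEpsilon.
From Coquelicot Require Import Coquelicot.
Open Scope R_scope.

(** * Derivatives of complex-valued maps *)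

(** Both strict inequalities come from explicit constants just beyond the claimed ends:
    [167 / 500 > 1 / 3] and [357 / 500 < 5 / 7]. The threshold [1 / 3] appears because [x^-c - 1]
    has integral [c / (1 - c)] over [0, 1]. A quarter of a geodesic circle of radius [rho] has speed
    at most [2 * rho] in the parameter [x], while its share of the diameter is [rho]; and
    [2 * c / (1 - c) = 1] exactly at [c = 1 / 3]. Going beyond needs a finer bound on the speed. In
    the upper bound the critical point lies on the unit circle. In the coordinate [u] everything is
    analytic on the strip [|Im u| < PI], twice as wide as the image of the disc, so no boundary
    limits occur; continuity then leads back into the disc. All function theory rests on one form of
    Goursat's theorem, for images of rectangles under maps that may overlap or degenerate: a family
    of circles gives Cauchy's formula, a rectangle with one side collapsed gives primitives. *)

(* The variable [x : X] is seen as a complex number through [e]; taking [e] to be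
   the identity of [C] or [RtoC] gives complex derivatives and derivatives of
   curves, with a single calculus for both. *)
Definition cont {X : Type} (e f : X -> C) (x : X) : Prop :=
  forall eps : R, 0 < eps -> exists d : R, 0 < d /\
    forall y : X, Cmod (e y - e x) < d -> Cmod (f y - f x) < eps.

Definition der {X : Type} (e f : X -> C) (x : X) (l : C) : Prop :=
  forall eps : R, 0 < eps -> exists d : R, 0 < d /\
    forall y : X, Cmod (e y - e x) < d ->
      Cmod (f y - f x - l * (e y - e x)) <= eps * Cmod (e y - e x).

Definition Cid (z : C) : C := z.
Notation ccont := (cont Cid).
Notation rcont := (cont RtoC).
Notation cder := (der Cid).
Notation rder := (der RtoC).

Lemma Cmod_sub_sym (a b : C) : Cmod (a - b) = Cmod (b - a).
Proof. rewrite <- Cmod_opp. f_equal. ring. Qed.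

Lemma Cmod_diff_0 (a : C) : Cmod (a - a) = 0.
Proof. replace (a - a)%C with (RtoC 0) by ring. apply Cmod_0. Qed.

Lemma Cmod_minus_le (a b : C) : Cmod (a - b) <= Cmod a + Cmod b.
Proof. replace (a - b)%C with (a + - b)%C by ring. rewrite <- (Cmod_opp b). apply Cmod_triangle. Qed.

Lemma Cmod_triangle_rev (a b : C) : Cmod a - Cmod b <= Cmod (a - b).
Proof.
  pose proof (Cmod_triangle (a - b) b) as H.
  replace (a - b + b)%C with a in H by ring. lra.
Qed.

Lemma cont_const {X} (e : X -> C) (k : C) (x : X) : cont e (fun _ => k) x.
Proof.
  intros eps He; exists 1; split; [lra|]; intros y _.
  rewrite Cmod_diff_0; lra.
Qed.

Lemma cont_id {X} (e : X -> C) (x : X) : cont e e x.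
Proof. intros eps He; exists eps; split; auto. Qed.

Lemma cont_plus {X} (e f g : X -> C) (x : X) :
  cont e f x -> cont e g x -> cont e (fun y => f y + g y)%C x.
Proof.
  intros Hf Hg eps He.
  destruct (Hf (eps / 2)) as [d1 [H1 K1]]; [lra|].
  destruct (Hg (eps / 2)) as [d2 [H2 K2]]; [lra|].
  exists (Rmin d1 d2); split; [apply Rmin_pos; auto|]; intros y Hy.
  specialize (K1 y (Rlt_le_trans _ _ _ Hy (Rmin_l _ _))).
  specialize (K2 y (Rlt_le_trans _ _ _ Hy (Rmin_r _ _))).
  replace (f y + g y - (f x + g x))%C with ((f y - f x) + (g y - g x))%C by ring.
  pose proof (Cmod_triangle (f y - f x) (g y - g x)); lra.
Qed.

Lemma cont_mult {X} (e f g : X -> C) (x : X) :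
  cont e f x -> cont e g x -> cont e (fun y => f y * g y)%C x.
Proof.
  intros Hf Hg eps He.
  set (M := Cmod (f x) + Cmod (g x) + 1).
  pose proof (Cmod_ge_0 (f x)) as P1. pose proof (Cmod_ge_0 (g x)) as P2.
  assert (HM : 1 <= M) by (unfold M; lra).
  destruct (Hf (Rmin 1 (eps / (2 * M)))) as [d1 [H1 K1]].
  { apply Rmin_pos; [lra|apply Rdiv_lt_0_compat; lra]. }
  destruct (Hg (eps / (2 * M))) as [d2 [H2 K2]].
  { apply Rdiv_lt_0_compat; lra. }
  exists (Rmin d1 d2); split; [apply Rmin_pos; auto|]; intros y Hy.
  specialize (K1 y (Rlt_le_trans _ _ _ Hy (Rmin_l _ _))).
  specialize (K2 y (Rlt_le_trans _ _ _ Hy (Rmin_r _ _))).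
  assert (A1 : Cmod (f y - f x) < 1) by (eapply Rlt_le_trans; [exact K1|apply Rmin_l]).
  assert (A2 : Cmod (f y - f x) < eps / (2 * M)) by (eapply Rlt_le_trans; [exact K1|apply Rmin_r]).
  replace (f y * g y - f x * g x)%C with
    ((f y - f x) * g x + (f y - f x) * (g y - g x) + f x * (g y - g x))%C by ring.
  assert (A3 : eps / (2 * M) * M = eps / 2) by (field; lra).
  pose proof (Cmod_triangle ((f y - f x) * g x + (f y - f x) * (g y - g x)) (f x * (g y - g x))) as T1.
  pose proof (Cmod_triangle ((f y - f x) * g x) ((f y - f x) * (g y - g x))) as T2.
  rewrite Cmod_mult in T1. rewrite 2!Cmod_mult in T2.
  pose proof (Cmod_ge_0 (f y - f x)) as P3. pose proof (Cmod_ge_0 (g y - g x)) as P4.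
  assert (B1 : Cmod (f y - f x) * Cmod (g x) <= eps / (2 * M) * Cmod (g x))
    by (apply Rmult_le_compat_r; lra).
  assert (B2 : Cmod (f y - f x) * Cmod (g y - g x) <= 1 * (eps / (2 * M)))
    by (apply Rmult_le_compat; lra).
  assert (B3 : Cmod (f x) * Cmod (g y - g x) <= Cmod (f x) * (eps / (2 * M)))
    by (apply Rmult_le_compat_l; lra).
  assert (B4 : 0 < eps / (2 * M)) by (apply Rdiv_lt_0_compat; lra).
  set (k := eps / (2 * M)) in *. unfold M in A3. lra.
Qed.

Lemma cont_comp {X} (e f : X -> C) (g : C -> C) (x : X) :
  cont e f x -> ccont g (f x) -> cont e (fun y => g (f y)) x.
Proof.
  intros Hf Hg eps He.
  destruct (Hg eps He) as [d1 [H1 K1]].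
  destruct (Hf d1 H1) as [d2 [H2 K2]].
  exists d2; split; [auto|intros y Hy; apply K1, K2, Hy].
Qed.

Lemma cont_local {X} (e f g : X -> C) (x : X) (r : R) :
  0 < r -> (forall y, Cmod (e y - e x) < r -> f y = g y) ->
  cont e f x -> cont e g x.
Proof.
  intros Hr E Hf eps He. destruct (Hf eps He) as [d [H K]].
  exists (Rmin d r); split; [apply Rmin_pos; auto|]; intros y Hy.
  rewrite <- !E.
  - apply K. eapply Rlt_le_trans; [exact Hy|apply Rmin_l].
  - rewrite Cmod_diff_0; lra.
  - eapply Rlt_le_trans; [exact Hy|apply Rmin_r].
Qed.

Lemma cont_ext {X} (e f g : X -> C) (x : X) :
  (forall y, f y = g y) -> cont e f x -> cont e g x.
Proof. intros E; apply (cont_local e f g x 1); [lra|auto]. Qed.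

Lemma cont_inv_id (z : C) : z <> 0%C -> ccont (fun w => / w)%C z.
Proof.
  intros Hz eps He.
  assert (Pz : 0 < Cmod z) by (apply Cmod_gt_0; auto).
  exists (Rmin (Cmod z / 2) (eps * Cmod z * Cmod z / 2)); split.
  { apply Rmin_pos; [lra|]. assert (0 < eps * Cmod z * Cmod z) by (repeat apply Rmult_lt_0_compat; auto). lra. }
  unfold Cid; intros y Hy.
  assert (A1 : Cmod (y - z) < Cmod z / 2) by (eapply Rlt_le_trans; [exact Hy|apply Rmin_l]).
  assert (A2 : Cmod (y - z) < eps * Cmod z * Cmod z / 2) by (eapply Rlt_le_trans; [exact Hy|apply Rmin_r]).
  pose proof (Cmod_triangle_rev z y) as T. rewrite Cmod_sub_sym in T.
  assert (Py : Cmod z / 2 < Cmod y) by lra.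
  assert (Ny : y <> 0%C) by (apply Cmod_gt_0; lra).
  replace (/ y - / z)%C with ((z - y) / (y * z))%C by (field; auto).
  rewrite Cmod_div by (apply Cmult_neq_0; auto).
  rewrite Cmod_mult, Cmod_sub_sym.
  apply Rlt_div_l; [apply Rmult_lt_0_compat; lra|].
  eapply Rlt_le_trans; [exact A2|].
  assert (0 <= eps * Cmod z * (Cmod y - Cmod z / 2)) by (repeat apply Rmult_le_pos; lra). nra.
Qed.

Lemma cont_inv {X} (e f : X -> C) (x : X) :
  cont e f x -> f x <> 0%C -> cont e (fun y => / f y)%C x.
Proof. intros Hf Hx. apply (cont_comp e f (fun w => / w)%C x Hf), cont_inv_id, Hx. Qed.

Lemma cont_minus {X} (e f g : X -> C) (x : X) :
  cont e f x -> cont e g x -> cont e (fun y => f y - g y)%C x.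
Proof.
  intros Hf Hg.
  apply (cont_ext e (fun y => f y + (-1) * g y)%C); [intros; ring|].
  apply cont_plus; auto. apply cont_mult; auto. apply cont_const.
Qed.

Lemma cont_div {X} (e f g : X -> C) (x : X) :
  cont e f x -> cont e g x -> g x <> 0%C -> cont e (fun y => f y / g y)%C x.
Proof. intros Hf Hg Hx. apply cont_mult; auto. apply cont_inv; auto. Qed.

(* Caratheodory's form of differentiability, which reduces the rules below to
   those for continuity. *)
Lemma der_intro {X} (e f phi : X -> C) (x : X) (l : C) (r : R) :
  0 < r -> cont e phi x -> phi x = l ->
  (forall y, Cmod (e y - e x) < r -> f y - f x = phi y * (e y - e x))%C ->
  der e f x l.
Proof.
  intros Hr Hc Hl E eps He.
  destruct (Hc eps He) as [d [Hd K]].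
  exists (Rmin d r); split; [apply Rmin_pos; auto|]; intros y Hy.
  rewrite E by (eapply Rlt_le_trans; [exact Hy|apply Rmin_r]).
  replace (phi y * (e y - e x) - l * (e y - e x))%C with ((phi y - phi x) * (e y - e x))%C
    by (rewrite Hl; ring).
  rewrite Cmod_mult. apply Rmult_le_compat_r; [apply Cmod_ge_0|].
  apply Rlt_le, K. eapply Rlt_le_trans; [exact Hy|apply Rmin_l].
Qed.

Lemma der_elim {X} (e f : X -> C) (x : X) (l : C) :
  der e f x l -> exists (phi : X -> C) (r : R), 0 < r /\ cont e phi x /\ phi x = l /\
  (forall y, Cmod (e y - e x) < r -> f y - f x = phi y * (e y - e x))%C.
Proof.
  intros H.
  set (phi := fun y => if Ceq_dec (e y) (e x) then l else ((f y - f x) / (e y - e x))%C).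
  assert (Px : phi x = l) by (unfold phi; destruct (Ceq_dec (e x) (e x)); congruence).
  assert (N : forall y, e y <> e x -> (e y - e x <> 0)%C).
  { intros y Hy E. apply Hy. replace (e y) with ((e y - e x) + e x)%C by ring. rewrite E; ring. }
  destruct (H 1) as [r [Hr Kr]]; [lra|].
  exists phi, r; split; [auto|split; [|split; [exact Px|]]].
  - intros eps He. destruct (H (eps / 2)) as [d [Hd K]]; [lra|].
    exists d; split; auto; intros y Hy. rewrite Px. unfold phi.
    destruct (Ceq_dec (e y) (e x)) as [E|E]; [rewrite Cmod_diff_0; lra|].
    specialize (K y Hy). specialize (N y E).
    assert (Pe : 0 < Cmod (e y - e x)) by (apply Cmod_gt_0; auto).
    replace ((f y - f x) / (e y - e x) - l)%C with ((f y - f x - l * (e y - e x)) / (e y - e x))%C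
      by (field; auto).
    rewrite Cmod_div by auto. apply Rlt_div_l; [auto|]. nra.
  - intros y Hy. unfold phi. destruct (Ceq_dec (e y) (e x)) as [E|E].
    (* [e] need not be injective: at a point with the same image as [x] the estimate has right-hand
       side 0 and forces [f y = f x]. *)
    + specialize (Kr y Hy). rewrite E in Kr |- *.
      rewrite Cmod_diff_0, Rmult_0_r in Kr.
      assert (Z : Cmod (f y - f x - l * (e x - e x)) = 0) by (apply Rle_antisym; [auto|apply Cmod_ge_0]).
      apply Cmod_eq_0 in Z.
      replace (f y - f x)%C with (f y - f x - l * (e x - e x) + l * (e x - e x))%C by ring.
      rewrite Z; ring.
    + field. auto.
Qed.

Lemma der_cont {X} (e f : X -> C) (x : X) (l : C) : der e f x l -> cont e f x.
Proof.
  intros H. destruct (der_elim _ _ _ _ H) as [phi [r [Hr [Hc [_ E]]]]].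
  apply (cont_local e (fun y => f x + phi y * (e y - e x))%C f x r Hr).
  - intros y Hy. rewrite <- E by auto. ring.
  - apply cont_plus; [apply cont_const|apply cont_mult; auto].
    apply cont_minus; [apply cont_id|apply cont_const].
Qed.

Lemma der_local {X} (e f g : X -> C) (x : X) (l : C) (r : R) :
  0 < r -> (forall y, Cmod (e y - e x) < r -> f y = g y) ->
  der e f x l -> der e g x l.
Proof.
  intros Hr E Hf eps He. destruct (Hf eps He) as [d [H K]].
  exists (Rmin d r); split; [apply Rmin_pos; auto|]; intros y Hy.
  rewrite <- !E.
  - apply K. eapply Rlt_le_trans; [exact Hy|apply Rmin_l].
  - rewrite Cmod_diff_0; lra.
  - eapply Rlt_le_trans; [exact Hy|apply Rmin_r].
Qed.

Lemma der_ext {X} (e f g : X -> C) (x : X) (l l' : C) :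
  (forall y, f y = g y) -> l = l' -> der e f x l -> der e g x l'.
Proof. intros E El. subst l'. apply (der_local e f g x l 1); [lra|auto]. Qed.

Lemma der_const {X} (e : X -> C) (k : C) (x : X) : der e (fun _ => k) x 0%C.
Proof.
  apply (der_intro e _ (fun _ => 0%C) x 0%C 1); [lra|apply cont_const|auto|intros; ring].
Qed.

Lemma der_id {X} (e : X -> C) (x : X) : der e e x 1%C.
Proof.
  apply (der_intro e _ (fun _ => 1%C) x 1%C 1); [lra|apply cont_const|auto|intros; ring].
Qed.

Lemma cder_id (z : C) : cder (fun w => w) z 1%C.
Proof. apply (der_id Cid). Qed.

Lemma der_mult {X} (e f g : X -> C) (x : X) (l m : C) :
  der e f x l -> der e g x m -> der e (fun y => f y * g y)%C x (l * g x + f x * m)%C.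
Proof.
  intros Hf Hg. pose proof (der_cont _ _ _ _ Hg) as Cg.
  destruct (der_elim _ _ _ _ Hf) as [p [r1 [H1 [C1 [P1 E1]]]]].
  destruct (der_elim _ _ _ _ Hg) as [q [r2 [H2 [C2 [P2 E2]]]]].
  apply (der_intro e _ (fun y => p y * g y + f x * q y)%C x _ (Rmin r1 r2)).
  - apply Rmin_pos; auto.
  - apply cont_plus; apply cont_mult; auto. apply cont_const.
  - rewrite P1, P2; auto.
  - intros y Hy.
    specialize (E1 y (Rlt_le_trans _ _ _ Hy (Rmin_l _ _))).
    specialize (E2 y (Rlt_le_trans _ _ _ Hy (Rmin_r _ _))).
    replace (f y * g y - f x * g x)%C with ((f y - f x) * g y + f x * (g y - g x))%C by ring.
    rewrite E1, E2; ring.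
Qed.

Lemma der_plus {X} (e f g : X -> C) (x : X) (l m : C) :
  der e f x l -> der e g x m -> der e (fun y => f y + g y)%C x (l + m)%C.
Proof.
  intros Hf Hg.
  destruct (der_elim _ _ _ _ Hf) as [p [r1 [H1 [C1 [P1 E1]]]]].
  destruct (der_elim _ _ _ _ Hg) as [q [r2 [H2 [C2 [P2 E2]]]]].
  apply (der_intro e _ (fun y => p y + q y)%C x _ (Rmin r1 r2)).
  - apply Rmin_pos; auto.
  - apply cont_plus; auto.
  - rewrite P1, P2; auto.
  - intros y Hy.
    specialize (E1 y (Rlt_le_trans _ _ _ Hy (Rmin_l _ _))).
    specialize (E2 y (Rlt_le_trans _ _ _ Hy (Rmin_r _ _))).
    replace (f y + g y - (f x + g x))%C with ((f y - f x) + (g y - g x))%C by ring.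
    rewrite E1, E2; ring.
Qed.

Lemma der_comp {X} (e f : X -> C) (g : C -> C) (x : X) (l m : C) :
  der e f x l -> cder g (f x) m -> der e (fun y => g (f y)) x (m * l)%C.
Proof.
  intros Hf Hg. pose proof (der_cont _ _ _ _ Hf) as Cf.
  destruct (der_elim _ _ _ _ Hf) as [p [r1 [H1 [C1 [P1 E1]]]]].
  destruct (der_elim _ _ _ _ Hg) as [q [r2 [H2 [C2 [P2 E2]]]]].
  unfold Cid in E2.
  destruct (Cf r2 H2) as [d [Hd K]].
  apply (der_intro e _ (fun y => q (f y) * p y)%C x _ (Rmin r1 d)).
  - apply Rmin_pos; auto.
  - apply cont_mult; auto. apply (cont_comp e f q); auto.
  - rewrite P1, P2; auto.
  - intros y Hy.
    specialize (E1 y (Rlt_le_trans _ _ _ Hy (Rmin_l _ _))).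
    rewrite E2 by (apply K; eapply Rlt_le_trans; [exact Hy|apply Rmin_r]).
    rewrite E1; ring.
Qed.

Lemma der_scal {X} (e f : X -> C) (k : C) (x : X) (l : C) :
  der e f x l -> der e (fun y => k * f y)%C x (k * l)%C.
Proof.
  intros H. eapply der_ext; [| |apply (der_mult e (fun _ => k) f); [apply der_const|exact H]];
    [reflexivity|cbn; ring].
Qed.

Lemma der_minus {X} (e f g : X -> C) (x : X) (l m : C) :
  der e f x l -> der e g x m -> der e (fun y => f y - g y)%C x (l - m)%C.
Proof.
  intros Hf Hg.
  apply (der_ext e (fun y => f y + (-1) * g y)%C _ x (l + (-1) * m)%C);
    [intros; ring|ring|apply der_plus; auto; apply der_scal; auto].
Qed.

Lemma cder_inv (z : C) : z <> 0%C -> cder (fun w => / w)%C z (- / (z * z))%C.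
Proof.
  intros Hz. assert (Pz : 0 < Cmod z) by (apply Cmod_gt_0; auto).
  apply (der_intro Cid _ (fun w => - / (w * z))%C z _ (Cmod z)); auto.
  - apply (cont_ext Cid (fun w => (-1) * / (w * z))%C); [intros; ring|].
    apply cont_mult; [apply cont_const|].
    apply cont_inv; [|apply Cmult_neq_0; auto].
    apply cont_mult; [apply (cont_id Cid)|apply cont_const].
  - unfold Cid; intros y Hy.
    assert (y <> 0%C).
    { intros E. rewrite E in Hy. replace (0 - z)%C with (- z)%C in Hy by ring. rewrite Cmod_opp in Hy. lra. }
    field; auto.
Qed.

Lemma der_div {X} (e f g : X -> C) (x : X) (l m : C) :
  der e f x l -> der e g x m -> g x <> 0%C ->
  der e (fun y => f y / g y)%C x ((l * g x - f x * m) / (g x * g x))%C.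
Proof.
  intros Hf Hg Hx.
  eapply der_ext; [| |apply der_mult; [exact Hf|apply der_comp; [exact Hg|apply (cder_inv _ Hx)]]].
  - reflexivity.
  - cbn; field; auto.
Qed.

Lemma cder_unique (f : C -> C) (z l m : C) : cder f z l -> cder f z m -> l = m.
Proof.
  intros H1 H2.
  destruct (Ceq_dec l m) as [E|E]; [auto|exfalso].
  assert (P : 0 < Cmod (l - m)).
  { apply Cmod_gt_0. intros E'. apply E. replace l with ((l - m) + m)%C by ring. rewrite E'; ring. }
  destruct (H1 (Cmod (l - m) / 4)) as [d1 [D1 K1]]; [lra|].
  destruct (H2 (Cmod (l - m) / 4)) as [d2 [D2 K2]]; [lra|].
  set (d := Rmin d1 d2 / 2).
  assert (Dp : 0 < Rmin d1 d2) by (apply Rmin_pos; auto).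
  pose proof (Rmin_l d1 d2); pose proof (Rmin_r d1 d2).
  assert (Ed : Cmod (Cid (z + d) - Cid z) = d).
  { unfold Cid. replace (z + d - z)%C with (RtoC d) by ring. rewrite Cmod_R. apply Rabs_pos_eq. unfold d; lra. }
  specialize (K1 (z + d)%C). specialize (K2 (z + d)%C).
  rewrite Ed in K1, K2.
  assert (A1 := K1 ltac:(unfold d; lra)). assert (A2 := K2 ltac:(unfold d; lra)).
  pose proof (Cmod_minus_le (f (z + d)%C - f z - m * (Cid (z + d) - Cid z)) (f (z + d)%C - f z - l * (Cid (z + d) - Cid z))) as T.
  replace (f (z + d)%C - f z - m * (Cid (z + d) - Cid z) - (f (z + d)%C - f z - l * (Cid (z + d) - Cid z)))%C
    with ((l - m) * (Cid (z + d) - Cid z))%C in T by ring.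
  rewrite Cmod_mult, Ed in T.
  assert (0 < d) by (unfold d; lra). nra.
Qed.

(** * Curves and their integrals *)

Lemma Re_RtoC (x : R) : Re (RtoC x) = x. Proof. reflexivity. Qed.
Lemma Im_RtoC (x : R) : Im (RtoC x) = 0. Proof. reflexivity. Qed.
Lemma Re_plus (a b : C) : Re (a + b) = Re a + Re b. Proof. reflexivity. Qed.
Lemma Re_minus (a b : C) : Re (a - b) = Re a - Re b. Proof. reflexivity. Qed.
Lemma Im_plus (a b : C) : Im (a + b) = Im a + Im b. Proof. reflexivity. Qed.
Lemma Im_minus (a b : C) : Im (a - b) = Im a - Im b. Proof. reflexivity. Qed.
Lemma Re_mult (a b : C) : Re (a * b) = Re a * Re b - Im a * Im b. Proof. reflexivity. Qed.
Lemma Im_mult (a b : C) : Im (a * b) = Re a * Im b + Im a * Re b. Proof. reflexivity. Qed.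

Lemma C_eq_intro (a b : C) : Re a = Re b -> Im a = Im b -> a = b.
Proof. destruct a, b; cbn; intros; subst; reflexivity. Qed.

Lemma Re_le_Cmod (a : C) : Re a <= Cmod a.
Proof. eapply Rle_trans; [apply Rle_abs|apply re_le_Cmod]. Qed.

Lemma Im_le_Cmod (a : C) : Rabs (Im a) <= Cmod a.
Proof. pose proof (Rmax_Cmod a). pose proof (Rmax_r (Rabs (fst a)) (Rabs (snd a))). unfold Im; lra. Qed.

Lemma Cmod_RtoC_sub (x y : R) : Cmod (RtoC x - RtoC y) = Rabs (x - y).
Proof. rewrite <- RtoC_minus. apply Cmod_R. Qed.

Lemma rder_Re (phi : R -> C) (t : R) (l : C) :
  rder phi t l -> is_derive (fun s => Re (phi s)) t (Re l).
Proof.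
  intros H. apply is_derive_Reals. intros eps He.
  destruct (H (eps / 2)) as [d [Hd K]]; [lra|].
  exists (mkposreal d Hd); intros h Hh Hb; cbn in Hb.
  specialize (K (t + h)). rewrite Cmod_RtoC_sub in K.
  replace (t + h - t) with h in K by ring. specialize (K Hb).
  pose proof (re_le_Cmod (phi (t + h) - phi t - l * (RtoC (t + h) - RtoC t))) as T.
  assert (E : Re (phi (t + h) - phi t - l * (RtoC (t + h) - RtoC t)) = Re (phi (t + h)) - Re (phi t) - Re l * h).
  { rewrite <- RtoC_minus, !Re_minus, Re_mult, Re_RtoC.
    replace (Im (RtoC (t + h - t))) with 0 by reflexivity. ring. }
  rewrite E in T.
  replace ((Re (phi (t + h)) - Re (phi t)) / h - Re l) with ((Re (phi (t + h)) - Re (phi t) - Re l * h) / h)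
    by (field; auto).
  rewrite Rabs_div by auto. pose proof (Rabs_pos_lt h Hh).
  apply Rlt_div_l; auto. nra.
Qed.

Lemma rder_Im (phi : R -> C) (t : R) (l : C) :
  rder phi t l -> is_derive (fun s => Im (phi s)) t (Im l).
Proof.
  intros H. apply (der_scal _ _ (- Ci)) in H. apply rder_Re in H.
  assert (E : forall w, Re (- Ci * w) = Im w) by (intros [x y]; unfold Re, Im; simpl; ring).
  rewrite E in H. eapply is_derive_ext; [|exact H]. intros s. apply E.
Qed.

Lemma rder_of_real (f : R -> R) (t l : R) :
  is_derive f t l -> rder (fun s => RtoC (f s)) t (RtoC l).
Proof.
  intros H eps He. apply is_derive_Reals in H.
  destruct (H eps He) as [d K].
  exists d; split; [apply cond_pos|]. intros s Hs. rewrite Cmod_RtoC_sub in *.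
  rewrite <- !RtoC_minus, <- RtoC_mult, <- RtoC_minus, Cmod_R.
  destruct (Req_dec (s - t) 0) as [E|E].
  - replace s with t by lra. rewrite !Rminus_diag, Rmult_0_r, Rminus_0_r, Rabs_R0. lra.
  - specialize (K (s - t) E Hs). replace (t + (s - t)) with s in K by ring.
    replace ((f s - f t) / (s - t) - l) with ((f s - f t - l * (s - t)) / (s - t)) in K by (field; auto).
    rewrite Rabs_div in K by auto. pose proof (Rabs_pos_lt _ E).
    apply Rlt_div_l in K; auto. lra.
Qed.

Lemma rcont_Re (phi : R -> C) (t : R) : rcont phi t -> continuous (fun s => Re (phi s)) t.
Proof.
  intros H. apply continuity_pt_filterlim. intros eps He.
  destruct (H eps He) as [d [Hd K]]. exists d; split; [exact Hd|].
  intros s [_ Hs]. specialize (K s). rewrite Cmod_RtoC_sub in K. specialize (K Hs).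
  cbn; unfold R_dist. rewrite <- Re_minus. eapply Rle_lt_trans; [apply re_le_Cmod|exact K].
Qed.

Lemma rcont_Im (phi : R -> C) (t : R) : rcont phi t -> continuous (fun s => Im (phi s)) t.
Proof.
  intros H. apply continuity_pt_filterlim. intros eps He.
  destruct (H eps He) as [d [Hd K]]. exists d; split; [exact Hd|].
  intros s [_ Hs]. specialize (K s). rewrite Cmod_RtoC_sub in K. specialize (K Hs).
  cbn; unfold R_dist. rewrite <- Im_minus. eapply Rle_lt_trans; [apply Im_le_Cmod|exact K].
Qed.

Lemma rcont_of_real (f : R -> R) (t : R) : continuous f t -> rcont (fun s => RtoC (f s)) t.
Proof.
  intros H eps He. apply continuity_pt_filterlim in H.
  destruct (H eps He) as [d [Hd K]]. exists d; split; [exact Hd|].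
  intros s Hs. rewrite Cmod_RtoC_sub in *.
  destruct (Req_dec t s) as [E|E]; [subst s; rewrite Rminus_diag, Rabs_R0; auto|].
  apply K. split; [split; [exact I|auto]|exact Hs].
Qed.

Lemma is_derive_continuity_pt (f : R -> R) (x l : R) : is_derive f x l -> continuity_pt f x.
Proof.
  intros H. apply derivable_continuous_pt. exists l. apply is_derive_Reals, H.
Qed.

(* Turning [phi b - phi a] into the positive real axis reduces this to the real
   mean value theorem. *)
Lemma curve_mean_value (phi phi' : R -> C) (psi psi' : R -> R) (a b : R) :
  a <= b ->
  (forall t, a <= t <= b -> rder phi t (phi' t)) ->
  (forall t, a <= t <= b -> is_derive psi t (psi' t)) ->
  (forall t, a <= t <= b -> Cmod (phi' t) <= psi' t) ->
  Cmod (phi b - phi a) <= psi b - psi a.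
Proof.
  intros Hab Hphi Hpsi Hle.
  set (v := Cconj (phi b - phi a)).
  set (m := Cmod (phi b - phi a)).
  assert (Hm : 0 <= m) by apply Cmod_ge_0.
  assert (Hv : Cmod v = m) by apply Cmod_conj.
  set (r := fun t => Re (v * phi t) - m * psi t).
  assert (Dr : forall t, a <= t <= b -> is_derive r t (Re (v * phi' t) - m * psi' t)).
  { intros t Ht. apply (is_derive_minus (fun t => Re (v * phi t)) (fun t => m * psi t)).
    - apply rder_Re, der_scal, Hphi, Ht.
    - apply is_derive_scal, Hpsi, Ht. }
  assert (Hr : r b <= r a).
  { destruct (MVT_gen r a b (fun t => Re (v * phi' t) - m * psi' t)) as [c [Hc E]].
    - rewrite Rmin_left, Rmax_right by auto. intros; apply Dr; lra.
    - rewrite Rmin_left, Rmax_right by auto. intros x Hx.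
      apply (is_derive_continuity_pt r x _ (Dr x Hx)).
    - rewrite Rmin_left, Rmax_right in Hc by auto.
      pose proof (Re_le_Cmod (v * phi' c)) as T. rewrite Cmod_mult, Hv in T.
      specialize (Hle c Hc).
      assert (m * Cmod (phi' c) <= m * psi' c) by (apply Rmult_le_compat_l; auto). nra. }
  unfold r in Hr.
  assert (E : Re (v * phi b) - Re (v * phi a) = m * m).
  { rewrite <- Re_minus. replace (v * phi b - v * phi a)%C with ((phi b - phi a) * v)%C by ring.
    unfold v. rewrite <- Cmod2_conj. fold m. rewrite Re_RtoC. ring. }
  destruct (Rle_lt_or_eq_dec 0 m Hm) as [P|P].
  - nra.
  (* When the increment of [phi] is 0, what remains is [psi a <= psi b], which holds because [psi']
     dominates a modulus. *)
  - rewrite <- P. destruct (MVT_gen psi a b psi') as [c [Hc E']].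
    + rewrite Rmin_left, Rmax_right by auto. intros; apply Hpsi; lra.
    + rewrite Rmin_left, Rmax_right by auto. intros x Hx.
      apply (is_derive_continuity_pt psi x _ (Hpsi x Hx)).
    + rewrite Rmin_left, Rmax_right in Hc by auto.
      pose proof (Cmod_ge_0 (phi' c)). specialize (Hle c Hc). nra.
Qed.

Lemma curve_lipschitz (phi phi' : R -> C) (a b K : R) :
  a <= b ->
  (forall t, a <= t <= b -> rder phi t (phi' t)) ->
  (forall t, a <= t <= b -> Cmod (phi' t) <= K) ->
  Cmod (phi b - phi a) <= K * (b - a).
Proof.
  intros Hab Hp HK.
  replace (K * (b - a)) with (K * b - K * a) by ring.
  apply (curve_mean_value phi phi' (fun t => K * t) (fun _ => K)); auto.
  intros t _. auto_derive; [auto|ring].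
Qed.

Definition CInt (f : R -> C) (a b : R) : C :=
  (RInt (fun t => Re (f t)) a b, RInt (fun t => Im (f t)) a b).

Definition rcont_on (f : R -> C) (a b : R) : Prop := forall t, a <= t <= b -> rcont f t.

Lemma rcont_on_ex_Re (f : R -> C) (a b : R) :
  a <= b -> rcont_on f a b -> ex_RInt (fun t => Re (f t)) a b.
Proof.
  intros Hab H. apply (ex_RInt_continuous (V := R_CompleteNormedModule)).
  rewrite Rmin_left, Rmax_right by auto. intros; apply rcont_Re, H; auto.
Qed.

Lemma rcont_on_ex_Im (f : R -> C) (a b : R) :
  a <= b -> rcont_on f a b -> ex_RInt (fun t => Im (f t)) a b.
Proof.
  intros Hab H. apply (ex_RInt_continuous (V := R_CompleteNormedModule)).
  rewrite Rmin_left, Rmax_right by auto. intros; apply rcont_Im, H; auto.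
Qed.

Lemma CInt_ext (f g : R -> C) (a b : R) :
  a <= b -> (forall t, a <= t <= b -> f t = g t) -> CInt f a b = CInt g a b.
Proof.
  intros Hab E. unfold CInt. f_equal; apply RInt_ext; rewrite Rmin_left, Rmax_right by auto;
    intros t Ht; rewrite E; auto; lra.
Qed.

Lemma CInt_plus (f g : R -> C) (a b : R) :
  a <= b -> rcont_on f a b -> rcont_on g a b ->
  CInt (fun t => f t + g t)%C a b = (CInt f a b + CInt g a b)%C.
Proof.
  intros Hab Hf Hg. apply C_eq_intro; cbn.
  - apply (RInt_plus (fun t => Re (f t)) (fun t => Re (g t))); apply rcont_on_ex_Re; auto.
  - apply (RInt_plus (fun t => Im (f t)) (fun t => Im (g t))); apply rcont_on_ex_Im; auto.
Qed.

Lemma CInt_scal (k : C) (f : R -> C) (a b : R) :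
  a <= b -> rcont_on f a b -> CInt (fun t => k * f t)%C a b = (k * CInt f a b)%C.
Proof.
  intros Hab Hf.
  pose proof (rcont_on_ex_Re f a b Hab Hf) as ER. pose proof (rcont_on_ex_Im f a b Hab Hf) as EI.
  apply (RInt_correct (V := R_CompleteNormedModule)) in ER.
  apply (RInt_correct (V := R_CompleteNormedModule)) in EI.
  apply C_eq_intro; apply is_RInt_unique.
  - apply (is_RInt_minus (fun t => Re k * Re (f t)) (fun t => Im k * Im (f t)));
      [apply (is_RInt_scal _ _ _ (Re k) _ ER)|apply (is_RInt_scal _ _ _ (Im k) _ EI)].
  - apply (is_RInt_plus (fun t => Re k * Im (f t)) (fun t => Im k * Re (f t)));
      [apply (is_RInt_scal _ _ _ (Re k) _ EI)|apply (is_RInt_scal _ _ _ (Im k) _ ER)].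
Qed.

Lemma rcont_on_scal (k : C) (f : R -> C) (a b : R) : rcont_on f a b -> rcont_on (fun t => k * f t)%C a b.
Proof. intros H t Ht. apply cont_mult; [apply cont_const|auto]. Qed.

Lemma CInt_minus (f g : R -> C) (a b : R) :
  a <= b -> rcont_on f a b -> rcont_on g a b ->
  CInt (fun t => f t - g t)%C a b = (CInt f a b - CInt g a b)%C.
Proof.
  intros Hab Hf Hg.
  rewrite (CInt_ext _ (fun t => f t + (-1) * g t)%C) by (auto; intros; ring).
  rewrite CInt_plus by (auto; apply rcont_on_scal; auto).
  rewrite CInt_scal by auto. ring.
Qed.

Lemma CInt_const (k : C) (a b : R) : CInt (fun _ => k) a b = ((b - a)%R * k)%C.
Proof.
  apply C_eq_intro; rewrite ?Re_mult, ?Im_mult, Re_RtoC, Im_RtoC.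
  - transitivity ((b - a) * Re k); [|ring]. apply is_RInt_unique, (is_RInt_const a b (Re k)).
  - transitivity ((b - a) * Im k); [|ring]. apply is_RInt_unique, (is_RInt_const a b (Im k)).
Qed.

Lemma CInt_Chasles (f : R -> C) (a b c : R) :
  a <= b -> b <= c -> rcont_on f a c -> (CInt f a b + CInt f b c)%C = CInt f a c.
Proof.
  intros Hab Hbc H.
  assert (H1 : rcont_on f a b) by (intros t Ht; apply H; lra).
  assert (H2 : rcont_on f b c) by (intros t Ht; apply H; lra).
  apply C_eq_intro; cbn.
  - apply (RInt_Chasles (fun t => Re (f t))); apply rcont_on_ex_Re; auto.
  - apply (RInt_Chasles (fun t => Im (f t))); apply rcont_on_ex_Im; auto.
Qed.

(** Multiplying by the conjugate of the integral [I] turns [|I|^2] into the integral of a real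
    function that is at most [|I| * K]. *)
Lemma CInt_bound (f : R -> C) (a b K : R) :
  a <= b -> rcont_on f a b -> (forall t, a <= t <= b -> Cmod (f t) <= K) ->
  Cmod (CInt f a b) <= K * (b - a).
Proof.
  intros Hab Hf HK.
  set (I := CInt f a b). set (m := Cmod I).
  assert (Hm : 0 <= m) by apply Cmod_ge_0.
  assert (E : m * m = RInt (fun t => Re (Cconj I * f t)) a b).
  { replace (m * m) with (Re (Cconj I * I)).
    - unfold I at 2. rewrite <- CInt_scal by auto. reflexivity.
    - rewrite Cmult_comm, <- Cmod2_conj. fold m. rewrite Re_RtoC; ring. }
  assert (B : RInt (fun t => Re (Cconj I * f t)) a b <= RInt (fun _ => m * K) a b).
  { apply RInt_le; auto.
    - apply rcont_on_ex_Re; auto. apply rcont_on_scal; auto.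
    - apply ex_RInt_const.
    - intros t Ht. eapply Rle_trans; [apply Re_le_Cmod|].
      rewrite Cmod_mult, Cmod_conj. apply Rmult_le_compat_l; auto. apply HK; lra. }
  replace (RInt (fun _ => m * K) a b) with ((b - a) * (m * K)) in B
    by (symmetry; apply is_RInt_unique, (is_RInt_const a b (m * K))).
  rewrite <- E in B. pose proof (HK a ltac:(lra)) as H1. pose proof (Cmod_ge_0 (f a)).
  assert (0 <= K * (b - a)) by (apply Rmult_le_pos; lra).
  destruct (Rle_lt_or_eq_dec 0 m Hm) as [P|P]; nra.
Qed.

Lemma CInt_rder (phi phi' : R -> C) (a b : R) :
  a <= b -> (forall t, a <= t <= b -> rder phi t (phi' t)) -> rcont_on phi' a b ->
  CInt phi' a b = (phi b - phi a)%C.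
Proof.
  intros Hab Hd Hc. apply C_eq_intro; apply is_RInt_unique.
  - apply (is_RInt_derive (fun t => Re (phi t)) (fun t => Re (phi' t))); rewrite Rmin_left, Rmax_right by auto;
      intros; [apply rder_Re, Hd|apply rcont_Re, Hc]; auto.
  - apply (is_RInt_derive (fun t => Im (phi t)) (fun t => Im (phi' t))); rewrite Rmin_left, Rmax_right by auto;
      intros; [apply rder_Im, Hd|apply rcont_Im, Hc]; auto.
Qed.

(** * Goursat's theorem on parametrized rectangles *)

Lemma curve_lipschitz_abs (phi phi' : R -> C) (a b K s t : R) :
  (forall r, a <= r <= b -> rder phi r (phi' r)) ->
  (forall r, a <= r <= b -> Cmod (phi' r) <= K) ->
  a <= s <= b -> a <= t <= b -> Cmod (phi t - phi s) <= K * Rabs (t - s).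
Proof.
  intros Hp HK Hs Ht. destruct (Rle_dec s t) as [E|E].
  - rewrite Rabs_pos_eq by lra. apply (curve_lipschitz phi phi'); auto; intros; [apply Hp|apply HK]; lra.
  - rewrite Cmod_sub_sym, Rabs_minus_sym, Rabs_pos_eq by lra.
    apply (curve_lipschitz phi phi'); [lra| |]; intros; [apply Hp|apply HK]; lra.
Qed.

(** The affine approximation of [f] at [p] has the primitive [c0 z + c1 (z - p)^2 / 2], so its
    integral along an edge is an exact increment, and such increments cancel around a closed
    contour. Only the error survives: at most [eta * D] pointwise, times the length
    [K * (b - a)]. *)
Lemma affine_edge (f : C -> C) (w w' : R -> C) (a b : R) (c0 c1 p : C) (eta D K : R) :
  a <= b -> 0 <= eta ->
  (forall t, a <= t <= b -> rder w t (w' t)) -> rcont_on w' a b ->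
  rcont_on (fun t => f (w t)) a b ->
  (forall t, a <= t <= b -> Cmod (w' t) <= K) ->
  (forall t, a <= t <= b -> Cmod (w t - p) <= D) ->
  (forall t, a <= t <= b -> Cmod (f (w t) - c0 - c1 * (w t - p)) <= eta * Cmod (w t - p)) ->
  Cmod (CInt (fun t => f (w t) * w' t)%C a b
        - ((c0 * w b + c1 * ((w b - p) * (w b - p)) / 2) - (c0 * w a + c1 * ((w a - p) * (w a - p)) / 2)))
  <= eta * D * K * (b - a).
Proof.
  intros Hab He Hw Cw' Cfw HK HD HE.
  set (g := fun t => ((c0 + c1 * (w t - p)) * w' t)%C).
  assert (Cw : rcont_on w a b) by (intros t Ht; apply (der_cont _ _ _ _ (Hw t Ht))).
  assert (Cg : rcont_on g a b).
  { intros t Ht. apply cont_mult; [|auto]. apply cont_plus; [apply cont_const|].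
    apply cont_mult; [apply cont_const|apply cont_minus; [auto|apply cont_const]]. }
  assert (Cf : rcont_on (fun t => f (w t) * w' t)%C a b).
  { intros t Ht. apply cont_mult; auto. }
  assert (Ig : CInt g a b = ((c0 * w b + c1 * ((w b - p) * (w b - p)) / 2) - (c0 * w a + c1 * ((w a - p) * (w a - p)) / 2))%C).
  { apply (CInt_rder (fun t => c0 * w t + c1 * ((w t - p) * (w t - p)) / 2)%C g a b); auto.
    intros t Ht. specialize (Hw t Ht).
    assert (Hm : rder (fun s => w s - p)%C t (w' t - 0)%C) by (apply der_minus; [auto|apply der_const]).
    eapply der_ext; [| |apply der_plus; [apply (der_scal _ _ c0 _ _ Hw)|
      apply (der_scal _ _ (c1 / 2) _ _ (der_mult _ _ _ _ _ _ Hm Hm))]].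
    - intros y; cbn. field.
    - unfold g; cbn. field. }
  rewrite <- Ig, <- CInt_minus by auto.
  apply CInt_bound; auto.
  - intros t Ht. apply cont_minus; auto.
  - intros t Ht. unfold g.
    replace (f (w t) * w' t - (c0 + c1 * (w t - p)) * w' t)%C
      with ((f (w t) - c0 - c1 * (w t - p)) * w' t)%C by ring.
    rewrite Cmod_mult. apply Rmult_le_compat; auto using Cmod_ge_0.
    eapply Rle_trans; [apply HE; auto|]. apply Rmult_le_compat_l; auto.
Qed.

(** The compactness part of a quadrisection: [P n s t] marks the cell of generation [n] with lower
    left corner [(s, t)], every marked cell has a marked quarter, and a descending chain of them has
    a common point. *)
Lemma nested_squares (P : nat -> R -> R -> Prop) (a c l m : R) :
  0 <= l -> 0 <= m -> P O a c ->
  (forall n s t, P n s t -> exists s' t', P (S n) s' t' /\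
     (s' = s \/ s' = s + l / 2 ^ S n) /\ (t' = t \/ t' = t + m / 2 ^ S n)) ->
  exists s0 t0, forall n, exists s t, P n s t /\
     s <= s0 <= s + l / 2 ^ n /\ t <= t0 <= t + m / 2 ^ n.
Proof.
  intros Hl Hm H0 Hstep.
  (* Marked cells of all generations are gathered in one type, so that the choice of a marked
     quarter is a map of this type to itself that can be iterated. *)
  set (Q := fun x : nat * (R * R) => P (fst x) (fst (snd x)) (snd (snd x))).
  assert (ST : forall x : sig Q, {y : sig Q |
     fst (proj1_sig y) = S (fst (proj1_sig x)) /\
     (fst (snd (proj1_sig y)) = fst (snd (proj1_sig x)) \/
      fst (snd (proj1_sig y)) = fst (snd (proj1_sig x)) + l / 2 ^ S (fst (proj1_sig x))) /\
     (snd (snd (proj1_sig y)) = snd (snd (proj1_sig x)) \/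
      snd (snd (proj1_sig y)) = snd (snd (proj1_sig x)) + m / 2 ^ S (fst (proj1_sig x)))}).
  { intros [[n [s t]] Hx]. apply constructive_indefinite_description.
    destruct (Hstep n s t Hx) as [s' [t' [Hp [Es Et]]]].
    exists (exist Q (S n, (s', t')) Hp); cbn; auto. }
  assert (NX : exists next : sig Q -> sig Q, forall x,
     fst (proj1_sig (next x)) = S (fst (proj1_sig x)) /\
     (fst (snd (proj1_sig (next x))) = fst (snd (proj1_sig x)) \/
      fst (snd (proj1_sig (next x))) = fst (snd (proj1_sig x)) + l / 2 ^ S (fst (proj1_sig x))) /\
     (snd (snd (proj1_sig (next x))) = snd (snd (proj1_sig x)) \/
      snd (snd (proj1_sig (next x))) = snd (snd (proj1_sig x)) + m / 2 ^ S (fst (proj1_sig x))))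
    by (exists (fun x => proj1_sig (ST x)); intros x; apply (proj2_sig (ST x))).
  destruct NX as [next NX].
  set (sq := fix sq n := match n with O => exist Q (O, (a, c)) H0 | S k => next (sq k) end).
  set (s := fun n => fst (snd (proj1_sig (sq n)))).
  set (t := fun n => snd (snd (proj1_sig (sq n)))).
  assert (Ix : forall n, fst (proj1_sig (sq n)) = n).
  { induction n as [|n IH]; [reflexivity|]. change (fst (proj1_sig (next (sq n))) = S n).
    destruct (NX (sq n)) as [E _]. rewrite E. f_equal. exact IH. }
  assert (Hp : forall n, P n (s n) (t n)).
  { intros n. pose proof (proj2_sig (sq n)) as H. unfold Q in H. rewrite Ix in H. exact H. }
  assert (Ss : forall n, s (S n) = s n \/ s (S n) = s n + l / 2 ^ S n).
  { intros n. destruct (NX (sq n)) as [_ [E _]]. rewrite (Ix n) in E. exact E. }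
  assert (Stt : forall n, t (S n) = t n \/ t (S n) = t n + m / 2 ^ S n).
  { intros n. destruct (NX (sq n)) as [_ [_ E]]. rewrite (Ix n) in E. exact E. }
  (* In each coordinate the left ends increase and the right ends decrease, so the supremum of the
     left ends lies in all the intervals. *)
  assert (Lim : forall (u : nat -> R) (k : R), 0 <= k ->
    (forall n, u (S n) = u n \/ u (S n) = u n + k / 2 ^ S n) ->
    exists u0, forall n, u n <= u0 <= u n + k / 2 ^ n).
  { intros u k Hk Hu.
    assert (Hhalf : forall n, k / 2 ^ n = 2 * (k / 2 ^ S n)).
    { intros n. cbn. field. apply pow_nonzero; lra. }
    assert (Hpos : forall n, 0 <= k / 2 ^ n).
    { intros n. apply Rdiv_le_0_compat; [auto|apply pow_lt; lra]. }
    assert (Mono : forall n j, u n <= u (n + j)%nat /\ u (n + j)%nat + k / 2 ^ (n + j) <= u n + k / 2 ^ n).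
    { intros n. induction j as [|j [I1 I2]]; [rewrite Nat.add_0_r; lra|].
      rewrite Nat.add_succ_r. specialize (Hu (n + j)%nat). specialize (Hhalf (n + j)%nat).
      specialize (Hpos (S (n + j))). destruct Hu as [E|E]; rewrite E; lra. }
    assert (Up : forall n j, u j <= u n + k / 2 ^ n).
    { intros n j. destruct (Nat.le_ge_cases n j) as [E|E].
      - replace j with (n + (j - n))%nat by lia. destruct (Mono n (j - n)%nat). specialize (Hpos (n + (j - n))%nat). lra.
      - replace n with (j + (n - j))%nat by lia. destruct (Mono j (n - j)%nat). specialize (Hpos (j + (n - j))%nat). lra. }
    destruct (completeness (fun x => exists n, x = u n)) as [u0 [Hub Hlub]].
    - exists (u O + k / 2 ^ 0). intros x [n ->]. apply Up.
    - exists (u O), O; auto.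
    - exists u0. intros n; split; [apply Hub; exists n; auto|].
      apply Hlub. intros x [j ->]. apply Up. }
  destruct (Lim s l Hl Ss) as [s0 Hs0]. destruct (Lim t m Hm Stt) as [t0 Ht0].
  exists s0, t0; intros n; exists (s n), (t n); auto.
Qed.

(** Each partial derivative is continuous in its own variable, which makes the edge integrals
    meaningful; the common bound [K] makes the images of small cells small. Injectivity is not part
    of the notion: in the applications the patch closes up on itself or collapses a side. *)
Definition patch (Phi Phis Phit : R -> R -> C) (a b c d K : R) : Prop :=
  forall s t, a <= s <= b -> c <= t <= d ->
    rder (fun s => Phi s t) s (Phis s t) /\ rder (fun t => Phi s t) t (Phit s t) /\
    rcont (fun s => Phis s t) s /\ rcont (fun t => Phit s t) t /\
    Cmod (Phis s t) <= K /\ Cmod (Phit s t) <= K.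

Definition boundary_integral (f : C -> C) (Phi Phis Phit : R -> R -> C) (a b c d : R) : C :=
  (CInt (fun s => f (Phi s c) * Phis s c)%C a b + CInt (fun t => f (Phi b t) * Phit b t)%C c d
   - CInt (fun s => f (Phi s d) * Phis s d)%C a b - CInt (fun t => f (Phi a t) * Phit a t)%C c d)%C.

Lemma patch_sub (Phi Phis Phit : R -> R -> C) (a b c d K a' b' c' d' : R) :
  patch Phi Phis Phit a b c d K -> a <= a' -> b' <= b -> c <= c' -> d' <= d ->
  patch Phi Phis Phit a' b' c' d' K.
Proof. intros H Ha Hb Hc Hd s t Hs Ht. apply H; lra. Qed.

Lemma patch_cont (f : C -> C) (Phi Phis Phit : R -> R -> C) (a b c d K : R) :
  patch Phi Phis Phit a b c d K ->
  (forall s t, a <= s <= b -> c <= t <= d -> ccont f (Phi s t)) ->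
  (forall t, c <= t <= d -> rcont_on (fun s => f (Phi s t) * Phis s t)%C a b) /\
  (forall s, a <= s <= b -> rcont_on (fun t => f (Phi s t) * Phit s t)%C c d).
Proof.
  intros HP Hf. split.
  - intros t Ht s Hs. destruct (HP s t Hs Ht) as [D1 [_ [C1 _]]].
    apply cont_mult; [|auto]. apply (cont_comp RtoC (fun s => Phi s t) f); auto.
    apply (der_cont _ _ _ _ D1).
  - intros s Hs t Ht. destruct (HP s t Hs Ht) as [_ [D1 [_ [C1 _]]]].
    apply cont_mult; [|auto]. apply (cont_comp RtoC (fun t => Phi s t) f); auto.
    apply (der_cont _ _ _ _ D1).
Qed.

(** Every inner edge is traversed twice, in opposite directions. *)
Lemma boundary_integral_split (f : C -> C) (Phi Phis Phit : R -> R -> C) (a e b c g d K : R) :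
  patch Phi Phis Phit a b c d K ->
  (forall s t, a <= s <= b -> c <= t <= d -> ccont f (Phi s t)) ->
  a <= e <= b -> c <= g <= d ->
  boundary_integral f Phi Phis Phit a b c d =
  (boundary_integral f Phi Phis Phit a e c g + boundary_integral f Phi Phis Phit a e g d
   + boundary_integral f Phi Phis Phit e b c g + boundary_integral f Phi Phis Phit e b g d)%C.
Proof.
  intros HP Hf He Hg. destruct (patch_cont f _ _ _ _ _ _ _ _ HP Hf) as [C1 C2].
  unfold boundary_integral.
  rewrite <- (CInt_Chasles (fun s => f (Phi s c) * Phis s c)%C a e b) by (try apply C1; lra).
  rewrite <- (CInt_Chasles (fun s => f (Phi s d) * Phis s d)%C a e b) by (try apply C1; lra).
  rewrite <- (CInt_Chasles (fun t => f (Phi a t) * Phit a t)%C c g d) by (try apply C2; lra).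
  rewrite <- (CInt_Chasles (fun t => f (Phi b t) * Phit b t)%C c g d) by (try apply C2; lra).
  ring.
Qed.

(** Quadrisection: if the integral has modulus [J > 0], some chain of cells carries at least
    [J / 4 ^ n] each. Near the common point, differentiability bounds the same integrals by [eta]
    times diameter times perimeter, which is also of order [4 ^ -n]; a small [eta] gives the
    contradiction. *)
Lemma goursat (f : C -> C) (Phi Phis Phit : R -> R -> C) (a b c d K : R) :
  a <= b -> c <= d ->
  patch Phi Phis Phit a b c d K ->
  (forall s t, a <= s <= b -> c <= t <= d -> exists l, cder f (Phi s t) l) ->
  boundary_integral f Phi Phis Phit a b c d = 0%C.
Proof.
  intros Hab Hcd HP Hf.
  assert (Cf : forall s t, a <= s <= b -> c <= t <= d -> ccont f (Phi s t)).
  { intros s t Hs Ht. destruct (Hf s t Hs Ht) as [l Hl]. apply (der_cont _ _ _ _ Hl). }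
  set (BI := boundary_integral f Phi Phis Phit).
  destruct (Ceq_dec (BI a b c d) 0%C) as [E|NE]; [exact E|exfalso].
  apply Cmod_gt_0 in NE. set (J := Cmod (BI a b c d)) in *.
  set (l := b - a). set (m := d - c).
  assert (Hl : 0 <= l) by (unfold l; lra). assert (Hm : 0 <= m) by (unfold m; lra).
  assert (HK : 0 <= K).
  { destruct (HP a c ltac:(lra) ltac:(lra)) as [_ [_ [_ [_ [B _]]]]]. pose proof (Cmod_ge_0 (Phis a c)). lra. }
  assert (P2 : forall n, 0 < 2 ^ n) by (intros; apply pow_lt; lra).
  assert (Hhalf : forall k n, k / 2 ^ n = 2 * (k / 2 ^ S n)).
  { intros k n. cbn. field. apply pow_nonzero; lra. }
  destruct (nested_squares (fun n s t =>
     a <= s /\ s + l / 2 ^ n <= b /\ c <= t /\ t + m / 2 ^ n <= d /\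
     J / 4 ^ n <= Cmod (BI s (s + l / 2 ^ n) t (t + m / 2 ^ n))) a c l m) as [s0 [t0 H0]]; auto.
  - cbn. unfold Rdiv. rewrite Rinv_1, !Rmult_1_r. unfold l, m.
    replace (a + (b - a)) with b by ring. replace (c + (d - c)) with d by ring.
    fold J. lra.
  - intros n s t [B1 [B2 [B3 [B4 B5]]]].
    rewrite (Hhalf l n), (Hhalf m n) in *.
    set (x := l / 2 ^ S n) in *. set (y := m / 2 ^ S n) in *.
    assert (Hx : 0 <= x) by (apply Rdiv_le_0_compat; auto).
    assert (Hy : 0 <= y) by (apply Rdiv_le_0_compat; auto).
    unfold BI in B5.
    rewrite (boundary_integral_split f Phi Phis Phit s (s + x) (s + 2 * x) t (t + y) (t + 2 * y) K) in B5;
      [|apply (patch_sub _ _ _ a b c d); auto; lra|intros; apply Cf; lra|lra|lra].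
    fold BI in B5.
    replace (s + 2 * x) with (s + x + x) in * by ring. replace (t + 2 * y) with (t + y + y) in * by ring.
    assert (HJ : J / 4 ^ n = 4 * (J / 4 ^ S n)) by (cbn; field; apply pow_nonzero; lra).
    rewrite HJ in B5. set (q := J / 4 ^ S n) in *.
    pose proof (Cmod_triangle (BI s (s + x) t (t + y) + BI s (s + x) (t + y) (t + y + y) + BI (s + x) (s + x + x) t (t + y)) (BI (s + x) (s + x + x) (t + y) (t + y + y))) as T1.
    pose proof (Cmod_triangle (BI s (s + x) t (t + y) + BI s (s + x) (t + y) (t + y + y)) (BI (s + x) (s + x + x) t (t + y))) as T2.
    pose proof (Cmod_triangle (BI s (s + x) t (t + y)) (BI s (s + x) (t + y) (t + y + y))) as T3.
    destruct (Rle_dec q (Cmod (BI s (s + x) t (t + y)))) as [G|G1];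
      [exists s, t; repeat split; auto; lra|].
    destruct (Rle_dec q (Cmod (BI s (s + x) (t + y) (t + y + y)))) as [G|G2];
      [exists s, (t + y); repeat split; auto; lra|].
    destruct (Rle_dec q (Cmod (BI (s + x) (s + x + x) t (t + y)))) as [G|G3];
      [exists (s + x), t; repeat split; auto; lra|].
    exists (s + x), (t + y); repeat split; auto; lra.
  - assert (Hs0 : a <= s0 <= b /\ c <= t0 <= d).
    { destruct (H0 O) as [s [t [[B1 [B2 [B3 [B4 _]]]] [I1 I2]]]]. lra. }
    destruct (Hf s0 t0) as [f' Hf']; [tauto|tauto|].
    (* The final estimate will read [J <= eta * (2 * (K * K * (l + m) * (l + m)))]; the added 1
       makes it false and keeps the denominator positive. *)
    set (eta := J / (2 * (K * K * (l + m) * (l + m)) + 1)).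
    assert (HD : 0 <= K * K * (l + m) * (l + m)) by (repeat apply Rmult_le_pos; lra).
    assert (Heta : 0 < eta) by (apply Rdiv_lt_0_compat; lra).
    destruct (Hf' eta Heta) as [r [Hr Kr]]. unfold Cid in Kr.
    destruct (archimed_cor1 (r / (K * (l + m) + 1))) as [n [Hn1 Hn2]].
    { apply Rdiv_lt_0_compat; [auto|]. assert (0 <= K * (l + m)) by (apply Rmult_le_pos; lra). lra. }
    set (D := K * (l + m) / 2 ^ n).
    assert (HDr : D < r).
    (* Bernoulli's inequality converts the archimedean bound on [1 / n] into one on [1 / 2 ^ n], so
       that the image of the cell fits into the disc where the estimate with [eta] holds. *)
    { assert (N1 : INR n < 2 ^ n) by (pose proof (poly n 1 ltac:(lra)) as PP; replace (1 + 1) with 2 in PP by ring; lra).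
      assert (0 < INR n) by (apply lt_0_INR; auto).
      assert (Q0 : 0 <= K * (l + m)) by (apply Rmult_le_pos; lra).
      assert (N2 : / 2 ^ n < / INR n) by (apply Rinv_lt_contravar; [apply Rmult_lt_0_compat; auto|auto]).
      assert (N3 : / 2 ^ n < r / (K * (l + m) + 1)) by lra.
      assert (0 < / 2 ^ n) by (apply Rinv_0_lt_compat; auto).
      assert (N4 : / 2 ^ n * (K * (l + m) + 1) < r) by (apply Rlt_div_r; lra).
      unfold D, Rdiv. nra. }
    destruct (H0 n) as [s [t [[B1 [B2 [B3 [B4 B5]]]] [I1 I2]]]].
    set (x := l / 2 ^ n) in *. set (y := m / 2 ^ n) in *.
    assert (Hx : 0 <= x) by (apply Rdiv_le_0_compat; auto).
    assert (Hy : 0 <= y) by (apply Rdiv_le_0_compat; auto).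
    set (p := Phi s0 t0).
    assert (Dist : forall s' t', s <= s' <= s + x -> t <= t' <= t + y -> Cmod (Phi s' t' - p) <= D).
    { intros s' t' Hs' Ht'. unfold p.
      replace (Phi s' t' - Phi s0 t0)%C with ((Phi s' t' - Phi s0 t') + (Phi s0 t' - Phi s0 t0))%C by ring.
      eapply Rle_trans; [apply Cmod_triangle|].
      pose proof (curve_lipschitz_abs (fun s => Phi s t') (fun s => Phis s t') a b K s0 s') as L1.
      pose proof (curve_lipschitz_abs (fun t => Phi s0 t) (fun t => Phit s0 t) c d K t0 t') as L2.
      cbn in L1, L2.
      assert (M1 : Rabs (s' - s0) <= x) by (apply Rabs_le; lra).
      assert (M2 : Rabs (t' - t0) <= y) by (apply Rabs_le; lra).
      assert (M3 : Cmod (Phi s' t' - Phi s0 t') <= K * Rabs (s' - s0)).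
      { apply L1; [| |tauto|lra]; intros r' Hr'; apply (HP r' t'); lra. }
      assert (M4 : Cmod (Phi s0 t' - Phi s0 t0) <= K * Rabs (t' - t0)).
      { apply L2; [| |tauto|lra]; intros r' Hr'; apply (HP s0 r'); lra. }
      assert (K * Rabs (s' - s0) <= K * x) by (apply Rmult_le_compat_l; auto).
      assert (K * Rabs (t' - t0) <= K * y) by (apply Rmult_le_compat_l; auto).
      replace D with (K * x + K * y) by (unfold D, x, y; field; apply pow_nonzero; lra). lra. }
    assert (Est : forall s' t', s <= s' <= s + x -> t <= t' <= t + y ->
      Cmod (f (Phi s' t') - f p - f' * (Phi s' t' - p)) <= eta * Cmod (Phi s' t' - p)).
    { intros s' t' Hs' Ht'. apply Kr. eapply Rle_lt_trans; [apply Dist; auto|exact HDr]. }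
    set (A := fun z => (f p * z + f' * ((z - p) * (z - p)) / 2)%C).
    assert (ES : forall t', t <= t' <= t + y ->
      Cmod (CInt (fun s' => f (Phi s' t') * Phis s' t')%C s (s + x) - (A (Phi (s + x) t') - A (Phi s t'))) <= eta * D * K * x).
    { intros t' Ht'. replace (eta * D * K * x) with (eta * D * K * (s + x - s)) by ring.
      apply (affine_edge f (fun s' => Phi s' t') (fun s' => Phis s' t') s (s + x) (f p) f' p eta D K); try lra;
      try (intros s' Hs'; apply (HP s' t'); lra); auto.
      intros s' Hs'. apply (cont_comp RtoC (fun s' => Phi s' t') f).
      - destruct (HP s' t' ltac:(lra) ltac:(lra)) as [D1 _]. apply (der_cont _ _ _ _ D1).
      - apply Cf; lra. }
    assert (ET : forall s', s <= s' <= s + x ->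
      Cmod (CInt (fun t' => f (Phi s' t') * Phit s' t')%C t (t + y) - (A (Phi s' (t + y)) - A (Phi s' t))) <= eta * D * K * y).
    { intros s' Hs'. replace (eta * D * K * y) with (eta * D * K * (t + y - t)) by ring.
      apply (affine_edge f (fun t' => Phi s' t') (fun t' => Phit s' t') t (t + y) (f p) f' p eta D K); try lra;
      try (intros t' Ht'; apply (HP s' t'); lra); auto.
      intros t' Ht'. apply (cont_comp RtoC (fun t' => Phi s' t') f).
      - destruct (HP s' t' ltac:(lra) ltac:(lra)) as [_ [D1 _]]. apply (der_cont _ _ _ _ D1).
      - apply Cf; lra. }
    pose proof (ES t ltac:(lra)) as E1. pose proof (ES (t + y) ltac:(lra)) as E2.
    pose proof (ET s ltac:(lra)) as E3. pose proof (ET (s + x) ltac:(lra)) as E4.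
    unfold BI, boundary_integral in B5.
    set (i1 := CInt (fun s' => f (Phi s' t) * Phis s' t)%C s (s + x)) in *.
    set (i2 := CInt (fun t' => f (Phi (s + x)%R t') * Phit (s + x)%R t')%C t (t + y)) in *.
    set (i3 := CInt (fun s' => f (Phi s' (t + y)%R) * Phis s' (t + y)%R)%C s (s + x)) in *.
    set (i4 := CInt (fun t' => f (Phi s t') * Phit s t')%C t (t + y)) in *.
    set (u1 := (i1 - (A (Phi (s + x)%R t) - A (Phi s t)))%C) in *.
    set (u3 := (i3 - (A (Phi (s + x)%R (t + y)%R) - A (Phi s (t + y)%R)))%C) in *.
    set (u4 := (i4 - (A (Phi s (t + y)%R) - A (Phi s t)))%C) in *.
    set (u2 := (i2 - (A (Phi (s + x)%R (t + y)%R) - A (Phi (s + x)%R t)))%C) in *.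
    (* The increments of the primitive [A] cancel around the cell, leaving the four edge errors. *)
    replace (i1 + i2 - i3 - i4)%C with (u1 + u2 - u3 - u4)%C in B5 by (unfold u1, u2, u3, u4; ring).
    pose proof (Cmod_minus_le (u1 + u2 - u3) u4). pose proof (Cmod_minus_le (u1 + u2) u3).
    pose proof (Cmod_triangle u1 u2).
    assert (Fin : J / 4 ^ n <= 2 * (eta * D * K * (x + y))) by lra.
    assert (E44 : 4 ^ n = 2 ^ n * 2 ^ n).
    { rewrite <- Rpow_mult_distr. f_equal; lra. }
    replace (2 * (eta * D * K * (x + y))) with (eta * (2 * (K * K * (l + m) * (l + m))) / 4 ^ n) in Fin
      by (unfold D, x, y; rewrite E44; field; apply pow_nonzero; lra).
    assert (P4 : 0 < 4 ^ n) by (apply pow_lt; lra).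
    assert (Fin2 : J <= eta * (2 * (K * K * (l + m) * (l + m)))).
    { apply (Rmult_le_compat_r (4 ^ n)) in Fin; [|lra].
      replace (J / 4 ^ n * 4 ^ n) with J in Fin by (field; lra).
      replace (eta * (2 * (K * K * (l + m) * (l + m))) / 4 ^ n * 4 ^ n) with (eta * (2 * (K * K * (l + m) * (l + m)))) in Fin by (field; lra).
      exact Fin. }
    assert (E : eta * (2 * (K * K * (l + m) * (l + m)) + 1) = J) by (unfold eta; field; lra).
    lra.
Qed.

(** * The complex exponential *)

Definition cexp (z : C) : C := (exp (Re z) * cos (Im z), exp (Re z) * sin (Im z)).
Definition cis (t : R) : C := (cos t, sin t).

Lemma cexp_plus (z w : C) : cexp (z + w) = (cexp z * cexp w)%C.
Proof.
  apply C_eq_intro; rewrite ?Re_mult, ?Im_mult; unfold cexp, Re, Im; cbn;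
    rewrite exp_plus, ?cos_plus, ?sin_plus; ring.
Qed.

Lemma cexp_RtoC (x : R) : cexp x = RtoC (exp x).
Proof. apply C_eq_intro; unfold cexp, RtoC, Re, Im; cbn; rewrite ?cos_0, ?sin_0; ring. Qed.

Lemma cexp_0 : cexp 0 = 1%C.
Proof. rewrite cexp_RtoC, exp_0; auto. Qed.

Lemma Cmod_cis (t : R) : Cmod (cis t) = 1.
Proof.
  unfold Cmod, cis; cbn. replace (cos t * (cos t * 1) + sin t * (sin t * 1)) with 1; [apply sqrt_1|].
  pose proof (sin2_cos2 t) as H; unfold Rsqr in H; lra.
Qed.

Lemma cexp_polar (z : C) : cexp z = (RtoC (exp (Re z)) * cis (Im z))%C.
Proof. apply C_eq_intro; unfold cexp, cis, RtoC, Re, Im; cbn; ring. Qed.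

Lemma Cmod_cexp (z : C) : Cmod (cexp z) = exp (Re z).
Proof.
  rewrite cexp_polar, Cmod_mult, Cmod_cis, Cmod_R, Rmult_1_r.
  apply Rabs_pos_eq, Rlt_le, exp_pos.
Qed.

Lemma cexp_neq_0 (z : C) : cexp z <> 0%C.
Proof. apply Cmod_gt_0. rewrite Cmod_cexp. apply exp_pos. Qed.

Lemma cexp_opp (z : C) : cexp (- z) = (/ cexp z)%C.
Proof.
  assert (E : (cexp (- z) * cexp z = 1)%C).
  { rewrite <- cexp_plus. replace (- z + z)%C with (RtoC 0) by ring. apply cexp_0. }
  replace (/ cexp z)%C with (1 * / cexp z)%C by ring. rewrite <- E.
  field. apply cexp_neq_0.
Qed.

Lemma cexp_conj (z : C) : cexp (Cconj z) = Cconj (cexp z).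
Proof. apply C_eq_intro; unfold cexp, Cconj, Re, Im; cbn; rewrite ?cos_neg, ?sin_neg; ring. Qed.

Lemma rder_pair (f g : R -> R) (t a b : R) :
  is_derive f t a -> is_derive g t b -> rder (fun s => (f s, g s)) t (a, b).
Proof.
  intros Hf Hg.
  eapply der_ext; [| |apply der_plus; [apply (rder_of_real f t a Hf)|apply (der_scal _ _ Ci _ _ (rder_of_real g t b Hg))]].
  - intros s. apply C_eq_intro; unfold Ci, Re, Im; cbn; ring.
  - apply C_eq_intro; unfold Ci, Re, Im; cbn; ring.
Qed.

Lemma rder_cexp_line (w : C) (t : R) : rder (fun s => cexp (RtoC s * w)) t (w * cexp (RtoC t * w))%C.
Proof.
  destruct w as [x y].
  eapply der_ext; [| |apply (rder_pair (fun s => exp (s * x) * cos (s * y)) (fun s => exp (s * x) * sin (s * y)) t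
    (exp (t * x) * (x * cos (t * y) - y * sin (t * y))) (exp (t * x) * (x * sin (t * y) + y * cos (t * y))))].
  - intros s. apply C_eq_intro; unfold cexp, Re, Im; cbn; rewrite !Rmult_0_l, Rplus_0_r, Rminus_0_r; reflexivity.
  - apply C_eq_intro.
    + unfold cexp, Re, Im; cbn; rewrite !Rmult_0_l, Rplus_0_r, Rminus_0_r; ring.
    + unfold cexp, Re, Im; cbn; rewrite !Rmult_0_l, Rplus_0_r, Rminus_0_r; ring.
  - auto_derive; [auto|ring].
  - auto_derive; [auto|ring].
Qed.

Lemma Cmod_cexp_line (w : C) (t : R) : 0 <= t -> Cmod (cexp (RtoC t * w)) <= exp (t * Cmod w).
Proof.
  intros Ht. rewrite Cmod_cexp, Re_mult, Re_RtoC, Im_RtoC.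
  pose proof (Re_le_Cmod w) as H. apply (Rmult_le_compat_l t) in H; auto.
  destruct (Rle_lt_or_eq_dec (t * Re w - 0 * Im w) (t * Cmod w)) as [E|E]; [lra| |rewrite E; lra].
  apply Rlt_le, exp_increasing, E.
Qed.

Lemma Cmod_cexp_minus_1 (w : C) : Cmod (cexp w - 1) <= exp (Cmod w) - 1.
Proof.
  pose proof (curve_mean_value (fun t => cexp (RtoC t * w)) (fun t => (w * cexp (RtoC t * w))%C)
    (fun t => exp (t * Cmod w)) (fun t => Cmod w * exp (t * Cmod w)) 0 1) as H; cbn beta in H.
  rewrite Rmult_0_l, exp_0, Rmult_1_l in H.
  replace (1 * w)%C with w in H by ring. replace (0 * w)%C with (RtoC 0) in H by ring.
  rewrite cexp_0 in H. apply H; [lra| | |].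
  - intros; apply rder_cexp_line.
  - intros; auto_derive; [auto|ring].
  - intros t Ht. rewrite Cmod_mult. apply Rmult_le_compat_l; [apply Cmod_ge_0|].
    apply Cmod_cexp_line; lra.
Qed.

(** The power series majorant, obtained without series: along the segment [t * w] the derivative is
    controlled by the bound on [cexp w - 1], which is itself the same argument one order lower. *)
Lemma Cmod_cexp_minus_1_minus (w : C) : Cmod (cexp w - 1 - w) <= exp (Cmod w) - 1 - Cmod w.
Proof.
  pose proof (curve_mean_value (fun t => cexp (RtoC t * w) - RtoC t * w)%C (fun t => (w * cexp (RtoC t * w) - w)%C)
    (fun t => exp (t * Cmod w) - t * Cmod w) (fun t => Cmod w * exp (t * Cmod w) - Cmod w) 0 1) as H; cbn beta in H.
  rewrite !Rmult_0_l, exp_0, Rmult_1_l in H.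
  replace (1 * w)%C with w in H by ring. replace (0 * w)%C with (RtoC 0) in H by ring.
  rewrite cexp_0 in H.
  replace (cexp w - 1 - w)%C with (cexp w - w - (1 - 0))%C by ring.
  replace (exp (Cmod w) - 1 - Cmod w) with (exp (Cmod w) - Cmod w - (1 - 0)) by ring.
  apply H; [lra| | |].
  - intros t _. apply der_minus; [apply rder_cexp_line|].
    eapply der_ext; [| |apply (der_scal RtoC RtoC w t), (der_id RtoC)]; [intros; cbn; ring|cbn; ring].
  - intros; auto_derive; [auto|ring].
  - intros t Ht. replace (w * cexp (RtoC t * w) - w)%C with (w * (cexp (RtoC t * w) - 1))%C by ring.
    rewrite Cmod_mult. replace (Cmod w * exp (t * Cmod w) - Cmod w) with (Cmod w * (exp (t * Cmod w) - 1)) by ring.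
    apply Rmult_le_compat_l; [apply Cmod_ge_0|].
    eapply Rle_trans; [apply Cmod_cexp_minus_1|].
    rewrite Cmod_mult, Cmod_R, Rabs_pos_eq by lra. lra.
Qed.

(** The addition formula moves the question to 0, where the majorant reduces it to the derivative of
    the real exponential. *)
Lemma cder_cexp (z : C) : cder cexp z (cexp z).
Proof.
  intros eps He. unfold Cid.
  set (m := Cmod (cexp z)). assert (Hm : 0 < m) by (unfold m; rewrite Cmod_cexp; apply exp_pos).
  destruct (derivable_pt_lim_exp_0 (eps / m)) as [d Hd]; [apply Rdiv_lt_0_compat; auto|].
  exists d; split; [apply cond_pos|]. intros y Hy.
  set (h := (y - z)%C) in *. replace y with (z + h)%C by (unfold h; ring).
  rewrite cexp_plus.
  replace (cexp z * cexp h - cexp z - cexp z * h)%C with (cexp z * (cexp h - 1 - h))%C by ring.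
  rewrite Cmod_mult. fold m.
  assert (B : Cmod (cexp h - 1 - h) <= eps / m * Cmod h).
  { eapply Rle_trans; [apply Cmod_cexp_minus_1_minus|].
    destruct (Req_dec (Cmod h) 0) as [E|E]; [rewrite E, exp_0; lra|].
    pose proof (Cmod_ge_0 h).
    specialize (Hd (Cmod h) E). rewrite Rabs_pos_eq in Hd by auto. specialize (Hd Hy).
    rewrite Rplus_0_l, exp_0 in Hd. apply Rabs_def2 in Hd. destruct Hd as [Hd _].
    assert (E2 : (exp (Cmod h) - 1) / Cmod h * Cmod h = exp (Cmod h) - 1) by (field; auto).
    assert (0 < Cmod h) by lra. nra. }
  apply (Rmult_le_compat_l m) in B; [|lra].
  replace (m * (eps / m * Cmod h)) with (eps * Cmod h) in B by (field; lra). exact B.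
Qed.

Lemma rder_cis (t : R) : rder cis t (Ci * cis t)%C.
Proof.
  eapply der_ext; [| |apply (rder_cexp_line Ci t)].
  - intros s. apply C_eq_intro; unfold cexp, cis, Ci, Re, Im; cbn; rewrite ?Rmult_0_r, ?Rmult_0_l, ?Rminus_0_r, exp_0, Rplus_0_r, Rmult_1_r; ring.
  - f_equal. apply C_eq_intro; unfold cexp, cis, Ci, Re, Im; cbn; rewrite ?Rmult_0_r, ?Rmult_0_l, ?Rminus_0_r, exp_0, Rplus_0_r, Rmult_1_r; ring.
Qed.

Lemma rcont_cis (t : R) : rcont cis t.
Proof. apply (der_cont _ _ _ _ (rder_cis t)). Qed.

Lemma cis_period (t : R) : cis (t + 2 * PI) = cis t.
Proof.
  unfold cis. replace (t + 2 * PI) with (t + 2 * INR 1 * PI) by (cbn; ring).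
  rewrite cos_period, sin_period; auto.
Qed.

Lemma cis_neq_0 (t : R) : cis t <> 0%C.
Proof. apply Cmod_gt_0. rewrite Cmod_cis; lra. Qed.

Lemma cis_opp (t : R) : cis (- t) = Cconj (cis t).
Proof. unfold cis, Cconj; cbn. rewrite cos_neg, sin_neg; auto. Qed.

Lemma cis_plus (s t : R) : cis (s + t) = (cis s * cis t)%C.
Proof. apply C_eq_intro; rewrite ?Re_mult, ?Im_mult; unfold cis, Re, Im; cbn; rewrite ?cos_plus, ?sin_plus; ring. Qed.

(** * Cauchy's integral formula *)

Lemma C_eq_of_close (a b : C) : (forall eps, 0 < eps -> Cmod (a - b) <= eps) -> a = b.
Proof.
  intros H. assert (E : Cmod (a - b) = 0).
  { apply Rle_antisym; [|apply Cmod_ge_0]. apply Rnot_lt_le; intros P.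
    specialize (H (Cmod (a - b) / 2) ltac:(lra)). lra. }
  apply Cmod_eq_0 in E. replace a with (a - b + b)%C by ring. rewrite E; ring.
Qed.

(** Goursat's theorem for [f w / (w - z)] on the family of circles that moves linearly from the
    small circle about [z] to the large circle about [z0]. On the small one the pole cancels against
    the velocity, and the common factor [Ci] is divided out. *)
Lemma circle_homotopy (f : C -> C) (z0 z : C) (r rho th : R) :
  0 < rho -> Cmod (z - z0) + rho <= r ->
  (forall w, Cmod (w - z0) <= r -> exists l, cder f w l) ->
  CInt (fun t => f (z0 + r * cis t) * (r * cis t) / (z0 + r * cis t - z))%C th (th + 2 * PI) =
  CInt (fun t => f (z + rho * cis t))%C th (th + 2 * PI).
Proof.
  intros Hrho Hz Hf. pose proof (Cmod_ge_0 (z - z0)) as Hz0. pose proof PI_RGT_0 as HPI.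
  set (R1 := fun s => rho + (r - rho) * s).
  set (Phi := fun s t => ((1 - RtoC s) * z + RtoC s * z0 + RtoC (R1 s) * cis t)%C).
  set (Phis := fun (s t : R) => (z0 - z + RtoC (r - rho) * cis t)%C).
  set (Phit := fun s t => (RtoC (R1 s) * (Ci * cis t))%C).
  assert (HR1 : forall s, 0 <= s <= 1 -> rho <= R1 s <= r) by (intros s Hs; unfold R1; nra).
  (* [|Phi s t - z|] is at least [R1 s - s * |z - z0|], which is affine in [s] and never below
     [rho]. *)
  assert (Far : forall s t, 0 <= s <= 1 -> (Phi s t - z <> 0)%C).
  { intros s t Hs. apply Cmod_gt_0.
    replace (Phi s t - z)%C with (RtoC (R1 s) * cis t - RtoC s * (z - z0))%C by (unfold Phi; ring).
    pose proof (Cmod_triangle_rev (RtoC (R1 s) * cis t) (RtoC s * (z - z0))) as T.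
    rewrite !Cmod_mult, Cmod_cis, !Cmod_R, !Rabs_pos_eq in T by (try (specialize (HR1 s Hs)); lra).
    assert (ER : R1 s = rho + (r - rho) * s) by reflexivity. assert (0 <= s * (r - Cmod (z - z0) - rho)) by (apply Rmult_le_pos; lra). lra. }
  assert (Near : forall s t, 0 <= s <= 1 -> Cmod (Phi s t - z0) <= r).
  { intros s t Hs.
    replace (Phi s t - z0)%C with (RtoC (1 - s) * (z - z0) + RtoC (R1 s) * cis t)%C
      by (unfold Phi; rewrite RtoC_minus; ring).
    eapply Rle_trans; [apply Cmod_triangle|].
    rewrite !Cmod_mult, Cmod_cis, !Cmod_R, !Rabs_pos_eq by (try (specialize (HR1 s Hs)); lra).
    unfold R1. assert (0 <= (1 - s) * (r - Cmod (z - z0) - rho)) by (apply Rmult_le_pos; lra). lra. }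
  assert (HP : patch Phi Phis Phit 0 1 th (th + 2 * PI) (Cmod (z0 - z) + r)).
  { intros s t Hs _. split; [|split; [|split; [|split; [|split]]]].
    - unfold Phi, Phis, R1.
      eapply der_ext; [| |apply (der_plus RtoC (fun _ => z + RtoC rho * cis t)%C
        (fun s => (z0 - z + RtoC (r - rho) * cis t) * RtoC s)%C s); [apply der_const|apply der_scal, (der_id RtoC)]].
      + intros y; cbn. rewrite RtoC_plus, RtoC_mult. ring.
      + cbn; ring.
    - unfold Phi, Phit.
      eapply der_ext; [| |apply (der_plus RtoC (fun _ => (1 - RtoC s) * z + RtoC s * z0)%C
        (fun t => RtoC (R1 s) * cis t)%C t); [apply der_const|apply der_scal, rder_cis]].
      + intros y; cbn. ring.
      + cbn; ring.
    - exact (cont_const RtoC (Phis 0 t) s).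
    - unfold Phit. apply cont_mult; [apply cont_const|apply cont_mult; [apply cont_const|apply rcont_cis]].
    - unfold Phis. eapply Rle_trans; [apply Cmod_triangle|].
      rewrite Cmod_mult, Cmod_cis, Cmod_R, Rabs_pos_eq by lra. lra.
    - unfold Phit. rewrite !Cmod_mult, Cmod_cis, Cmod_Ci, Cmod_R, Rabs_pos_eq by (specialize (HR1 s Hs); lra).
      pose proof (Cmod_ge_0 (z0 - z)). specialize (HR1 s Hs). lra. }
  set (g := fun w => (f w / (w - z))%C).
  assert (Hg : forall s t, 0 <= s <= 1 -> th <= t <= th + 2 * PI -> exists l, cder g (Phi s t) l).
  { intros s t Hs _. destruct (Hf (Phi s t) (Near s t Hs)) as [l Hl].
    eexists. apply der_div; [exact Hl| |apply Far; auto].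
    apply der_minus; [apply cder_id|apply der_const]. }
  pose proof (goursat g Phi Phis Phit 0 1 th (th + 2 * PI) _ ltac:(lra) ltac:(lra) HP Hg) as G.
  unfold boundary_integral in G.
  assert (Cg : forall s t, 0 <= s <= 1 -> th <= t <= th + 2 * PI -> ccont g (Phi s t)).
  { intros s t Hs Ht. destruct (Hg s t Hs Ht) as [l Hl]. apply (der_cont _ _ _ _ Hl). }
  destruct (patch_cont g _ _ _ _ _ _ _ _ HP Cg) as [_ C2].
  (* By periodicity the two edges at the ends of the [t] interval are the same path with opposite
     signs. *)
  rewrite (CInt_ext (fun s => g (Phi s (th + 2 * PI)%R) * Phis s (th + 2 * PI)%R)%C (fun s => g (Phi s th) * Phis s th)%C) in G
    by (try lra; intros s _; unfold Phi, Phis; rewrite cis_period; auto).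
  assert (Hr : 0 < r) by lra.
  assert (E1 : CInt (fun t => g (Phi 1 t) * Phit 1 t)%C th (th + 2 * PI) =
    (Ci * CInt (fun t => f (z0 + r * cis t) * (r * cis t) / (z0 + r * cis t - z))%C th (th + 2 * PI))%C).
  { assert (EP : forall t, Phi 1 t = (z0 + r * cis t)%C).
    { intros t. unfold Phi, R1. replace (rho + (r - rho) * 1) with r by ring. ring. }
    rewrite <- CInt_scal; [|lra|].
    - apply CInt_ext; [lra|]. intros t _. unfold g, Phit. rewrite EP. unfold R1.
      replace (rho + (r - rho) * 1) with r by ring. unfold Cdiv; ring.
    - intros t Ht.
      apply (cont_ext RtoC (fun t => - Ci * (g (Phi 1 t) * Phit 1 t))%C).
      + intros y. unfold g, Phit. rewrite EP. unfold R1.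
        replace (rho + (r - rho) * 1) with r by ring.
        assert (EC : (- Ci * Ci = 1)%C) by (apply C_eq_intro; unfold Ci, Re, Im; cbn; ring).
        unfold Cdiv.
        transitivity ((- Ci * Ci) * (f (z0 + r * cis y) * (r * cis y) * / (z0 + r * cis y - z)))%C; [ring|].
        rewrite EC; ring.
      + apply cont_mult; [apply cont_const|]. apply (C2 1 ltac:(lra)); auto. }
  assert (E0 : CInt (fun t => g (Phi 0 t) * Phit 0 t)%C th (th + 2 * PI) =
    (Ci * CInt (fun t => f (z + rho * cis t))%C th (th + 2 * PI))%C).
  { assert (EP : forall t, Phi 0 t = (z + rho * cis t)%C).
    { intros t. unfold Phi, R1. replace (rho + (r - rho) * 0) with rho by ring. ring. }
    rewrite <- CInt_scal; [|lra|].
    - apply CInt_ext; [lra|]. intros t _. unfold g, Phit. rewrite EP. unfold R1.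
      replace (rho + (r - rho) * 0) with rho by ring. field.
      replace (z + rho * cis t - z)%C with (rho * cis t)%C by ring.
      apply Cmult_neq_0; [|apply cis_neq_0]. intros E. apply RtoC_inj in E. lra.
    - intros t Ht. apply (cont_ext RtoC (fun t => f (Phi 0 t))); [intros; rewrite EP; auto|].
      destruct (Hf (Phi 0 t) (Near 0 t ltac:(lra))) as [l Hl].
      apply (cont_comp RtoC (Phi 0) f); [|apply (der_cont _ _ _ _ Hl)].
      destruct (HP 0 t ltac:(lra) Ht) as [_ [D _]]. apply (der_cont _ _ _ _ D). }
  rewrite E1, E0 in G.
  match type of G with (?S0 + Ci * ?A0 - _ - Ci * ?B0 = _)%C => set (S := S0) in G; set (A := A0) in G; set (B := B0) in G end.
  assert (H : (Ci * (A - B) = 0)%C) by (rewrite <- G; ring).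
  assert (NC : Ci <> 0%C) by (intros E; apply (f_equal Im) in E; unfold Ci, Im in E; cbn in E; lra).
  assert (H2 : (A - B = / Ci * (Ci * (A - B)))%C) by (field; auto).
  rewrite H in H2. fold A B. replace A with (A - B + B)%C by ring. rewrite H2; ring.
Qed.

(** The homotopy holds for every small [rho], and the mean of [f] over a shrinking circle tends to
    [f z] by continuity. The starting angle [th] is left free because the gradient estimate has to
    cut the circle at the zeros of a cosine. *)
Lemma cauchy_formula (f : C -> C) (z0 z : C) (r th : R) :
  Cmod (z - z0) < r ->
  (forall w, Cmod (w - z0) <= r -> exists l, cder f w l) ->
  CInt (fun t => f (z0 + r * cis t) * (r * cis t) / (z0 + r * cis t - z))%C th (th + 2 * PI) =
  (RtoC (2 * PI) * f z)%C.
Proof.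
  intros Hz Hf. pose proof PI_RGT_0 as HPI. apply C_eq_of_close. intros eps He.
  destruct (Hf z ltac:(lra)) as [l Hl]. apply der_cont in Hl.
  destruct (Hl (eps / (2 * PI))) as [d [Hd K]]; [apply Rdiv_lt_0_compat; lra|]. unfold Cid in K.
  set (rho := Rmin (d / 2) (r - Cmod (z - z0))).
  assert (H1 : 0 < rho) by (apply Rmin_pos; lra).
  assert (H2 : rho <= d / 2) by apply Rmin_l. assert (H3 : rho <= r - Cmod (z - z0)) by apply Rmin_r.
  assert (Dist : forall t, Cmod (z + rho * cis t - z) = rho).
  { intros t. replace (z + rho * cis t - z)%C with (rho * cis t)%C by ring.
    rewrite Cmod_mult, Cmod_cis, Cmod_R, Rabs_pos_eq by lra. ring. }
  rewrite (circle_homotopy f z0 z r rho th) by (auto; lra).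
  replace (RtoC (2 * PI)) with (RtoC (th + 2 * PI - th)) by (f_equal; ring).
  rewrite <- CInt_const.
  assert (Cc : rcont_on (fun t => f (z + rho * cis t)%C) th (th + 2 * PI)).
  { intros t Ht. destruct (Hf (z + rho * cis t)%C) as [l' Hl'].
    - replace (z + rho * cis t - z0)%C with ((z - z0) + (z + rho * cis t - z))%C by ring.
      eapply Rle_trans; [apply Cmod_triangle|]. rewrite Dist. lra.
    - apply (cont_comp RtoC (fun t => z + rho * cis t)%C f); [|apply (der_cont _ _ _ _ Hl')].
      apply cont_plus; [apply cont_const|apply cont_mult; [apply cont_const|apply rcont_cis]]. }
  rewrite <- CInt_minus; [|lra|auto|intros t _; apply cont_const].
  eapply Rle_trans; [apply (CInt_bound _ _ _ (eps / (2 * PI)))|].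
  - lra.
  - intros t Ht. apply cont_minus; [auto|apply cont_const].
  - intros t _. apply Rlt_le, K. rewrite Dist. lra.
  - right. field. lra.
Qed.

(** * Differentiation under the integral sign, higher derivatives, removable singularities *)

Lemma der_CInt (F : C -> R -> C) (F' : R -> C) (z : C) (a b B d : R) :
  a <= b -> 0 < d -> 0 <= B ->
  (forall y, Cmod (y - z) < d -> rcont_on (F y) a b) -> rcont_on F' a b ->
  (forall y t, Cmod (y - z) < d -> a <= t <= b ->
     Cmod (F y t - F z t - F' t * (y - z)) <= B * (Cmod (y - z) * Cmod (y - z))) ->
  cder (fun y => CInt (F y) a b) z (CInt F' a b).
Proof.
  intros Hab Hd HB CF CF' H eps He.
  assert (HL : 0 <= B * (b - a)) by (apply Rmult_le_pos; lra).
  exists (Rmin d (eps / (B * (b - a) + 1))). split.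
  { apply Rmin_pos; [auto|apply Rdiv_lt_0_compat; lra]. }
  unfold Cid; intros y Hy.
  assert (Y1 : Cmod (y - z) < d) by (eapply Rlt_le_trans; [exact Hy|apply Rmin_l]).
  assert (Y2 : Cmod (y - z) < eps / (B * (b - a) + 1)) by (eapply Rlt_le_trans; [exact Hy|apply Rmin_r]).
  assert (C1 : rcont_on (F y) a b) by auto.
  assert (C2 : rcont_on (F z) a b) by (apply CF; rewrite Cmod_diff_0; auto).
  assert (C3 : rcont_on (fun t => (y - z) * F' t)%C a b) by (apply rcont_on_scal; auto).
  assert (C4 : rcont_on (fun t => F y t - F z t)%C a b) by (intros t Ht; apply cont_minus; auto).
  replace (CInt F' a b * (y - z))%C with ((y - z) * CInt F' a b)%C by ring.
  rewrite <- CInt_scal, <- !CInt_minus by auto.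
  eapply Rle_trans; [apply (CInt_bound _ _ _ (B * (Cmod (y - z) * Cmod (y - z))))|]; auto.
  - intros t Ht. apply cont_minus; auto.
  - intros t Ht. replace ((y - z) * F' t)%C with (F' t * (y - z))%C by ring. auto.
  - pose proof (Cmod_ge_0 (y - z)) as P.
    apply Rlt_div_r in Y2; [|lra].
    replace (B * (Cmod (y - z) * Cmod (y - z)) * (b - a)) with ((Cmod (y - z) * (B * (b - a))) * Cmod (y - z)) by ring.
    apply Rmult_le_compat_r; auto. lra.
Qed.

Lemma neq_0_of_Cmod (u : C) (r : R) : 0 < r -> r <= Cmod u -> u <> 0%C.
Proof. intros Hr Hu E. rewrite E, Cmod_0 in Hu. lra. Qed.

Lemma distance_half (p z y : C) (eta : R) :
  eta <= Cmod (p - z) -> Cmod (y - z) < eta / 2 -> eta / 2 <= Cmod (p - y).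
Proof.
  intros Hp Hy. pose proof (Cmod_triangle_rev (p - z) (y - z)) as T.
  replace (p - z - (y - z))%C with (p - y)%C in T by ring. lra.
Qed.

(** The remainder of [1 / (w - y)] at [y = z] is exactly [(y - z)^2 / ((w - z)^2 (w - y))]; it is
    uniformly quadratic, as [|w - y| >= eta / 2] when [|y - z| < eta / 2]. *)
Lemma cder_kernel_1 (k w : R -> C) (z : C) (a b M eta : R) :
  a <= b -> 0 < eta -> rcont_on k a b -> rcont_on w a b ->
  (forall t, a <= t <= b -> Cmod (k t) <= M) ->
  (forall t, a <= t <= b -> eta <= Cmod (w t - z)) ->
  cder (fun y => CInt (fun t => k t / (w t - y))%C a b) z
    (CInt (fun t => k t / ((w t - z) * (w t - z)))%C a b).
Proof.
  intros Hab He Ck Cw HM Hw.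
  assert (HM0 : 0 <= M) by (specialize (HM a ltac:(lra)); pose proof (Cmod_ge_0 (k a)); lra).
  pose proof (fun y t Hy Ht => distance_half (w t) z y eta (Hw t Ht) Hy) as Far.
  pose proof neq_0_of_Cmod as NZ.
  apply (der_CInt (fun y t => k t / (w t - y))%C _ z a b (M * (2 / (eta * eta * eta))) (eta / 2)); auto.
  - lra.
  - apply Rmult_le_pos; auto. apply Rdiv_le_0_compat; [lra|]. repeat apply Rmult_lt_0_compat; auto.
  - intros y Hy t Ht. apply cont_div; [auto|apply cont_minus; [auto|apply cont_const]|].
    apply (NZ _ (eta / 2)); [lra|auto].
  - intros t Ht. apply cont_div; [auto| |].
    + apply cont_mult; apply cont_minus; auto; apply cont_const.
    + apply Cmult_neq_0; apply (NZ _ eta); auto.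
  - intros y t Hy Ht. specialize (Far y t Hy Ht). specialize (Hw t Ht). specialize (HM t Ht).
    assert (N1 : (w t - y <> 0)%C) by (apply (NZ _ (eta / 2)); lra).
    assert (N2 : (w t - z <> 0)%C) by (apply (NZ _ eta); auto).
    replace (k t / (w t - y) - k t / (w t - z) - k t / ((w t - z) * (w t - z)) * (y - z))%C
      with (k t * ((y - z) * (y - z)) / ((w t - z) * (w t - z) * (w t - y)))%C by (field; auto).
    rewrite Cmod_div by (repeat apply Cmult_neq_0; auto). rewrite !Cmod_mult.
    set (x := Cmod (y - z)). assert (Hx : 0 <= x * x) by nra.
    assert (D : eta * eta * eta / 2 <= Cmod (w t - z) * Cmod (w t - z) * Cmod (w t - y)).
    { replace (eta * eta * eta / 2) with (eta * eta * (eta / 2)) by field.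
      repeat apply Rmult_le_compat; try lra. nra. }
    assert (E3 : 0 < eta * eta * eta) by (repeat apply Rmult_lt_0_compat; auto).
    apply Rle_div_l; [lra|].
    transitivity (M * (x * x)); [apply Rmult_le_compat_r; auto|].
    replace (M * (x * x)) with (M * (2 / (eta * eta * eta)) * (x * x) * (eta * eta * eta / 2)) by (field; lra).
    apply Rmult_le_compat_l; auto. repeat apply Rmult_le_pos; try lra; [|apply Cmod_ge_0|apply Cmod_ge_0].
    apply Rlt_le, Rinv_0_lt_compat; auto.
Qed.

(** One order higher, the numerator of the remainder acquires the factor [3 (w - z) - 2 (y - z)],
    which is at most [4 |w - z|] in modulus for [|y - z| < eta / 2]. *)
Lemma cder_kernel_2 (k w : R -> C) (z : C) (a b M eta : R) :
  a <= b -> 0 < eta -> rcont_on k a b -> rcont_on w a b ->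
  (forall t, a <= t <= b -> Cmod (k t) <= M) ->
  (forall t, a <= t <= b -> eta <= Cmod (w t - z)) ->
  exists l, cder (fun y => CInt (fun t => k t / ((w t - y) * (w t - y)))%C a b) z l.
Proof.
  intros Hab He Ck Cw HM Hw.
  assert (HM0 : 0 <= M) by (specialize (HM a ltac:(lra)); pose proof (Cmod_ge_0 (k a)); lra).
  pose proof (fun y t Hy Ht => distance_half (w t) z y eta (Hw t Ht) Hy) as Far.
  pose proof neq_0_of_Cmod as NZ.
  set (F' := fun t => (2 * k t / ((w t - z) * (w t - z) * (w t - z)))%C).
  exists (CInt F' a b).
  apply (der_CInt (fun y t => k t / ((w t - y) * (w t - y)))%C _ z a b (M * (16 / (eta * eta * eta * eta))) (eta / 2)); auto.
  - lra.
  - apply Rmult_le_pos; auto. apply Rdiv_le_0_compat; [lra|]. repeat apply Rmult_lt_0_compat; auto.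
  - intros y Hy t Ht. apply cont_div; [auto|apply cont_mult; (apply cont_minus; [auto|apply cont_const])|].
    apply Cmult_neq_0; apply (NZ _ (eta / 2)); auto; lra.
  - intros t Ht. apply cont_div; [apply cont_mult; [apply cont_const|auto]| |].
    + repeat apply cont_mult; apply cont_minus; auto; apply cont_const.
    + repeat apply Cmult_neq_0; apply (NZ _ eta); auto.
  - intros y t Hy Ht. specialize (Far y t Hy Ht). specialize (Hw t Ht). specialize (HM t Ht).
    assert (N1 : (w t - y <> 0)%C) by (apply (NZ _ (eta / 2)); lra).
    assert (N2 : (w t - z <> 0)%C) by (apply (NZ _ eta); auto).
    unfold F'.
    replace (k t / ((w t - y) * (w t - y)) - k t / ((w t - z) * (w t - z)) - 2 * k t / ((w t - z) * (w t - z) * (w t - z)) * (y - z))%C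
      with (k t * ((y - z) * (y - z)) * (3 * (w t - z) - 2 * (y - z)) / ((w t - z) * ((w t - z) * (w t - z)) * ((w t - y) * (w t - y))))%C by (field; auto).
    rewrite Cmod_div by (repeat apply Cmult_neq_0; auto). rewrite !Cmod_mult.
    pose proof (Cmod_minus_le (3 * (w t - z)) (2 * (y - z))) as T.
    rewrite !Cmod_mult, !Cmod_R, !Rabs_pos_eq in T by lra.
    set (x := Cmod (y - z)) in *. assert (Hx : 0 <= x * x) by nra.
    set (u := Cmod (w t - z)) in *. set (v := Cmod (w t - y)) in *.
    assert (D : eta * eta * eta * eta / 4 <= (u * u) * (v * v)).
    { replace (eta * eta * eta * eta / 4) with ((eta * eta) * (eta / 2 * (eta / 2))) by field.
      repeat apply Rmult_le_compat; try lra; nra. }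
    assert (E3 : 0 < eta * eta * eta * eta) by (repeat apply Rmult_lt_0_compat; auto).
    assert (P : 0 < u * (u * u) * (v * v)) by (repeat apply Rmult_lt_0_compat; lra).
    apply Rle_div_l; [exact P|].
    transitivity (M * (x * x) * (4 * u)).
    { apply Rmult_le_compat; try lra.
      - apply Rmult_le_pos; [apply Cmod_ge_0|auto].
      - apply Cmod_ge_0.
      - apply Rmult_le_compat_r; auto. }
    replace (M * (x * x) * (4 * u)) with (M * (16 / (eta * eta * eta * eta)) * (x * x) * u * (eta * eta * eta * eta / 4)) by (field; lra).
    replace (M * (16 / (eta * eta * eta * eta)) * (x * x) * (u * (u * u) * (v * v)))
      with (M * (16 / (eta * eta * eta * eta)) * (x * x) * u * ((u * u) * (v * v))) by ring.
    apply Rmult_le_compat_l; auto. repeat apply Rmult_le_pos; try lra; try (apply Cmod_ge_0).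
    apply Rlt_le, Rinv_0_lt_compat; auto.
Qed.

Lemma rcont_on_bounded (k : R -> C) (a b : R) :
  a <= b -> rcont_on k a b -> exists M, forall t, a <= t <= b -> Cmod (k t) <= M.
Proof.
  intros Hab Hk.
  destruct (continuity_ab_maj (fun t => Cmod (k t)) a b Hab) as [c [Hc _]].
  - intros t Ht eps He. destruct (Hk t Ht eps He) as [d [Hd K]].
    exists d; split; [exact Hd|]. intros s [_ Hs]. cbn in *. unfold R_dist in *.
    specialize (K s). rewrite Cmod_RtoC_sub in K. specialize (K Hs).
    pose proof (Cmod_triangle_rev (k s) (k t)). pose proof (Cmod_triangle_rev (k t) (k s)) as T.
    rewrite (Cmod_sub_sym (k t) (k s)) in T. apply Rabs_def1; lra.
  - exists (Cmod (k c)). exact Hc.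
Qed.

(** Half the radius keeps the closed disc inside the domain of [f]. The result packages Cauchy's
    formula with the bounds [M] and [eta] that the differentiation lemmas take. *)
Lemma cauchy_kernel (f : C -> C) (z0 : C) (r : R) :
  0 < r -> (forall w, Cmod (w - z0) < r -> exists l, cder f w l) ->
  exists (k w : R -> C) (M : R),
    rcont_on k 0 (2 * PI) /\ rcont_on w 0 (2 * PI) /\
    (forall t, 0 <= t <= 2 * PI -> Cmod (k t) <= M) /\
    (forall t, 0 <= t <= 2 * PI -> Cmod (w t - z0) = r / 2) /\
    (forall z t, Cmod (z - z0) < r / 2 -> 0 <= t <= 2 * PI -> r / 2 - Cmod (z - z0) <= Cmod (w t - z)) /\
    (forall z, Cmod (z - z0) < r / 2 ->
       CInt (fun t => k t / (w t - z))%C 0 (2 * PI) = (RtoC (2 * PI) * f z)%C).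
Proof.
  intros Hr Hf. pose proof PI_RGT_0 as HPI.
  set (w := fun t => (z0 + RtoC (r / 2) * cis t)%C).
  set (k := fun t => (f (w t) * (RtoC (r / 2) * cis t))%C).
  assert (Cw : rcont_on w 0 (2 * PI)).
  { intros t _. apply cont_plus; [apply cont_const|apply cont_mult; [apply cont_const|apply rcont_cis]]. }
  assert (Dw : forall t, Cmod (w t - z0) = r / 2).
  { intros t. replace (w t - z0)%C with (RtoC (r / 2) * cis t)%C by (unfold w; ring).
    rewrite Cmod_mult, Cmod_cis, Cmod_R, Rabs_pos_eq by lra. ring. }
  assert (Ck : rcont_on k 0 (2 * PI)).
  { intros t Ht. apply cont_mult.
    - destruct (Hf (w t)) as [l Hl]; [rewrite Dw; lra|].
      apply (cont_comp RtoC w f); [auto|apply (der_cont _ _ _ _ Hl)].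
    - apply cont_mult; [apply cont_const|apply rcont_cis]. }
  destruct (rcont_on_bounded k 0 (2 * PI) ltac:(lra) Ck) as [M HM].
  exists k, w, M. split; [auto|split; [auto|split; [auto|split; [auto|split]]]].
  - intros z t Hz _. rewrite <- (Dw t). pose proof (Cmod_triangle_rev (w t - z0) (z - z0)) as T.
    replace (w t - z0 - (z - z0))%C with (w t - z)%C in T by ring. exact T.
  - intros z Hz. pose proof (cauchy_formula f z0 z (r / 2) 0 Hz) as H.
    rewrite Rplus_0_l in H. rewrite <- H; [reflexivity|].
    intros w' Hw'. apply Hf. lra.
Qed.

Lemma RtoC_2PI_neq_0 : RtoC (2 * PI) <> 0%C.
Proof. intros E. apply RtoC_inj in E. pose proof PI_RGT_0. lra. Qed.

(** Differentiating Cauchy's formula once represents [f'] near [z0], by uniqueness of derivatives;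
    this representation can be differentiated again. *)
Lemma cder_cder (f f' : C -> C) (z0 : C) (r : R) :
  0 < r -> (forall w, Cmod (w - z0) < r -> cder f w (f' w)) -> exists l, cder f' z0 l.
Proof.
  intros Hr Hf. pose proof PI_RGT_0 as HPI.
  destruct (cauchy_kernel f z0 r Hr) as [k [w [M [Ck [Cw [HM [Dw [Far HC]]]]]]]].
  { intros w Hw. exists (f' w). auto. }
  assert (E : forall z, Cmod (z - z0) < r / 2 ->
    (CInt (fun t => k t / ((w t - z) * (w t - z))) 0 (2 * PI))%C = (RtoC (2 * PI) * f' z)%C).
  { intros z Hz.
    apply (cder_unique (fun z => RtoC (2 * PI) * f z)%C z); [|apply der_scal, Hf; lra].
    apply (der_local Cid (fun y => CInt (fun t => k t / (w t - y))%C 0 (2 * PI)) _ z _ (r / 2 - Cmod (z - z0))).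
    - lra.
    - unfold Cid; intros y Hy. apply HC.
      pose proof (Cmod_triangle (y - z) (z - z0)) as T. replace (y - z + (z - z0))%C with (y - z0)%C in T by ring. lra.
    - apply (cder_kernel_1 k w z 0 (2 * PI) M (r / 2 - Cmod (z - z0))); auto; lra. }
  destruct (cder_kernel_2 k w z0 0 (2 * PI) M (r / 2)) as [l Hl]; auto; try lra.
  { intros t Ht. rewrite Dw by auto. lra. }
  exists (/ RtoC (2 * PI) * l)%C.
  apply (der_local Cid (fun y => / RtoC (2 * PI) * CInt (fun t => k t / ((w t - y) * (w t - y)))%C 0 (2 * PI))%C _ z0 _ (r / 2)).
  - lra.
  - unfold Cid; intros y Hy. rewrite E by auto. field. apply RtoC_2PI_neq_0.
  - apply der_scal, Hl.
Qed.

(** Partial fractions: [1 / (w - z) - 1 / (w - z0) = (z - z0) / ((w - z0) (w - z))]. Hence the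
    difference quotient [q] is the Cauchy integral of the kernel of [f] divided by [w - z0], also at
    [z0], where it is the formula for the derivative. *)
Lemma removable_quotient (f q : C -> C) (z0 : C) (r : R) :
  0 < r -> (forall w, Cmod (w - z0) < r -> exists l, cder f w l) ->
  (forall w, Cmod (w - z0) < r -> (q w * (w - z0) = f w - f z0)%C) ->
  cder f z0 (q z0) -> exists l, cder q z0 l.
Proof.
  intros Hr Hf Hq H0. pose proof PI_RGT_0 as HPI.
  destruct (cauchy_kernel f z0 r Hr Hf) as [k [w [M [Ck [Cw [HM [Dw [Far HC]]]]]]]].
  assert (W0 : forall t, 0 <= t <= 2 * PI -> (w t - z0 <> 0)%C).
  { intros t Ht. apply Cmod_gt_0. rewrite Dw; auto. lra. }
  assert (WZ : forall z t, Cmod (z - z0) < r / 2 -> 0 <= t <= 2 * PI -> (w t - z <> 0)%C).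
  { intros z t Hz Ht. apply Cmod_gt_0. specialize (Far z t Hz Ht). lra. }
  set (k' := fun t => (k t / (w t - z0))%C).
  assert (Ck' : rcont_on k' 0 (2 * PI)).
  { intros t Ht. apply cont_div; [auto|apply cont_minus; [auto|apply cont_const]|auto]. }
  destruct (rcont_on_bounded k' 0 (2 * PI) ltac:(lra) Ck') as [M' HM'].
  assert (Ckw : forall z, Cmod (z - z0) < r / 2 -> rcont_on (fun t => k t / (w t - z))%C 0 (2 * PI)).
  { intros z Hz t Ht. apply cont_div; [auto|apply cont_minus; [auto|apply cont_const]|auto]. }
  assert (E : forall z, Cmod (z - z0) < r / 2 ->
    (CInt (fun t => k' t / (w t - z)) 0 (2 * PI))%C = (RtoC (2 * PI) * q z)%C).
  { intros z Hz. destruct (Ceq_dec z z0) as [->|NE].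
    - apply (cder_unique (fun z => RtoC (2 * PI) * f z)%C z0); [|apply der_scal, H0].
      rewrite (CInt_ext _ (fun t => k t / ((w t - z0) * (w t - z0)))%C).
      + apply (der_local Cid (fun y => CInt (fun t => k t / (w t - y))%C 0 (2 * PI)) _ z0 _ (r / 2)).
        * lra.
        * unfold Cid; intros y Hy. apply HC; auto.
        * apply (cder_kernel_1 k w z0 0 (2 * PI) M (r / 2)); auto; try lra.
          intros t Ht. rewrite Dw; auto; lra.
      + lra.
      + intros t Ht. unfold k'. field. auto.
    - assert (N : (z - z0 <> 0)%C).
      { intros E. apply NE. replace z with (z - z0 + z0)%C by ring. rewrite E; ring. }
      assert (Z0 : Cmod (z0 - z0) < r / 2) by (rewrite Cmod_diff_0; lra).
      assert (H1 : ((z - z0) * CInt (fun t => k' t / (w t - z)) 0 (2 * PI))%C = (RtoC (2 * PI) * f z - RtoC (2 * PI) * f z0)%C).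
      { rewrite <- (HC z Hz), <- (HC z0 Z0), <- CInt_minus, <- CInt_scal; try lra; auto.
        - apply CInt_ext; [lra|]. intros t Ht. unfold k'. field. auto.
        - intros t Ht. apply cont_div; [auto|apply cont_minus; [auto|apply cont_const]|auto]. }
      replace (RtoC (2 * PI) * f z - RtoC (2 * PI) * f z0)%C with (RtoC (2 * PI) * (q z * (z - z0)))%C in H1
        by (rewrite Hq by lra; ring).
      set (X := CInt _ _ _) in *.
      replace X with ((z - z0) * X / (z - z0))%C by (field; auto). rewrite H1. field. auto. }
  exists (/ RtoC (2 * PI) * CInt (fun t => k' t / ((w t - z0) * (w t - z0)))%C 0 (2 * PI))%C.
  apply (der_local Cid (fun y => / RtoC (2 * PI) * CInt (fun t => k' t / (w t - y))%C 0 (2 * PI))%C _ z0 _ (r / 2)).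
  - lra.
  - unfold Cid; intros y Hy. rewrite E by auto. field. apply RtoC_2PI_neq_0.
  - apply der_scal, (cder_kernel_1 k' w z0 0 (2 * PI) M' (r / 2)); auto; try lra.
    intros t Ht. rewrite Dw; auto; lra.
Qed.

(** * Primitives and logarithms *)

(** Open and star-shaped about [z0]: the generality in which primitives are integrals along segments
    from [z0]. It covers the half-plane, the disc and the strips used below. *)
Definition starlike_region (U : C -> Prop) (z0 : C) : Prop :=
  U z0 /\
  (forall z, U z -> exists r, 0 < r /\ forall w, Cmod (w - z) < r -> U w) /\
  (forall z s, U z -> 0 <= s <= 1 -> U (z0 + RtoC s * (z - z0))%C).

Lemma rder_segment (z0 z : C) (t : R) : rder (fun s => z0 + RtoC s * (z - z0))%C t (z - z0)%C.
Proof.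
  eapply der_ext; [| |apply (der_plus RtoC (fun _ => z0) (fun s => (z - z0) * RtoC s)%C t);
    [apply der_const|apply der_scal, (der_id RtoC)]]; [intros; cbn; ring|ring].
Qed.

Lemma primitive_exists (U : C -> Prop) (z0 : C) (q : C -> C) :
  starlike_region U z0 -> (forall z, U z -> exists l, cder q z l) ->
  exists F : C -> C, F z0 = 0%C /\ forall z, U z -> cder F z (q z).
Proof.
  intros [HU0 [HO HS]] Hq.
  set (F := fun z => CInt (fun s => q (z0 + RtoC s * (z - z0)) * (z - z0))%C 0 1).
  exists F. split.
  { unfold F. rewrite (CInt_ext _ (fun _ => 0%C)); [|lra|intros; ring].
    rewrite CInt_const. ring. }
  assert (Incr : forall z h, (forall t, 0 <= t <= 1 -> U (z + RtoC t * h)%C) ->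
    (F (z + h) - F z)%C = CInt (fun t => q (z + RtoC t * h) * h)%C 0 1).
  { intros z h HUh.
    (* The triangle with vertices [z0], [z], [z + h] is a rectangle whose side [s = 0] collapses to
       [z0]; Goursat's theorem on it identifies the increment of [F] with the integral over the
       short side. *)
    set (Phi := fun s t => (z0 + RtoC s * (z + RtoC t * h - z0))%C).
    set (Phis := fun (s t : R) => (z + RtoC t * h - z0)%C).
    set (Phit := fun (s t : R) => (RtoC s * h)%C).
    assert (HP : patch Phi Phis Phit 0 1 0 1 (Cmod (z - z0) + Cmod h)).
    { intros s t Hs Ht. pose proof (Cmod_ge_0 h). pose proof (Cmod_ge_0 (z - z0)).
      split; [|split; [|split; [|split; [|split]]]].
      - apply (rder_segment z0 (z + RtoC t * h)).
      - unfold Phi, Phit.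
        eapply der_ext; [| |apply (der_plus RtoC (fun _ => z0 + RtoC s * (z - z0))%C (fun t => (RtoC s * h) * RtoC t)%C t);
          [apply der_const|apply der_scal, (der_id RtoC)]]; [intros; cbn; ring|cbn; ring].
      - exact (cont_const RtoC (Phis 0 t) s).
      - exact (cont_const RtoC (Phit s 0) t).
      - unfold Phis. replace (z + RtoC t * h - z0)%C with (z - z0 + RtoC t * h)%C by ring.
        eapply Rle_trans; [apply Cmod_triangle|]. rewrite Cmod_mult, Cmod_R, Rabs_pos_eq by lra. nra.
      - unfold Phit. rewrite Cmod_mult, Cmod_R, Rabs_pos_eq by lra. nra. }
    pose proof (goursat q Phi Phis Phit 0 1 0 1 _ ltac:(lra) ltac:(lra) HP) as G.
    assert (Hd : forall s t, 0 <= s <= 1 -> 0 <= t <= 1 -> exists l, cder q (Phi s t) l).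
    { intros s t Hs Ht. apply Hq. unfold Phi. apply HS; auto. }
    specialize (G Hd). unfold boundary_integral in G.
    rewrite (CInt_ext (fun s => q (Phi s 0) * Phis s 0)%C (fun s => q (z0 + RtoC s * (z - z0)) * (z - z0))%C) in G
      by (try lra; intros; unfold Phi, Phis; replace (z + 0 * h)%C with z by ring; auto).
    rewrite (CInt_ext (fun s => q (Phi s 1) * Phis s 1)%C (fun s => q (z0 + RtoC s * (z + h - z0)) * (z + h - z0))%C) in G
      by (try lra; intros; unfold Phi, Phis; replace (z + 1 * h)%C with (z + h)%C by ring; auto).
    rewrite (CInt_ext (fun t => q (Phi 0 t) * Phit 0 t)%C (fun _ => 0%C)) in G
      by (try lra; intros; unfold Phit; ring).
    rewrite (CInt_ext (fun t => q (Phi 1 t) * Phit 1 t)%C (fun t => q (z + RtoC t * h) * h)%C) in G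
      by (try lra; intros t Ht; unfold Phi, Phit; replace (z0 + 1 * (z + RtoC t * h - z0))%C with (z + RtoC t * h)%C by ring; ring).
    rewrite CInt_const in G. fold (F z) in G. fold (F (z + h)%C) in G.
    set (X := CInt _ _ _) in *.
    transitivity (F (z + h) - F z + (F z + X - F (z + h) - (1 - 0)%R * 0))%C; [rewrite G; ring|ring]. }
  intros z Hz eps He. unfold Cid.
  destruct (HO z Hz) as [r [Hr Kr]].
  destruct (Hq z Hz) as [l Hl]. apply der_cont in Hl.
  destruct (Hl eps He) as [d [Hd Kd]]. unfold Cid in Kd.
  exists (Rmin r d). split; [apply Rmin_pos; auto|]. intros y Hy.
  set (h := (y - z)%C) in *. replace y with (z + h)%C by (unfold h; ring).
  assert (Hyr : Cmod h < r) by (eapply Rlt_le_trans; [exact Hy|apply Rmin_l]).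
  assert (Hyd : Cmod h < d) by (eapply Rlt_le_trans; [exact Hy|apply Rmin_r]).
  assert (Near : forall t, 0 <= t <= 1 -> Cmod (z + RtoC t * h - z) <= Cmod h).
  { intros t Ht. replace (z + RtoC t * h - z)%C with (RtoC t * h)%C by ring.
    rewrite Cmod_mult, Cmod_R, Rabs_pos_eq by lra. pose proof (Cmod_ge_0 h). nra. }
  assert (HUh : forall t, 0 <= t <= 1 -> U (z + RtoC t * h)%C).
  { intros t Ht. apply Kr. eapply Rle_lt_trans; [apply Near; auto|auto]. }
  rewrite Incr by auto.
  assert (Cq : rcont_on (fun t => q (z + RtoC t * h) * h)%C 0 1).
  { intros t Ht. apply cont_mult; [|apply cont_const].
    destruct (Hq _ (HUh t Ht)) as [l' Hl'].
    apply (cont_comp RtoC (fun t => z + RtoC t * h)%C q); [|apply (der_cont _ _ _ _ Hl')].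
    apply cont_plus; [apply cont_const|apply cont_mult; [apply (cont_id RtoC)|apply cont_const]]. }
  replace (q z * h)%C with (CInt (fun _ => q z * h)%C 0 1)
    by (rewrite CInt_const; replace (RtoC (1 - 0)) with (RtoC 1) by (f_equal; ring); ring).
  rewrite <- CInt_minus; [|lra|auto|intros t _; apply cont_const].
  replace (eps * Cmod h) with (eps * Cmod h * (1 - 0)) by ring.
  apply CInt_bound; [lra| |].
  - intros t Ht. apply cont_minus; [auto|apply cont_const].
  - intros t Ht. replace (q (z + RtoC t * h) * h - q z * h)%C with ((q (z + RtoC t * h) - q z) * h)%C by ring.
    rewrite Cmod_mult. apply Rmult_le_compat_r; [apply Cmod_ge_0|].
    apply Rlt_le, Kd. eapply Rle_lt_trans; [apply Near; auto|auto].
Qed.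

Lemma constant_of_cder_0 (U : C -> Prop) (z0 z : C) (f : C -> C) :
  starlike_region U z0 -> (forall z, U z -> cder f z 0%C) -> U z -> f z = f z0.
Proof.
  intros [_ [_ HS]] Hf Hz.
  pose proof (curve_lipschitz (fun s => f (z0 + RtoC s * (z - z0)))%C (fun _ => 0%C) 0 1 0 ltac:(lra)) as H.
  cbn beta in H.
  replace (z0 + 1 * (z - z0))%C with z in H by ring.
  replace (z0 + 0 * (z - z0))%C with z0 in H by ring.
  assert (E : Cmod (f z - f z0) = 0).
  { apply Rle_antisym; [|apply Cmod_ge_0]. rewrite Rmult_0_l in H. apply H.
    - intros t Ht. replace (RtoC 0) with (0 * (z - z0))%C by ring.
      apply (der_comp RtoC (fun s => z0 + RtoC s * (z - z0))%C f); [apply rder_segment|apply Hf, HS; auto].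
    - intros t _. rewrite Cmod_0; lra. }
  apply Cmod_eq_0 in E. replace (f z) with (f z - f z0 + f z0)%C by ring. rewrite E; ring.
Qed.

(* [Q exp(-L)] has vanishing derivative as soon as [L' = Q'/Q]. *)
Lemma exp_of_log_derivative (U : C -> Prop) (z0 : C) (Q Q' L : C -> C) :
  starlike_region U z0 ->
  (forall z, U z -> cder Q z (Q' z)) ->
  (forall z, U z -> exists m, cder L z m /\ (Q' z = m * Q z)%C) ->
  forall z, U z -> Q z = (Q z0 * cexp (L z - L z0))%C.
Proof.
  intros HU HQ HL z Hz.
  assert (E : (Q z * cexp (- L z) = Q z0 * cexp (- L z0))%C).
  { apply (constant_of_cder_0 U z0 z (fun z => Q z * cexp (- L z))%C HU); [|auto].
    intros w Hw. destruct (HL w Hw) as [m [Hm Em]].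
    assert (HN : cder (fun y => - L y)%C w (- m)%C).
    { eapply der_ext; [| |apply (der_scal Cid L (-1)), Hm]; [intros; cbn; ring|ring]. }
    eapply der_ext; [| |apply der_mult; [apply HQ, Hw|apply (der_comp Cid (fun y => - L y)%C cexp); [exact HN|apply cder_cexp]]].
    - reflexivity.
    - cbn beta. rewrite Em. ring. }
  replace (L z - L z0)%C with (- L z0 + L z)%C by ring.
  rewrite cexp_plus, Cmult_assoc, <- E, <- Cmult_assoc, <- cexp_plus.
  replace (- L z + L z)%C with (RtoC 0) by ring. rewrite cexp_0. ring.
Qed.

Lemma cexp_surj (z : C) : z <> 0%C -> exists w, cexp w = z.
Proof.
  intros Hz. apply Cmod_gt_0 in Hz as Pz.
  destruct z as [x y].
  assert (S : x * x + y * y = Cmod (x, y) * Cmod (x, y)).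
  { unfold Cmod; cbn [fst snd]. rewrite sqrt_sqrt; [ring|nra]. }
  set (m := Cmod (x, y)) in *.
  assert (S1 : x / m * (x / m) + y / m * (y / m) = 1) by (transitivity ((x * x + y * y) / (m * m)); [field; lra|rewrite S; field; lra]).
  assert (B : -1 <= x / m <= 1) by nra.
  set (a := acos (x / m)).
  assert (Ca : cos a = x / m) by (apply cos_acos; auto).
  assert (Sa : sin a = sqrt (1 - Rsqr (x / m))) by (apply sin_acos; auto).
  destruct (Rle_dec 0 y) as [Hy|Hy].
  - assert (Sy : sin a = y / m).
    { rewrite Sa. replace (1 - Rsqr (x / m)) with (Rsqr (y / m)) by (unfold Rsqr; lra).
      apply sqrt_Rsqr. apply Rdiv_le_0_compat; lra. }
    exists (ln m, a). unfold cexp, Re, Im; cbn. rewrite exp_ln, Ca, Sy by auto. f_equal; field; lra.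
  - assert (Sy : sin a = - (y / m)).
    { rewrite Sa. replace (1 - Rsqr (x / m)) with (Rsqr (- (y / m))) by (unfold Rsqr; lra).
      apply sqrt_Rsqr. assert (0 <= (- y) / m) by (apply Rdiv_le_0_compat; lra).
      unfold Rdiv in *; lra. }
    exists (ln m, - a). unfold cexp, Re, Im; cbn. rewrite exp_ln, cos_neg, sin_neg, Ca, Sy by auto. f_equal; field; lra.
Qed.

(** * The gradient estimate for bounded harmonic functions *)

Lemma CInt_Re_le (X : R -> C) (psi psi' : R -> R) (a b : R) :
  a <= b -> rcont_on X a b ->
  (forall t, a <= t <= b -> is_derive psi t (psi' t)) ->
  (forall t, a <= t <= b -> continuous psi' t) ->
  (forall t, a <= t <= b -> Re (X t) <= psi' t) ->
  Re (CInt X a b) <= psi b - psi a.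
Proof.
  intros Hab CX Hp Cp H.
  assert (E : is_RInt psi' a b (psi b - psi a)).
  { apply (is_RInt_derive psi psi'); rewrite Rmin_left, Rmax_right by auto; auto. }
  rewrite <- (is_RInt_unique _ _ _ _ E).
  apply RInt_le; auto.
  - apply rcont_on_ex_Re; auto.
  - eexists; exact E.
  - intros t Ht; apply H; lra.
Qed.

(* With [cos(x) = (cis x + cis (-x)) / 2], the real part of [L] determines its
   derivative at the centre, since [cis * L] has zero mean on circles. *)
Lemma circle_derivative (L : C -> C) (l : C) (kap r al th : R) :
  0 < r < 1 -> (forall w, Cmod w < 1 -> exists m, cder L w m) -> cder L 0%C l ->
  CInt (fun t => RtoC (2 * cos (al + t)) * (L (RtoC r * cis t) - RtoC kap))%C th (th + 2 * PI)
  = (cis (- al) * (RtoC (2 * PI) * (RtoC r * l)))%C.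
Proof.
  intros Hr HL Hl. pose proof PI_RGT_0 as HPI.
  assert (Sub0 : forall w, (w - 0 = w)%C) by (intros; ring).
  assert (Circ : forall t, Cmod (RtoC r * cis t) = r).
  { intros t. rewrite Cmod_mult, Cmod_cis, Cmod_R, Rabs_pos_eq by lra. ring. }
  assert (NR : RtoC r <> 0%C) by (intros E; apply RtoC_inj in E; lra).
  assert (MV : forall f, (forall w, Cmod w <= r -> exists m, cder f w m) ->
     CInt (fun t => f (RtoC r * cis t))%C th (th + 2 * PI) = (RtoC (2 * PI) * f 0%C)%C).
  { intros f Hf. rewrite <- (cauchy_formula f 0%C 0%C r th).
    - apply CInt_ext; [lra|]. intros t _. rewrite Sub0.
      replace (0 + RtoC r * cis t)%C with (RtoC r * cis t)%C by ring. field.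
      split; [apply cis_neq_0|exact NR].
    - rewrite Cmod_diff_0; lra.
    - intros w Hw. apply Hf. rewrite Sub0 in Hw. exact Hw. }
  set (q := fun w => if Ceq_dec w 0%C then l else ((L w - L 0%C) / w)%C).
  assert (Hq0 : q 0%C = l) by (unfold q; destruct (Ceq_dec 0%C 0%C); congruence).
  assert (Hqw : forall w, (q w * (w - 0) = L w - L 0)%C).
  { intros w. unfold q. destruct (Ceq_dec w 0%C) as [->|N]; [ring|field; auto]. }
  assert (Dq : forall w, Cmod w <= r -> exists m, cder q w m).
  { intros w Hw. destruct (Ceq_dec w 0%C) as [->|N].
    - apply (removable_quotient L q 0%C 1); auto; [lra| |rewrite Hq0; auto].
      intros w. rewrite Sub0. apply HL.
    - destruct (HL w ltac:(lra)) as [m Hm].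
      eexists. apply (der_local Cid (fun w => (L w - L 0) / w)%C q w _ (Cmod w)).
      + apply Cmod_gt_0; auto.
      + unfold Cid; intros y Hy. unfold q. destruct (Ceq_dec y 0%C) as [->|Ny]; [|auto].
        replace (0 - w)%C with (- w)%C in Hy by ring. rewrite Cmod_opp in Hy. lra.
      + apply der_div; [apply der_minus; [exact Hm|apply der_const]|apply cder_id|auto]. }
  pose proof (MV q Dq) as M1. rewrite Hq0 in M1.
  pose proof (MV (fun w => w * (L w - RtoC kap))%C) as M2. cbn beta in M2.
  assert (D2 : forall w, Cmod w <= r -> exists m, cder (fun w => w * (L w - RtoC kap))%C w m).
  { intros w Hw. destruct (HL w ltac:(lra)) as [m Hm]. eexists.
    apply der_mult; [apply cder_id|apply der_minus; [exact Hm|apply der_const]]. }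
  specialize (M2 D2).
  assert (Ccirc : forall f, (forall w, Cmod w <= r -> exists m, cder f w m) ->
     rcont_on (fun t => f (RtoC r * cis t))%C th (th + 2 * PI)).
  { intros f Hf t _. destruct (Hf (RtoC r * cis t)%C) as [m Hm]; [rewrite Circ; lra|].
    apply (cont_comp RtoC (fun t => RtoC r * cis t)%C f); [|apply (der_cont _ _ _ _ Hm)].
    apply cont_mult; [apply cont_const|apply rcont_cis]. }
  assert (C1 := Ccirc q Dq). assert (C2 := Ccirc _ D2). cbn beta in C2.
  assert (Ccisn : forall t, rcont (fun t => cis (- t)) t).
  { intros t. apply (cont_ext RtoC (fun t => / cis t)%C).
    - intros s. pose proof (cis_neq_0 s). rewrite cis_opp.
      assert (E : (Cconj (cis s) * cis s = 1)%C).
      { rewrite Cmult_comm, <- Cmod2_conj, Cmod_cis. replace (1 ^ 2) with 1 by ring. auto. }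
      replace (Cconj (cis s)) with (Cconj (cis s) * cis s / cis s)%C by (field; auto). rewrite E. field; auto.
    - apply cont_inv; [apply rcont_cis|apply cis_neq_0]. }
  assert (M0 : CInt (fun t => cis (- t)) th (th + 2 * PI) = 0%C).
  { rewrite (CInt_rder (fun t => Ci * cis (- t))%C); [|lra| |intros t _; apply Ccisn].
    - replace (cis (- (th + 2 * PI))) with (cis (- th)); [ring|].
      rewrite !cis_opp, cis_period; auto.
    - intros t _.
      eapply der_ext; [| |apply (der_scal RtoC (fun t => (cos t, - sin t)) Ci t),
        (rder_pair cos (fun t => - sin t) t (- sin t) (- cos t))].
      + intros s. unfold cis. rewrite cos_neg, sin_neg. reflexivity.
      + unfold cis. rewrite cos_neg, sin_neg. apply C_eq_intro; unfold Ci, Re, Im; cbn; ring.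
      + auto_derive; [auto|ring].
      + auto_derive; [auto|ring]. }
  (* Splitting the cosine into two exponentials leaves three terms: the difference quotient [q],
     whose mean is [q 0 = l]; a constant times [cis (- t)], of mean zero; and the analytic function
     [w * (L w - kap)], of mean zero because it vanishes at 0. *)
  rewrite (CInt_ext _ (fun t => (cis (- al) * RtoC r) * q (RtoC r * cis t)
     + (cis (- al) * (L 0 - RtoC kap)) * cis (- t)
     + (cis al / RtoC r) * (RtoC r * cis t * (L (RtoC r * cis t) - RtoC kap)))%C); [|lra|].
  - assert (Cn : rcont_on (fun t => cis (- t)) th (th + 2 * PI)) by (intros t _; apply Ccisn).
    assert (Hle : th <= th + 2 * PI) by lra.
    pose proof (rcont_on_scal (cis (- al) * RtoC r) _ _ _ C1) as Q1.
    pose proof (rcont_on_scal (cis (- al) * (L 0 - RtoC kap)) _ _ _ Cn) as Q2.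
    pose proof (rcont_on_scal (cis al / RtoC r) _ _ _ C2) as Q3.
    assert (Q12 := fun t Ht => cont_plus _ _ _ _ (Q1 t Ht) (Q2 t Ht)).
    rewrite (CInt_plus _ _ _ _ Hle Q12 Q3), (CInt_plus _ _ _ _ Hle Q1 Q2).
    rewrite (CInt_scal _ _ _ _ Hle C1), (CInt_scal _ _ _ _ Hle Cn), (CInt_scal _ _ _ _ Hle C2), M0, M1, M2.
    field. auto.
  - intros t _.
    assert (E1 : RtoC (2 * cos (al + t)) = (cis (- al) * cis (- t) + cis al * cis t)%C).
    { rewrite <- !cis_plus. replace (- al + - t) with (- (al + t)) by ring.
      apply C_eq_intro; unfold cis, Re, Im; cbn; rewrite ?cos_neg, ?sin_neg; ring. }
    assert (E2 : (cis (- t) * cis t = 1)%C).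
    { rewrite <- cis_plus. replace (- t + t) with 0 by ring. unfold cis. rewrite cos_0, sin_0. auto. }
    specialize (Hqw (RtoC r * cis t)%C). rewrite Sub0 in Hqw.
    assert (E3 : (RtoC r * q (RtoC r * cis t) = (L (RtoC r * cis t) - L 0) * cis (- t))%C).
    { rewrite <- Hqw. transitivity (RtoC r * q (RtoC r * cis t) * (cis (- t) * cis t))%C; [rewrite E2; ring|ring]. }
    rewrite E1.
    transitivity (cis (- al) * (RtoC r * q (RtoC r * cis t)) + cis (- al) * (L 0 - RtoC kap) * cis (- t)
      + cis al * cis t * (L (RtoC r * cis t) - RtoC kap))%C.
    + rewrite E3. ring.
    + field. auto.
Qed.

Lemma continuous_scaled_cos (k al t : R) : continuous (fun t => k * cos (al + t)) t.
Proof.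
  apply (ex_derive_continuous (K := R_AbsRing) (V := R_NormedModule)). auto_derive; auto.
Qed.

(** With [al] the argument of [l], the circle integral equals [2 PI r |l|]. As [|cos|] has integral
    4 over a period, it is at most [8 M], and [r] tends to 1. *)
Lemma gradient_estimate (L : C -> C) (l : C) (kap M : R) :
  (forall w, Cmod w < 1 -> exists m, cder L w m) -> cder L 0%C l ->
  (forall w, Cmod w < 1 -> Rabs (Re (L w) - kap) <= M) ->
  PI * Cmod l <= 4 * M.
Proof.
  intros HL Hl HM. pose proof PI_RGT_0 as HPI.
  assert (HM0 : 0 <= M).
  { specialize (HM 0%C). rewrite Cmod_0 in HM. specialize (HM ltac:(lra)).
    pose proof (Rabs_pos (Re (L 0%C) - kap)). lra. }
  destruct (Ceq_dec l 0%C) as [->|Nl]; [rewrite Cmod_0; lra|].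
  destruct (cexp_surj l Nl) as [w Hw]. set (al := Im w).
  assert (El : l = (RtoC (Cmod l) * cis al)%C) by (rewrite <- Hw, Cmod_cexp; apply cexp_polar).
  assert (Er : forall r, 0 < r < 1 -> PI * (r * Cmod l) <= 4 * M).
  (* Starting at a zero of [cos (al + t)] makes the cosine nonnegative on the first half turn and
     nonpositive on the second. *)
  { intros r Hr. set (th := - al - PI / 2).
    pose proof (circle_derivative L l kap r al th Hr HL Hl) as E.
    set (X := fun t => (RtoC (2 * cos (al + t)) * (L (RtoC r * cis t) - RtoC kap))%C) in E.
    assert (Circ : forall t, Cmod (RtoC r * cis t) < 1).
    { intros t. rewrite Cmod_mult, Cmod_cis, Cmod_R, Rabs_pos_eq by lra. lra. }
    assert (CX : rcont_on X th (th + 2 * PI)).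
    { intros t _. apply cont_mult.
      - apply rcont_of_real, continuous_scaled_cos.
      - apply cont_minus; [|apply cont_const].
        destruct (HL _ (Circ t)) as [m Hm].
        apply (cont_comp RtoC (fun t => RtoC r * cis t)%C L); [|apply (der_cont _ _ _ _ Hm)].
        apply cont_mult; [apply cont_const|apply rcont_cis]. }
    assert (RX : forall t, Re (X t) = 2 * cos (al + t) * (Re (L (RtoC r * cis t)%C) - kap)).
    { intros t. unfold X. rewrite Re_mult, Re_RtoC, Im_RtoC, Re_minus, Re_RtoC. ring. }
    assert (Half : forall s a b, (s = 1 \/ s = -1) -> th <= a <= b -> b <= th + 2 * PI ->
      (forall t, a <= t <= b -> 0 <= s * cos (al + t)) ->
      Re (CInt X a b) <= s * (2 * M * sin (al + b)) - s * (2 * M * sin (al + a))).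
    { intros s a b Hs Ha Hb Hcos.
      apply (CInt_Re_le X (fun t => s * (2 * M * sin (al + t))) (fun t => s * (2 * M) * cos (al + t))).
      - lra.
      - intros t Ht; apply CX; lra.
      - intros t _. auto_derive; [auto|ring].
      - intros t _. apply continuous_scaled_cos.
      - intros t Ht. rewrite RX. specialize (Hcos t Ht). specialize (HM _ (Circ t)). apply Rabs_le_between in HM.
        set (u := Re (L (RtoC r * cis t)%C) - kap) in *. set (x := cos (al + t)) in *.
        replace (2 * x * u) with (2 * (s * x) * (s * u)) by (destruct Hs; subst s; ring).
        replace (s * (2 * M) * x) with (2 * (s * x) * M) by ring.
        apply Rmult_le_compat_l; [lra|]. destruct Hs; subst s; lra. }
    assert (H1 := Half 1 th (th + PI)). assert (H2 := Half (-1) (th + PI) (th + 2 * PI)).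
    rewrite <- (CInt_Chasles X th (th + PI) (th + 2 * PI)) in E by (auto; lra).
    apply (f_equal Re) in E. rewrite Re_plus in E.
    replace (cis (- al) * (RtoC (2 * PI) * (RtoC r * l)))%C with (RtoC (2 * (PI * (r * Cmod l)))) in E.
    2:{ rewrite El at 2.
        assert (Ec : (cis (- al) * cis al = 1)%C).
        { rewrite <- cis_plus. replace (- al + al) with 0 by ring. unfold cis. rewrite cos_0, sin_0. auto. }
        transitivity (RtoC (2 * PI) * RtoC r * RtoC (Cmod l) * (cis (- al) * cis al))%C; [|ring].
        rewrite Ec, !RtoC_mult. ring. }
    rewrite Re_RtoC in E.
    assert (A1 : al + th = - (PI / 2)) by (unfold th; ring).
    assert (A2 : al + (th + PI) = PI / 2) by (unfold th; field).
    assert (A3 : al + (th + 2 * PI) = PI / 2 + PI) by (unfold th; field).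
    rewrite A1, A2 in H1. rewrite A2, A3 in H2.
    rewrite neg_sin, sin_PI2 in H2. rewrite sin_neg, sin_PI2 in H1.
    assert (H1' := H1 (or_introl eq_refl) ltac:(lra) ltac:(lra)).
    assert (H2' := H2 (or_intror eq_refl) ltac:(lra) ltac:(lra)).
    assert (K1 : forall t, th <= t <= th + PI -> 0 <= 1 * cos (al + t)).
    { intros t Ht. rewrite Rmult_1_l. apply cos_ge_0; lra. }
    assert (K2 : forall t, th + PI <= t <= th + 2 * PI -> 0 <= -1 * cos (al + t)).
    { intros t Ht. assert (cos (al + t) <= 0) by (apply cos_le_0; lra). lra. }
    specialize (H1' K1). specialize (H2' K2). lra. }
  apply Rnot_lt_le. intros N.
  set (A := PI * Cmod l) in *.
  (* Midway between [4 * M / A] and 1, so that [r * A] still exceeds [4 * M]. *)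
  set (r := (1 + 4 * M / A) / 2).
  assert (HA : 0 < A) by lra.
  assert (B1 : 4 * M / A < 1) by (apply Rlt_div_l; lra).
  assert (B0 : 0 <= 4 * M / A) by (apply Rdiv_le_0_compat; lra).
  assert (B2 : 4 * M / A * A = 4 * M) by (field; lra).
  specialize (Er r ltac:(unfold r; lra)).
  replace (PI * (r * Cmod l)) with (r * A) in Er by (unfold A; ring).
  unfold r in Er. nra.
Qed.

Definition unit_disc (z : C) : Prop := Cmod z < 1.

Lemma unit_disc_neq (z : C) : unit_disc z -> (1 - z <> 0)%C /\ (1 + z <> 0)%C.
Proof.
  unfold unit_disc. intros Hz. split; intros E.
  - assert (Ez : z = 1%C) by (replace z with (1 - (1 - z))%C by ring; rewrite E; ring).
    rewrite Ez, Cmod_1 in Hz. lra.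
  - assert (Ez : z = (- (1))%C) by (replace z with (1 + z - 1)%C by ring; rewrite E; ring).
    rewrite Ez, Cmod_m1 in Hz. lra.
Qed.

Lemma cayley_Re_pos (z : C) : unit_disc z -> 0 < Re ((1 + z) / (1 - z)).
Proof.
  intros Hz. destruct (unit_disc_neq z Hz) as [N _].
  assert (P : 0 < Cmod (1 - z)) by (apply Cmod_gt_0, N).
  assert (E : ((1 + z) / (1 - z) = (1 + z) * Cconj (1 - z) * RtoC (/ (Cmod (1 - z) ^ 2)))%C).
  { rewrite RtoC_inv by (apply pow_nonzero; lra).
    rewrite Cmod2_conj. field. split; [|auto].
    intros E. apply N. rewrite <- (Cconj_conj (1 - z)), E. apply C_eq_intro; cbn; ring. }
  assert (Q : Cmod z ^ 2 < 1) by (pose proof (Cmod_ge_0 z); unfold unit_disc in Hz; cbn; nra).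
  rewrite Cmod2_alt in Q.
  rewrite E, Re_mult, Re_RtoC, Im_RtoC.
  assert (E2 : Re ((1 + z) * Cconj (1 - z)) = 1 - (Re z ^ 2 + Im z ^ 2)).
  { destruct z as [a b]. unfold Cconj, Re, Im; cbn. ring. }
  rewrite E2. assert (0 < / (Cmod (1 - z) ^ 2)) by (apply Rinv_0_lt_compat, pow_lt; auto).
  assert (0 < (1 - (Re z ^ 2 + Im z ^ 2)) * / (Cmod (1 - z) ^ 2)) by (apply Rmult_lt_0_compat; lra). lra.
Qed.

(** The Cayley map [T] sends the disc into the left half-plane with [T 0 = z] and
    [|T' 0| = 2 |Re z|]; the estimate at the centre of the disc is transported by the chain rule. *)
Lemma half_plane_derivative (G G' : C -> C) (kap M : R) (z : C) :
  (forall w, Re w < 0 -> cder G w (G' w)) ->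
  (forall w, Re w < 0 -> Rabs (Re (G w) - kap) <= M) ->
  Re z < 0 -> Cmod (G' z) <= 2 * M / PI / - Re z.
Proof.
  intros HG HM Hz. pose proof PI_RGT_0 as HPI.
  set (d := - Re z). assert (Hd : 0 < d) by (unfold d; lra).
  set (T := fun w => (Ci * RtoC (Im z) - RtoC d * ((1 + w) / (1 - w)))%C).
  assert (NZ : forall w, Cmod w < 1 -> (1 - w <> 0)%C) by (intros w Hw; apply (unit_disc_neq w Hw)).
  assert (DT : forall w, Cmod w < 1 -> cder T w (- RtoC d * (2 / ((1 - w) * (1 - w))))%C).
  { intros w Hw. eapply der_ext; [| |apply (der_minus Cid (fun _ => Ci * RtoC (Im z))%C
      (fun w => RtoC d * ((1 + w) / (1 - w)))%C); [apply der_const|apply der_scal, der_div;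
        [apply der_plus; [apply der_const|apply cder_id]|apply der_minus; [apply der_const|apply cder_id]|apply NZ, Hw]]].
    - reflexivity.
    - cbn beta. field. apply NZ, Hw. }
  assert (RT : forall w, Cmod w < 1 -> Re (T w) < 0).
  { intros w Hw. pose proof (cayley_Re_pos w Hw) as Q.
    unfold T. rewrite Re_minus, !Re_mult, !Re_RtoC, !Im_RtoC.
    replace (Re Ci) with 0 by reflexivity.
    assert (0 < d * Re ((1 + w) / (1 - w))) by (apply Rmult_lt_0_compat; auto). lra. }
  assert (T0 : T 0%C = z).
  { unfold T. replace ((1 + 0) / (1 - 0))%C with (RtoC 1) by (field; intros E; apply (f_equal Re) in E; cbn in E; lra).
    unfold d. apply C_eq_intro; unfold Re, Im; cbn; ring. }
  assert (C0 : Cmod 0 < 1) by (rewrite Cmod_0; lra).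
  assert (D0 : cder (fun w => G (T w)) 0%C (G' z * (- RtoC d * 2))%C).
  { eapply der_ext; [| |apply (der_comp Cid T G); [apply DT, C0|rewrite T0; apply HG, Hz]].
    - reflexivity.
    - field. }
  pose proof (gradient_estimate (fun w => G (T w)) (G' z * (- RtoC d * 2))%C kap M) as E.
  rewrite !Cmod_mult, Cmod_opp, !Cmod_R, !Rabs_pos_eq in E by lra.
  assert (B : PI * (Cmod (G' z) * (d * 2)) <= 4 * M).
  { apply E; auto.
    intros w Hw. eexists. apply (der_comp Cid T G); [apply DT, Hw|apply HG, RT, Hw]. }
  apply (Rmult_le_reg_r (d * PI)); [apply Rmult_lt_0_compat; lra|].
  replace (2 * M / PI / d * (d * PI)) with (2 * M) by (field; lra). lra.
Qed.

(** * Injectivity on the half-plane *)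

Lemma Cmod_sqr (z : C) : Cmod z * Cmod z = Re z * Re z + Im z * Im z.
Proof. pose proof (Cmod2_alt z) as H; cbn in H. nra. Qed.

Lemma Cmod_le_of_sqr (z : C) (B : R) : 0 <= B -> Re z * Re z + Im z * Im z <= B * B -> Cmod z <= B.
Proof. intros HB H. rewrite <- Cmod_sqr in H. pose proof (Cmod_ge_0 z). nra. Qed.

Lemma Cmod_lt_of_sqr (z : C) (B : R) : 0 <= B -> B * B < Re z * Re z + Im z * Im z -> B < Cmod z.
Proof. intros HB H. rewrite <- Cmod_sqr in H. pose proof (Cmod_ge_0 z). nra. Qed.

(* [F] stands for [log f (exp w)], [P] for [F'], [G] for [log P], and [c] for [delta / PI]. *)
Definition half_plane_data (c : R) (F P G G' : C -> C) : Prop :=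
  forall w, Re w < 0 ->
    cder F w (P w) /\ cder G w (G' w) /\ Cmod (G' w) <= c / - Re w /\ P w <> 0%C /\
    forall w0, Re w0 < 0 -> P w = (P w0 * cexp (G w - G w0))%C.

(* [|gamma'| = |Re gamma| / x] says that [ln x] is a hyperbolic arc length. *)
Lemma derivative_along_geodesic (c : R) (F P G G' : C -> C) (g g' : R -> C) (x1 x0 : R) :
  0 <= c -> half_plane_data c F P G G' -> 0 < x1 <= x0 ->
  (forall x, x1 <= x <= x0 -> rder g x (g' x) /\ Re (g x) < 0 /\ Cmod (g' x) <= - Re (g x) / x) ->
  Cmod (P (g x1) - P (g x0)) <= Cmod (P (g x0)) * (exp (c * (ln x0 - ln x1)) - 1).
Proof.
  intros Hc HD Hx Hg.
  destruct (Hg x0 ltac:(lra)) as [_ [N0 _]]. destruct (Hg x1 ltac:(lra)) as [_ [N1 _]].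
  assert (E : Cmod (G (g x0) - G (g x1)) <= c * ln x0 - c * ln x1).
  { apply (curve_mean_value (fun x => G (g x)) (fun x => G' (g x) * g' x)%C (fun x => c * ln x) (fun x => c / x)).
    - lra.
    - intros t Ht. destruct (Hg t Ht) as [D [N _]]. apply (der_comp RtoC g G); [auto|apply HD; auto].
    - intros t Ht. auto_derive; [lra|field; lra].
    - intros t Ht. destruct (Hg t Ht) as [_ [N B]]. destruct (HD (g t) N) as [_ [_ [B' _]]].
      rewrite Cmod_mult. replace (c / t) with (c / - Re (g t) * (- Re (g t) / t)) by (field; lra).
      apply Rmult_le_compat; auto using Cmod_ge_0. }
  destruct (HD (g x1) N1) as [_ [_ [_ [_ EP]]]]. rewrite (EP (g x0) N0).
  replace (P (g x0) * cexp (G (g x1) - G (g x0)) - P (g x0))%C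
    with (P (g x0) * (cexp (G (g x1) - G (g x0)) - 1))%C by ring.
  rewrite Cmod_mult. apply Rmult_le_compat_l; [apply Cmod_ge_0|].
  eapply Rle_trans; [apply Cmod_cexp_minus_1|]. apply Rplus_le_compat_r.
  rewrite Cmod_sub_sym. destruct (Rle_lt_or_eq_dec _ _ E) as [E'|E'].
  - apply Rlt_le, exp_increasing. lra.
  - rewrite E'. right. f_equal. ring.
Qed.

(** The exponential is [(x0 / x)^c]. The majorant [psi'] is left open, so that each bound on the
    speed of [g] can be chosen to have an explicit primitive. *)
Lemma geodesic_error (c : R) (F P G G' : C -> C) (g g' : R -> C) (psi psi' : R -> R) (x1 x0 : R) :
  0 <= c -> half_plane_data c F P G G' -> 0 < x1 <= x0 ->
  (forall x, x1 <= x <= x0 -> rder g x (g' x) /\ Re (g x) < 0 /\ Cmod (g' x) <= - Re (g x) / x) ->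
  (forall x, x1 <= x <= x0 -> is_derive psi x (psi' x)) ->
  (forall x, x1 <= x <= x0 -> (exp (c * (ln x0 - ln x)) - 1) * Cmod (g' x) <= psi' x) ->
  Cmod (F (g x0) - F (g x1) - P (g x0) * (g x0 - g x1)) <= Cmod (P (g x0)) * (psi x0 - psi x1).
Proof.
  intros Hc HD Hx Hg Hpsi Hle.
  set (m := Cmod (P (g x0))). assert (Hm : 0 <= m) by apply Cmod_ge_0.
  replace (m * (psi x0 - psi x1)) with (m * psi x0 - m * psi x1) by ring.
  replace (F (g x0) - F (g x1) - P (g x0) * (g x0 - g x1))%C
    with ((F (g x0) - P (g x0) * g x0) - (F (g x1) - P (g x0) * g x1))%C by ring.
  apply (curve_mean_value (fun x => F (g x) - P (g x0) * g x)%C (fun x => P (g x) * g' x - P (g x0) * g' x)%C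
    (fun x => m * psi x) (fun x => m * psi' x)).
  - lra.
  - intros t Ht. destruct (Hg t Ht) as [D [N _]].
    apply der_minus; [apply (der_comp RtoC g F); [auto|apply HD; auto]|apply der_scal; auto].
  - intros t Ht. apply is_derive_scal, Hpsi; auto.
  - intros t Ht. replace (P (g t) * g' t - P (g x0) * g' t)%C with ((P (g t) - P (g x0)) * g' t)%C by ring.
    rewrite Cmod_mult.
    transitivity (m * (exp (c * (ln x0 - ln t)) - 1) * Cmod (g' t)).
    + apply Rmult_le_compat_r; [apply Cmod_ge_0|].
      apply (derivative_along_geodesic c F P G G' g g'); auto; [lra|]. intros x Hx'; apply Hg; lra.
    + rewrite Rmult_assoc. apply Rmult_le_compat_l; auto.
Qed.

Lemma exp_ln_ge_1 (c x x0 : R) : 0 <= c -> 0 < x <= x0 -> 1 <= exp (c * (ln x0 - ln x)).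
Proof.
  intros Hc Hx. rewrite <- exp_0.
  assert (H : ln x <= ln x0) by (destruct (Rle_lt_or_eq_dec x x0) as [E|E]; [lra|apply Rlt_le, ln_increasing; lra|subst; lra]).
  assert (H1 : 0 <= c * (ln x0 - ln x)) by (apply Rmult_le_pos; lra).
  destruct (Rle_lt_or_eq_dec _ _ H1) as [E|E]; [apply Rlt_le, exp_increasing; auto|rewrite <- E; lra].
Qed.

(** For speed at most [K] the error is [K] times the integral of [(x0 / x)^c - 1], whose primitive
    stays bounded at 0 since [c < 1]. Replacing [(x0 / x1)^c] by 1 at the lower end gives the linear
    bound. *)
Lemma geodesic_error_lipschitz (c : R) (F P G G' : C -> C) (g g' : R -> C) (K x1 x0 : R) :
  0 <= c < 1 -> half_plane_data c F P G G' -> 0 < x1 <= x0 ->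
  (forall x, x1 <= x <= x0 -> rder g x (g' x) /\ Re (g x) < 0 /\ Cmod (g' x) <= - Re (g x) / x) ->
  (forall x, x1 <= x <= x0 -> Cmod (g' x) <= K) ->
  Cmod (F (g x0) - F (g x1) - P (g x0) * (g x0 - g x1))
    <= Cmod (P (g x0)) * (K * (c / (1 - c)) * (x0 - x1)).
Proof.
  intros Hc HD Hx Hg HK.
  assert (HK0 : 0 <= K) by (specialize (HK x0 ltac:(lra)); pose proof (Cmod_ge_0 (g' x0)); lra).
  eapply Rle_trans.
  - apply (geodesic_error c F P G G' g g'
      (fun x => K * (x * exp (c * (ln x0 - ln x)) / (1 - c) - x))
      (fun x => K * (exp (c * (ln x0 - ln x)) - 1))); auto; [lra| |].
    + intros x Hx'. auto_derive; [lra|]. unfold Rminus. field. lra.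
    + intros x Hx'. rewrite Rmult_comm. apply Rmult_le_compat_r; [|auto].
      pose proof (exp_ln_ge_1 c x x0 ltac:(lra) ltac:(lra)). lra.
  - apply Rmult_le_compat_l; [apply Cmod_ge_0|].
    pose proof (exp_ln_ge_1 c x1 x0 ltac:(lra) ltac:(lra)) as H1.
    replace (ln x0 - ln x0) with 0 by ring. rewrite Rmult_0_r, exp_0.
    set (E := exp (c * (ln x0 - ln x1))) in *.
    rewrite <- Rmult_minus_distr_l, Rmult_assoc. apply Rmult_le_compat_l; auto.
    assert (HE : x1 * 1 / (1 - c) <= x1 * E / (1 - c)).
    { apply Rmult_le_compat_r; [apply Rlt_le, Rinv_0_lt_compat; lra|apply Rmult_le_compat_l; lra]. }
    replace (c / (1 - c) * (x0 - x1)) with (x0 * 1 / (1 - c) - x0 - (x1 * 1 / (1 - c) - x1)) by (field; lra).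
    lra.
Qed.

(* The hyperbolic geodesic with centre [i y0] and radius [rho], from its apex at
   [x = 1] to its upper ([sg = 1]) or lower ([sg = -1]) end at [x = 0]. *)
Definition arc (y0 rho sg x : R) : C :=
  (- (rho * (2 * x / (1 + x * x))), y0 + sg * (rho * ((1 - x * x) / (1 + x * x)))).
Definition arc' (y0 rho sg x : R) : C :=
  (- (rho * (2 * (1 - x * x) / ((1 + x * x) * (1 + x * x)))),
   sg * (rho * (- 4 * x / ((1 + x * x) * (1 + x * x))))).

Lemma one_plus_sqr_pos (x : R) : 0 < 1 + x * x.
Proof. nra. Qed.

Lemma Cmod_arc' (y0 rho sg x : R) : 0 < rho -> sg * sg = 1 ->
  Cmod (arc' y0 rho sg x) <= 2 * rho / (1 + x * x).
Proof.
  intros Hr Hs. pose proof (one_plus_sqr_pos x) as P.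
  apply Cmod_le_of_sqr; [apply Rdiv_le_0_compat; lra|].
  unfold arc', Re, Im; cbn [fst snd]. right.
  transitivity ((rho * (2 * (1 - x * x) / ((1 + x * x) * (1 + x * x)))) ^ 2
    + (sg * sg) * (rho * (4 * x / ((1 + x * x) * (1 + x * x)))) ^ 2); [field; nra|rewrite Hs; field; nra].
Qed.

Lemma arc_geodesic (y0 rho sg x : R) : 0 < rho -> sg * sg = 1 -> 0 < x ->
  rder (arc y0 rho sg) x (arc' y0 rho sg x) /\ Re (arc y0 rho sg x) < 0 /\
  Cmod (arc' y0 rho sg x) <= - Re (arc y0 rho sg x) / x.
Proof.
  intros Hr Hs Hx. pose proof (one_plus_sqr_pos x) as P.
  assert (E : - Re (arc y0 rho sg x) / x = 2 * rho / (1 + x * x)) by (unfold arc, Re; cbn [fst]; field; nra).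
  split; [|split].
  - apply rder_pair; auto_derive; try nra; field; nra.
  - assert (0 < 2 * rho / (1 + x * x)) by (apply Rdiv_lt_0_compat; lra).
    assert (E2 : Re (arc y0 rho sg x) = - (2 * rho / (1 + x * x)) * x) by (unfold arc, Re; cbn [fst]; field; nra).
    rewrite E2. nra.
  - rewrite E. apply Cmod_arc'; auto.
Qed.

(* For [c] close to [1 / 3], integrating [x^-c - 1] against [2 / (1 + x^2)] over [0, 1]
   gives about [0.95]; the crude bound [2 / (1 + x^2) <= 2] would give [1] already at
   [c = 1 / 3], hence the second integrand below for small [x]. *)
Lemma apex_error (F P G G' : C -> C) (y0 rho sg x : R) :
  half_plane_data (167 / 500) F P G G' -> 0 < rho -> sg * sg = 1 -> 0 < x <= 1 ->
  Cmod (F (arc y0 rho sg 1) - F (arc y0 rho sg x) - P (arc y0 rho sg 1) * (arc y0 rho sg 1 - arc y0 rho sg x))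
  <= Cmod (P (arc y0 rho sg 1)) * (99 / 100 * (rho * ((1 - x) / sqrt (1 + x * x)))).
Proof.
  intros HD Hr Hs Hx.
  assert (Hg : forall t, x <= t <= 1 -> rder (arc y0 rho sg) t (arc' y0 rho sg t) /\ Re (arc y0 rho sg t) < 0 /\
     Cmod (arc' y0 rho sg t) <= - Re (arc y0 rho sg t) / t).
  { intros t Ht. apply arc_geodesic; auto; lra. }
  set (Y := sqrt (1 + x * x)).
  assert (HY : Y * Y = 1 + x * x) by (apply sqrt_sqrt; nra).
  assert (HY0 : 0 <= Y) by apply sqrt_pos.
  assert (HY1 : 1 <= Y) by nra.
  (* The length [rho * ((1 - x) / Y)] is the chord from the apex divided by [sqrt 2]. For
     [x >= 1 / 5] the constant speed bound suffices, as [334 / 333 <= 99 / 100 * Y] once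
     [Y * Y >= 26 / 25]. *)
  destruct (Rle_dec (1 / 5) x) as [Hx5|Hx5].
  - eapply Rle_trans; [apply (geodesic_error_lipschitz (167 / 500) F P G G' (arc y0 rho sg) (arc' y0 rho sg) (2 * rho / (1 + x * x)) x 1); auto; try lra|].
    + intros t Ht. eapply Rle_trans; [apply Cmod_arc'; auto|].
      apply Rmult_le_compat_l; [lra|]. apply Rinv_le_contravar; nra.
    + apply Rmult_le_compat_l; [apply Cmod_ge_0|].
      rewrite <- HY. apply (Rmult_le_reg_r (Y * Y)); [nra|].
      replace (2 * rho / (Y * Y) * (167 / 500 / (1 - 167 / 500)) * (1 - x) * (Y * Y))
        with (rho * (1 - x) * (334 / 333)) by (field; lra).
      replace (99 / 100 * (rho * ((1 - x) / Y)) * (Y * Y)) with (rho * (1 - x) * (99 / 100 * Y)) by (field; lra).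
      apply Rmult_le_compat_l; [apply Rmult_le_pos; lra|]. nra.
  - set (c := 167 / 500) in *.
    (* The speed [2 * rho / (1 + t * t)] is at most [rho * (2 - t * t)] on [0, 1]; the first
       function below is a primitive of [rho * (t^-c - 1) * (2 - t^2)]. *)
    eapply Rle_trans; [apply (geodesic_error c F P G G' (arc y0 rho sg) (arc' y0 rho sg)
      (fun t => rho * (2 * (t * exp (c * (ln 1 - ln t)) / (1 - c) - t)
         - (t * t * t * exp (c * (ln 1 - ln t)) / (3 - c) - t * t * t / 3)))
      (fun t => rho * ((exp (c * (ln 1 - ln t)) - 1) * (2 - t * t)))); auto|].
    + unfold c; lra.
    + intros t Ht. auto_derive; [lra|]. unfold Rminus, c. field. lra.
    + intros t Ht. pose proof (exp_ln_ge_1 c t 1 ltac:(unfold c; lra) ltac:(lra)) as H1.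
      replace (rho * ((exp (c * (ln 1 - ln t)) - 1) * (2 - t * t)))
        with ((exp (c * (ln 1 - ln t)) - 1) * (rho * (2 - t * t))) by ring.
      apply Rmult_le_compat_l; [lra|]. eapply Rle_trans; [apply Cmod_arc'; auto|].
      pose proof (one_plus_sqr_pos t).
      apply (Rmult_le_reg_r (1 + t * t)); [auto|].
      replace (2 * rho / (1 + t * t) * (1 + t * t)) with (rho * 2) by (field; lra).
      rewrite Rmult_assoc. apply Rmult_le_compat_l; [lra|].
      assert (0 <= t * t * (1 - t * t)) by (apply Rmult_le_pos; nra). nra.
    + apply Rmult_le_compat_l; [apply Cmod_ge_0|].
      rewrite <- Rmult_minus_distr_l.
      replace (99 / 100 * (rho * ((1 - x) / Y))) with (rho * ((1 - x) / Y * (99 / 100))) by ring.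
      apply Rmult_le_compat_l; [lra|].
      pose proof (exp_ln_ge_1 c x 1 ltac:(unfold c; lra) ltac:(lra)) as H1.
      replace (exp (c * (ln 1 - ln 1))) with 1 by (rewrite Rminus_diag, Rmult_0_r, exp_0; auto).
      set (E := exp (c * (ln 1 - ln x))) in *.
      assert (HE : x * (2 / (1 - c) - x * x / (3 - c)) * 1 <= x * (2 / (1 - c) - x * x / (3 - c)) * E).
      { apply Rmult_le_compat_l; auto. apply Rmult_le_pos; [lra|]. unfold c. nra. }
      (* The primitive is about 0.9612 at 1, and at least [x] at [x], because [E >= 1] and
         [x < 1 / 5]. *)
      assert (B : 2 * (1 * 1 / (1 - c) - 1) - (1 * 1 * 1 * 1 / (3 - c) - 1 * 1 * 1 / 3)
        - (2 * (x * E / (1 - c) - x) - (x * x * x * E / (3 - c) - x * x * x / 3)) <= 962 / 1000 - x).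
      { replace (2 * (x * E / (1 - c) - x) - (x * x * x * E / (3 - c) - x * x * x / 3))
          with (x * (2 / (1 - c) - x * x / (3 - c)) * E - 2 * x + x * x * x / 3) by (unfold c; field).
        unfold c in *. nra. }
      eapply Rle_trans; [exact B|].
      apply (Rmult_le_reg_r Y); [lra|].
      replace ((1 - x) / Y * (99 / 100) * Y) with ((1 - x) * (99 / 100)) by (field; lra).
      assert (HY2 : Y <= 1 + x * x / 2) by nra.
      assert ((962 / 1000 - x) * Y <= (962 / 1000 - x) * (1 + x * x / 2)) by (apply Rmult_le_compat_l; lra).
      nra.
Qed.

Lemma neq_of_error (F : C -> C) (a b p : C) :
  Cmod (F b - F a - p * (b - a)) < Cmod p * Cmod (b - a) -> F a <> F b.
Proof.
  intros H E. rewrite E in H.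
  replace (F b - F b - p * (b - a))%C with (- (p * (b - a)))%C in H by ring.
  rewrite Cmod_opp, Cmod_mult in H. lra.
Qed.

(** On one side of the apex, [x0] is the point farthest from the boundary and serves as reference.
    The chord, [2 rho (x0 - x1) / sqrt ((1 + x0^2) (1 + x1^2))], exceeds [1 / sqrt 2] of
    [2 rho (x0 - x1) / (1 + x1^2)], of which the error is only the fraction [167 / 333]. *)
Lemma same_side_neq (F P G G' : C -> C) (y0 rho sg x1 x0 : R) :
  half_plane_data (167 / 500) F P G G' -> 0 < rho -> sg * sg = 1 -> 0 < x1 < x0 -> x0 <= 1 ->
  F (arc y0 rho sg x1) <> F (arc y0 rho sg x0).
Proof.
  intros HD Hr Hs Hx Hx0.
  destruct (arc_geodesic y0 rho sg x0 Hr Hs ltac:(lra)) as [_ [N _]].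
  destruct (HD _ N) as [_ [_ [_ [NP _]]]]. apply Cmod_gt_0 in NP.
  apply (neq_of_error F _ _ (P (arc y0 rho sg x0))).
  eapply Rle_lt_trans; [apply (geodesic_error_lipschitz (167 / 500) F P G G' (arc y0 rho sg) (arc' y0 rho sg) (2 * rho / (1 + x1 * x1)) x1 x0); auto; try lra|].
  - intros t Ht. apply arc_geodesic; auto; lra.
  - intros t Ht. eapply Rle_trans; [apply Cmod_arc'; auto|].
    apply Rmult_le_compat_l; [lra|]. apply Rinv_le_contravar; nra.
  - apply Rmult_lt_compat_l; auto.
    pose proof (one_plus_sqr_pos x1) as P1. pose proof (one_plus_sqr_pos x0) as P0.
    apply Cmod_lt_of_sqr.
    + repeat apply Rmult_le_pos; try lra. apply Rlt_le, Rinv_0_lt_compat; auto.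
    + set (k := 4 * rho * rho * (x0 - x1) * (x0 - x1) / ((1 + x1 * x1) * (1 + x1 * x1))).
      assert (Hk : 0 < k) by (apply Rdiv_lt_0_compat; repeat apply Rmult_lt_0_compat; lra).
      transitivity (k * (1 / 2)).
      * replace (2 * rho / (1 + x1 * x1) * (167 / 500 / (1 - 167 / 500)) * (x0 - x1) *
          (2 * rho / (1 + x1 * x1) * (167 / 500 / (1 - 167 / 500)) * (x0 - x1)))
          with (k * (167 / 333 * (167 / 333))) by (unfold k; field; lra). nra.
      * replace (Re (arc y0 rho sg x0 - arc y0 rho sg x1))
          with (rho * (2 * x1 / (1 + x1 * x1)) - rho * (2 * x0 / (1 + x0 * x0)))
          by (rewrite Re_minus; unfold arc, Re; cbn [fst]; ring).
        replace (Im (arc y0 rho sg x0 - arc y0 rho sg x1))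
          with (sg * (rho * ((1 - x0 * x0) / (1 + x0 * x0)) - rho * ((1 - x1 * x1) / (1 + x1 * x1))))
          by (rewrite Im_minus; unfold arc, Im; cbn [snd]; ring).
        match goal with |- _ < ?A * ?A + (sg * ?B) * (sg * ?B) =>
          replace (A * A + (sg * B) * (sg * B)) with (k * ((1 + x1 * x1) / (1 + x0 * x0))) end.
        2:{ match goal with |- _ = ?A * ?A + (sg * ?B) * (sg * ?B) =>
              transitivity (A * A + sg * sg * (B * B)); [rewrite Hs; unfold k; field; lra|ring] end. }
        apply Rmult_lt_compat_l; [auto|]. apply (Rmult_lt_reg_r (1 + x0 * x0)); [auto|].
        replace ((1 + x1 * x1) / (1 + x0 * x0) * (1 + x0 * x0)) with (1 + x1 * x1) by (field; lra). nra.
Qed.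

(** The two apex errors are 99 hundredths of lengths whose sum is at most [|b - a|]: the chord times
    [X * Y] is [rho ((1 - x) (1 + y) + (1 - y) (1 + x))], while [X <= 1 + x] and [Y <= 1 + y]. *)
Lemma opposite_sides_neq (F P G G' : C -> C) (y0 rho x y : R) :
  half_plane_data (167 / 500) F P G G' -> 0 < rho -> 0 < x <= 1 -> 0 < y <= 1 ->
  arc y0 rho 1 x <> arc y0 rho (-1) y ->
  F (arc y0 rho 1 x) <> F (arc y0 rho (-1) y).
Proof.
  intros HD Hr Hx Hy Hne.
  destruct (arc_geodesic y0 rho 1 1 Hr ltac:(lra) ltac:(lra)) as [_ [N _]].
  destruct (HD _ N) as [_ [_ [_ [NP _]]]]. apply Cmod_gt_0 in NP.
  assert (Em : arc y0 rho (-1) 1 = arc y0 rho 1 1) by (apply C_eq_intro; unfold arc, Re, Im; cbn [fst snd]; field).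
  pose proof (apex_error F P G G' y0 rho 1 x HD Hr ltac:(lra) Hx) as A1.
  pose proof (apex_error F P G G' y0 rho (-1) y HD Hr ltac:(lra) Hy) as A2.
  rewrite Em in A2.
  set (m := arc y0 rho 1 1) in *. set (a := arc y0 rho 1 x) in *. set (b := arc y0 rho (-1) y) in *.
  apply (neq_of_error F a b (P m)).
  pose proof (Cmod_minus_le (F m - F a - P m * (m - a)) (F m - F b - P m * (m - b))) as T.
  replace (F m - F a - P m * (m - a) - (F m - F b - P m * (m - b)))%C with (F b - F a - P m * (b - a))%C in T by ring.
  set (X := sqrt (1 + x * x)) in *. set (Y := sqrt (1 + y * y)) in *.
  assert (HX : X * X = 1 + x * x) by (apply sqrt_sqrt; nra).
  assert (HX0 : 0 <= X) by apply sqrt_pos. assert (HX1 : 1 <= X) by nra.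
  assert (HY : Y * Y = 1 + y * y) by (apply sqrt_sqrt; nra).
  assert (HY0 : 0 <= Y) by apply sqrt_pos. assert (HY1 : 1 <= Y) by nra.
  assert (HXx : X <= 1 + x) by nra. assert (HYy : Y <= 1 + y) by nra.
  assert (D : Cmod (b - a) = 2 * rho * (1 - x * y) / (X * Y)).
  { assert (S : Cmod (b - a) * Cmod (b - a) = (2 * rho * (1 - x * y) / (X * Y)) * (2 * rho * (1 - x * y) / (X * Y))).
    { rewrite Cmod_sqr.
      replace (2 * rho * (1 - x * y) / (X * Y) * (2 * rho * (1 - x * y) / (X * Y)))
        with (4 * rho * rho * (1 - x * y) * (1 - x * y) / ((X * X) * (Y * Y))) by (field; lra).
      rewrite HX, HY. unfold a, b, arc, Re, Im; cbn [fst snd Cminus Cplus Copp].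
      field. pose proof (one_plus_sqr_pos x); pose proof (one_plus_sqr_pos y); lra. }
    assert (0 <= 2 * rho * (1 - x * y) / (X * Y)).
    { apply Rdiv_le_0_compat; [apply Rmult_le_pos; nra|nra]. }
    pose proof (Cmod_ge_0 (b - a)). nra. }
  assert (D2 : rho * ((1 - x) / X) + rho * ((1 - y) / Y) <= Cmod (b - a)).
  { rewrite D. apply (Rmult_le_reg_r (X * Y)); [nra|].
    replace ((rho * ((1 - x) / X) + rho * ((1 - y) / Y)) * (X * Y)) with (rho * ((1 - x) * Y + (1 - y) * X)) by (field; lra).
    replace (2 * rho * (1 - x * y) / (X * Y) * (X * Y)) with (rho * ((1 - x) * (1 + y) + (1 - y) * (1 + x))) by (field; lra).
    apply Rmult_le_compat_l; [lra|].
    apply Rplus_le_compat; apply Rmult_le_compat_l; lra. }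
  assert (D3 : 0 < Cmod (b - a)).
  { apply Cmod_gt_0. intros E. apply Hne. replace a with (b - (b - a))%C by ring. rewrite E; ring. }
  assert (M1 : Cmod (P m) * (99 / 100 * (rho * ((1 - x) / X))) + Cmod (P m) * (99 / 100 * (rho * ((1 - y) / Y)))
    <= Cmod (P m) * (99 / 100 * Cmod (b - a))).
  { rewrite <- Rmult_plus_distr_l, <- Rmult_plus_distr_l. apply Rmult_le_compat_l; lra. }
  assert (M2 : Cmod (P m) * (99 / 100 * Cmod (b - a)) < Cmod (P m) * Cmod (b - a)) by (apply Rmult_lt_compat_l; lra).
  lra.
Qed.

Lemma point_on_arc (y0 rho : R) (p : C) :
  Re p < 0 -> 0 < rho -> Re p * Re p + (Im p - y0) * (Im p - y0) = rho * rho ->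
  exists sg x, (sg = 1 \/ sg = -1) /\ 0 < x <= 1 /\ p = arc y0 rho sg x.
Proof.
  intros Hp Hr E.
  assert (Gen : forall sg, sg * sg = 1 -> 0 <= sg * (Im p - y0) -> exists x, 0 < x <= 1 /\ p = arc y0 rho sg x).
  { intros sg Hs HB. set (B := sg * (Im p - y0)) in *. set (A := - Re p).
    assert (HA : 0 < A) by (unfold A; lra).
    assert (E2 : A * A + B * B = rho * rho).
    { unfold A, B. rewrite <- E. transitivity (Re p * Re p + sg * sg * ((Im p - y0) * (Im p - y0))); [ring|rewrite Hs; ring]. }
    assert (HBr : B < rho) by nra.
    (* The tangent of half the angle between [p] and the end of the arc, seen from the centre: the
       sine over one plus the cosine. *)
    exists (A / (rho + B)).
    assert (Ex : 1 + A / (rho + B) * (A / (rho + B)) = 2 * rho / (rho + B)).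
    { transitivity (((rho + B) * (rho + B) + A * A) / ((rho + B) * (rho + B))); [field; lra|].
      replace ((rho + B) * (rho + B) + A * A) with (2 * rho * (rho + B)) by nra. field; lra. }
    split.
    - split; [apply Rdiv_lt_0_compat; lra|]. apply Rle_div_l; [lra|]. nra.
    - apply C_eq_intro; unfold arc; cbn [Re Im fst snd].
      + replace (Re p) with (- A) by (unfold A; ring). unfold Re; cbn [fst]. rewrite Ex. field. lra.
      +
        replace (1 - A / (rho + B) * (A / (rho + B))) with (2 - (1 + A / (rho + B) * (A / (rho + B)))) by ring.
        rewrite Ex.
        replace (sg * (rho * ((2 - 2 * rho / (rho + B)) / (2 * rho / (rho + B))))) with (sg * B) by (field; lra).
        unfold B. transitivity (y0 + sg * sg * (Im p - y0)); [rewrite Hs; ring|ring]. }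
  destruct (Rle_dec 0 (Im p - y0)) as [H|H].
  - destruct (Gen 1 ltac:(lra) ltac:(lra)) as [x [Hx Ep]]. exists 1, x; auto.
  - destruct (Gen (-1) ltac:(lra) ltac:(lra)) as [x [Hx Ep]]. exists (-1), x; auto.
Qed.

Lemma half_plane_injective (F P G G' : C -> C) (a b : C) :
  half_plane_data (167 / 500) F P G G' -> Re a < 0 -> Re b < 0 -> F a = F b -> a = b.
Proof.
  intros HD Ha Hb E. destruct (Ceq_dec a b) as [Eab|Nab]; [auto|exfalso].
  destruct (Req_dec (Im a) (Im b)) as [EI|NI].
  (* Points at equal height lie on a geodesic that is a horizontal line. It has unit speed, so the
     relative error is [c / (1 - c) = 167 / 333 < 1]. *)
  - assert (Line : forall y x1 x0, 0 < x1 < x0 -> F (- x1, y) <> F (- x0, y)).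
    { intros y x1 x0 Hx. set (g := fun x : R => (- x, y)).
      assert (Hg : forall x, x1 <= x <= x0 -> rder g x (RtoC (-1)) /\ Re (g x) < 0 /\ Cmod (RtoC (-1)) <= - Re (g x) / x).
      { intros x Hx'. split; [|split].
        - apply (rder_pair (fun x => - x) (fun _ => y) x (-1) 0); auto_derive; auto; ring.
        - unfold g, Re; cbn; lra.
        - rewrite Cmod_R, Rabs_left by lra. unfold g, Re; cbn. right. field. lra. }
      destruct (Hg x0 ltac:(lra)) as [_ [N _]].
      destruct (HD _ N) as [_ [_ [_ [NP _]]]]. apply Cmod_gt_0 in NP.
      apply (neq_of_error F _ _ (P (g x0))).
      eapply Rle_lt_trans; [apply (geodesic_error_lipschitz (167 / 500) F P G G' g (fun _ => RtoC (-1)) 1 x1 x0); auto; try lra|].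
      - intros x Hx'. rewrite Cmod_R, Rabs_left; lra.
      - apply Rmult_lt_compat_l; auto.
        assert (EE : (g x0 - g x1)%C = RtoC (- (x0 - x1))) by (apply C_eq_intro; unfold g, Re, Im; cbn; ring).
        change (1 * (167 / 500 / (1 - 167 / 500)) * (x0 - x1) < Cmod (g x0 - g x1)).
        rewrite EE, Cmod_R, Rabs_Ropp, Rabs_pos_eq by lra. lra. }
    destruct a as [xa ya], b as [xb yb]. unfold Re, Im in *; cbn in *. subst yb.
    destruct (Rtotal_order xa xb) as [L|[L|L]].
    + apply (Line ya (- xb) (- xa)); [lra|]. rewrite !Ropp_involutive. auto.
    + subst xb. auto.
    + apply (Line ya (- xa) (- xb)); [lra|]. rewrite !Ropp_involutive. auto.
  (* The height of the point of the imaginary axis equidistant from [a] and [b], centre of the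
     geodesic through them. *)
  - set (y0 := (Re b * Re b + Im b * Im b - Re a * Re a - Im a * Im a) / (2 * (Im b - Im a))).
    assert (Ey : 2 * (Im b - Im a) * y0 = Re b * Re b + Im b * Im b - Re a * Re a - Im a * Im a)
      by (unfold y0; field; lra).
    set (rho := sqrt (Re a * Re a + (Im a - y0) * (Im a - y0))).
    assert (Pr : 0 < Re a * Re a + (Im a - y0) * (Im a - y0)).
    { pose proof (Rle_0_sqr (Im a - y0)) as Q; unfold Rsqr in Q.
      assert (0 < Re a * Re a) by nra. lra. }
    assert (Hr : 0 < rho) by (apply sqrt_lt_R0; auto).
    assert (Er : Re a * Re a + (Im a - y0) * (Im a - y0) = rho * rho) by (symmetry; apply sqrt_sqrt; lra).
    destruct (point_on_arc y0 rho a Ha Hr Er) as [s [x [Hs [Hx Eqa]]]].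
    destruct (point_on_arc y0 rho b Hb Hr) as [s' [x' [Hs' [Hx' Eqb]]]]; [rewrite <- Er; nra|].
    assert (Same : forall sg, sg * sg = 1 -> a = arc y0 rho sg x -> b = arc y0 rho sg x' -> False).
    { intros sg Hsg Ea Eb. destruct (Rtotal_order x x') as [L|[L|L]].
      - apply (same_side_neq F P G G' y0 rho sg x x'); auto; try lra. congruence.
      - subst x'. congruence.
      - apply (same_side_neq F P G G' y0 rho sg x' x); auto; try lra. congruence. }
    destruct Hs as [-> | ->], Hs' as [-> | ->].
    + apply (Same 1); auto; lra.
    + apply (opposite_sides_neq F P G G' y0 rho x x'); auto; congruence.
    + apply (opposite_sides_neq F P G G' y0 rho x' x); auto; congruence.
    + apply (Same (-1)); auto; lra.
Qed.

(** * The lower bound *)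

Lemma is_derive_cder (f : C -> C) (z l : C) :
  @is_derive C_AbsRing C_NormedModule f z l <-> cder f z l.
Proof.
  split.
  - intros [_ H] eps He.
    destruct (H z (fun P HP => HP) (mkposreal eps He)) as [d Hd].
    exists d; split; [apply cond_pos|]. unfold Cid. intros y Hy.
    specialize (Hd y Hy).
    change (Cmod (f y - f z - (y - z) * l) <= eps * Cmod (y - z)) in Hd.
    replace (l * (y - z))%C with ((y - z) * l)%C by ring. exact Hd.
  - intros H. split; [apply is_linear_scal_l|].
    intros x Hx.
    assert (E : z = x) by exact (@is_filter_lim_locally_unique C_AbsRing (AbsRing_NormedModule C_AbsRing) z x Hx).
    subst x.
    intros [eps He]. destruct (H eps He) as [d [Hd K]]. exists (mkposreal d Hd).
    intros y Hy. specialize (K y Hy). unfold Cid in K.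
    change (Cmod (f y - f z - (y - z) * l) <= eps * Cmod (y - z)).
    replace ((y - z) * l)%C with (l * (y - z))%C by ring. exact K.
Qed.

Lemma cexp_eq_1 (u : C) : cexp u = 1%C -> exists k : Z, u = (Ci * RtoC (IZR k * (2 * PI)))%C.
Proof.
  intros H.
  assert (HR : Re u = 0).
  { apply (f_equal Cmod) in H. rewrite Cmod_cexp, Cmod_1 in H. rewrite <- exp_0 in H. apply exp_inv in H. exact H. }
  destruct u as [x y]. unfold Re in HR; cbn in HR. subst x.
  unfold cexp, Re, Im in H; cbn in H. rewrite exp_0, !Rmult_1_l in H.
  injection H as Hc Hs.
  destruct (sin_eq_0_0 y Hs) as [k Hk].
  destruct (Z.Even_or_Odd k) as [[m Hm]|[m Hm]].
  - exists m. apply C_eq_intro; unfold Ci, Re, Im; cbn; [ring|].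
    rewrite Hk, Hm, mult_IZR. ring.
  - exfalso.
    assert (Ey : y = PI + 2 * IZR m * PI) by (rewrite Hk, Hm, plus_IZR, mult_IZR; ring).
    assert (E : cos (y / 2) = 0).
    { rewrite Ey. apply cos_eq_0_1. exists m. field. }
    replace y with (2 * (y / 2)) in Hc by field. rewrite cos_2a_cos, E in Hc. lra.
Qed.

Lemma left_half_plane_starlike : starlike_region (fun z => Re z < 0) (RtoC (-1)).
Proof.
  split; [rewrite Re_RtoC; lra|split].
  - intros z Hz. exists (- Re z); split; [lra|]. intros w Hw.
    pose proof (Re_le_Cmod (w - z)). rewrite Re_minus in *. lra.
  - intros z s Hz Hs. rewrite Re_plus, Re_mult, !Re_RtoC, Im_RtoC, Re_minus, Re_RtoC. nra.
Qed.

(** A derivative known only to exist at each point becomes a function; where there is none the value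
    is arbitrary. *)
Definition pick_derivative (f : C -> C) (z : C) : C := epsilon (inhabits (RtoC 0)) (fun l : C => cder f z l).

Lemma pick_derivative_spec (f : C -> C) (z : C) :
  (exists l, cder f z l) -> cder f z (pick_derivative f z).
Proof. intros H. apply (epsilon_spec (inhabits (RtoC 0)) (fun l : C => cder f z l) H). Qed.

Lemma cder_cder_half_plane (f f' : C -> C) (z : C) :
  (forall w, Re w < 0 -> cder f w (f' w)) -> Re z < 0 -> exists l, cder f' z l.
Proof.
  intros Hf Hz. apply (cder_cder f f' z (- Re z)); [lra|].
  intros w Hw. apply Hf. pose proof (Re_le_Cmod (w - z)). rewrite Re_minus in *. lra.
Qed.

Lemma log_derivative_data (P : C -> C) (c : R) :
  (forall w, Re w < 0 -> exists l, cder P w l) ->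
  (forall w, Re w < 0 -> exp (- (c * PI / 2)) < Cmod (P w) < exp (c * PI / 2)) ->
  exists F G G', half_plane_data c F P G G'.
Proof.
  intros HP HB. pose proof left_half_plane_starlike as HS. pose proof PI_RGT_0 as HPI.
  set (P' := pick_derivative P).
  assert (DP : forall w, Re w < 0 -> cder P w (P' w)) by (intros w Hw; apply pick_derivative_spec, HP, Hw).
  assert (NP : forall w, Re w < 0 -> P w <> 0%C).
  { intros w Hw. apply Cmod_gt_0. pose proof (HB w Hw). pose proof (exp_pos (- (c * PI / 2))). lra. }
  set (G' := fun w => (P' w / P w)%C).
  assert (DG' : forall w, Re w < 0 -> exists l, cder G' w l).
  { intros w Hw. destruct (cder_cder_half_plane P P' w DP Hw) as [l Hl].
    eexists. apply der_div; [exact Hl|apply DP, Hw|apply NP, Hw]. }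
  destruct (primitive_exists _ _ G' HS DG') as [G [_ DG]].
  destruct (primitive_exists _ _ P HS HP) as [F [_ DF]].
  pose proof (exp_of_log_derivative _ _ P P' G HS DP) as EP.
  assert (EP' : forall z, Re z < 0 -> P z = (P (RtoC (-1)) * cexp (G z - G (RtoC (-1))))%C).
  { apply EP. intros z Hz. exists (G' z). split; [apply DG, Hz|]. unfold G'. field. apply NP, Hz. }
  exists F, G, G'. intros w Hw. split; [apply DF, Hw|split; [apply DG, Hw|split; [|split; [apply NP, Hw|]]]].
  - set (z0 := RtoC (-1)) in *.
    (* [G] is a logarithm of [P] only up to an additive constant. Subtracting
       [Re (G z0) - ln |P z0|] turns [Re G] into [ln |P|], which is within [c * PI / 2] of 0. *)
    assert (P0 : 0 < Cmod (P z0)) by (apply Cmod_gt_0, NP; unfold z0; rewrite Re_RtoC; lra).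
    pose proof (half_plane_derivative G G' (Re (G z0) - ln (Cmod (P z0))) (c * PI / 2) w DG) as H.
    replace (2 * (c * PI / 2) / PI) with c in H by (field; lra).
    apply H; auto. intros z Hz. specialize (HB z Hz). rewrite (EP' z Hz), Cmod_mult, Cmod_cexp, Re_minus in HB.
    rewrite <- (exp_ln _ P0), <- exp_plus in HB.
    destruct HB as [B1 B2]. apply exp_lt_inv in B1. apply exp_lt_inv in B2.
    apply Rabs_le. lra.
  - intros w0 Hw0. rewrite (EP' w Hw), (EP' w0 Hw0), <- Cmult_assoc, <- cexp_plus. f_equal. f_equal. ring.
Qed.

Lemma cder_cexp_shift (f f' : C -> C) (a z : C) :
  cder f (z + a)%C (f' (z + a)%C) -> cder (fun w => f (w + a)%C) z (f' (z + a)%C).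
Proof.
  intros H. eapply der_ext; [| |apply (der_comp Cid (fun w => w + a)%C f); [apply der_plus; [apply cder_id|apply der_const]|exact H]];
    [reflexivity|ring].
Qed.

Lemma cexp_2PI_i : cexp (Ci * RtoC (2 * PI)) = 1%C.
Proof.
  apply C_eq_intro; unfold cexp, Ci, RtoC, Re, Im; cbn.
  - replace (0 * 0 + 1 * (2 * PI)) with (2 * PI) by ring. replace (0 * (2 * PI) - 1 * 0) with 0 by ring.
    rewrite exp_0, cos_2PI. ring.
  - replace (0 * 0 + 1 * (2 * PI)) with (2 * PI) by ring. rewrite sin_2PI. ring.
Qed.

(* [F] lifts [log f], so it increases by [2 pi i] when the origin is encircled. *)
Lemma lift_translation (F P : C -> C) :
  (forall w, Re w < 0 -> cder F w (P w)) ->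
  (forall w, P (w + Ci * RtoC (2 * PI))%C = P w) ->
  (forall eps, 0 < eps -> exists A, forall w, Re w < A -> Cmod (P w - 1) < eps) ->
  forall w, Re w < 0 -> F (w + Ci * RtoC (2 * PI))%C = (F w + Ci * RtoC (2 * PI))%C.
Proof.
  intros DF HPer HLim. set (p := (Ci * RtoC (2 * PI))%C) in *. pose proof PI_RGT_0 as HPI.
  assert (Rp : Re p = 0) by (unfold p, Ci, Re; cbn; ring).
  assert (HC : forall w, Re w < 0 -> (F (w + p) - F w = F (RtoC (-1) + p) - F (RtoC (-1)))%C).
  { intros w Hw. apply (constant_of_cder_0 (fun z => Re z < 0) (RtoC (-1)) w (fun w => F (w + p) - F w)%C); auto.
    - apply left_half_plane_starlike.
    - intros z Hz. replace (RtoC 0) with (P (z + p) - P z)%C by (rewrite HPer; ring).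
      apply der_minus; [|auto]. apply (cder_cexp_shift F P). apply DF. rewrite Re_plus, Rp. lra. }
  assert (HK : (F (RtoC (-1) + p) - F (RtoC (-1)) = p)%C).
  { apply C_eq_of_close. intros eps He.
    destruct (HLim (eps / (2 * PI))) as [A HA]; [apply Rdiv_lt_0_compat; lra|].
    set (x := Rmin (A - 1) (-1)).
    assert (X1 : x <= A - 1) by apply Rmin_l. assert (X2 : x <= -1) by apply Rmin_r.
    rewrite <- (HC (RtoC x)) by (rewrite Re_RtoC; lra).
    assert (RL : forall t, Re (RtoC x + RtoC t * Ci) = x) by (intros t; unfold Ci, Re; cbn; ring).
    pose proof (curve_lipschitz (fun t => F (RtoC x + RtoC t * Ci) - RtoC t * Ci)%C
      (fun t => P (RtoC x + RtoC t * Ci) * Ci - Ci)%C 0 (2 * PI) (eps / (2 * PI)) ltac:(lra)) as L.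
    cbn beta in L.
    replace (RtoC x + RtoC (2 * PI) * Ci)%C with (RtoC x + p)%C in L by (unfold p; ring).
    replace (RtoC x + 0 * Ci)%C with (RtoC x) in L by ring.
    replace (F (RtoC x + p) - RtoC (2 * PI) * Ci - (F (RtoC x) - 0 * Ci))%C
      with (F (RtoC x + p) - F (RtoC x) - p)%C in L by (unfold p; ring).
    replace (eps / (2 * PI) * (2 * PI - 0)) with eps in L by (field; lra).
    assert (DI : forall t, rder (fun t => RtoC t * Ci)%C t Ci).
    { intros t. eapply der_ext; [| |apply (der_scal RtoC RtoC Ci t), (der_id RtoC)]; [intros; cbn; ring|ring]. }
    apply L.
    - intros t _. apply der_minus; [|apply DI].
      apply (der_comp RtoC (fun t => RtoC x + RtoC t * Ci)%C F).
      + eapply der_ext; [| |apply (der_plus RtoC (fun _ => RtoC x)); [apply der_const|apply DI]]; [reflexivity|ring].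
      + apply DF. rewrite RL. lra.
    - intros t _. replace (P (RtoC x + RtoC t * Ci) * Ci - Ci)%C with ((P (RtoC x + RtoC t * Ci) - 1) * Ci)%C by ring.
      rewrite Cmod_mult, Cmod_Ci, Rmult_1_r. apply Rlt_le, HA. rewrite RL. lra. }
  intros w Hw. specialize (HC w Hw). rewrite HK in HC.
  replace (F (w + p)%C) with (F (w + p)%C - F w + F w)%C by ring. rewrite HC. ring.
Qed.

Lemma lift_translation_nat (F : C -> C) (p : C) :
  Re p = 0 -> (forall w, Re w < 0 -> F (w + p)%C = (F w + p)%C) ->
  forall (n : nat) w, Re w < 0 -> F (w + RtoC (INR n) * p)%C = (F w + RtoC (INR n) * p)%C.
Proof.
  intros Rp H. induction n as [|n IH]; intros w Hw.
  - cbn [INR]. replace (w + 0 * p)%C with w by ring. ring.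
  - rewrite S_INR, RtoC_plus.
    replace (w + (RtoC (INR n) + 1) * p)%C with (w + RtoC (INR n) * p + p)%C by ring.
    rewrite H, IH; auto; [ring|].
    rewrite Re_plus, Re_mult, Re_RtoC, Im_RtoC, Rp. lra.
Qed.

Lemma univalence_lower : univalence_property (167 / 500 * PI).
Proof.
  intros f f' Hd Hf0 Hf'0 Hnz HB z w Hz Hw Efzw. unfold inD in *.
  assert (DF : forall z, Cmod z < 1 -> cder f z (f' z)) by (intros u Hu; apply is_derive_cder, Hd, Hu).
  assert (DF' : forall z, Cmod z < 1 -> exists l, cder f' z l).
  { intros u Hu. apply (cder_cder f f' u (1 - Cmod u)); [lra|]. intros v Hv. apply DF.
    pose proof (Cmod_triangle (v - u) u) as T. replace (v - u + u)%C with v in T by ring. lra. }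
  destruct (Ceq_dec z 0%C) as [Ez|Nz].
  { subst z. destruct (Ceq_dec w 0%C) as [Ew|Nw]; [auto|]. exfalso. apply (Hnz w Hw Nw). congruence. }
  destruct (Ceq_dec w 0%C) as [Ew|Nw].
  { subst w. exfalso. apply (Hnz z Hz Nz). congruence. }
  set (p := fun z => (z * f' z / f z)%C).
  set (P := fun w => p (cexp w)).
  assert (EH : forall w, Re w < 0 -> Cmod (cexp w) < 1).
  { intros u Hu. rewrite Cmod_cexp, <- exp_0. apply exp_increasing, Hu. }
  assert (Nf : forall w, Re w < 0 -> f (cexp w) <> 0%C).
  { intros u Hu. apply Hnz; [apply EH, Hu|apply cexp_neq_0]. }
  assert (DP : forall w, Re w < 0 -> exists l, cder P w l).
  { intros u Hu. destruct (DF' _ (EH u Hu)) as [l Hl].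
    eexists. apply (der_comp Cid cexp p); [apply cder_cexp|].
    apply der_div; [apply der_mult; [apply cder_id|exact Hl]|apply DF, EH, Hu|apply Nf, Hu]. }
  assert (BP : forall w, Re w < 0 -> exp (- (167 / 500 * PI / 2)) < Cmod (P w) < exp (167 / 500 * PI / 2)).
  { intros u Hu. specialize (HB _ (EH u Hu)). unfold zf'_over_f in HB.
    destruct (Ceq_dec (cexp u) 0%C) as [E|_]; [exfalso; apply (cexp_neq_0 _ E)|]. exact HB. }
  destruct (log_derivative_data P (167 / 500) DP BP) as [F [G [G' HD]]].
  assert (DFF : forall w, Re w < 0 -> cder F w (P w)) by (intros u Hu; apply HD, Hu).
  assert (Ef : forall w, Re w < 0 -> f (cexp w) = (f (cexp (RtoC (-1))) * cexp (F w - F (RtoC (-1))))%C).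
  { apply (exp_of_log_derivative (fun z => Re z < 0) (RtoC (-1)) (fun w => f (cexp w)) (fun w => f' (cexp w) * cexp w)%C F).
    - apply left_half_plane_starlike.
    - intros u Hu. apply (der_comp Cid cexp f); [apply cder_cexp|apply DF, EH, Hu].
    - intros u Hu. exists (P u). split; [auto|]. unfold P, p. field. apply Nf, Hu. }
  assert (Pp : forall w, P (w + Ci * RtoC (2 * PI))%C = P w).
  { intros u. unfold P. rewrite cexp_plus, cexp_2PI_i. f_equal. ring. }
  assert (Lim : forall eps, 0 < eps -> exists A, forall w, Re w < A -> Cmod (P w - 1) < eps).
  { intros eps He.
    assert (C0 : Cmod 0 < 1) by (rewrite Cmod_0; lra).
    destruct (DF' 0%C C0) as [l Hl]. apply der_cont in Hl.
    (* Near 0 one has [f v = q v * v] with [q] continuous at 0 and [q 0 = f' 0 = 1], so that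
       [z f' / f = f' / q] tends to 1. *)
    destruct (der_elim _ _ _ _ (DF 0%C C0)) as [q [r [Hr [Cq [Hq0 Hq]]]]].
    assert (CQ : ccont (fun z => f' z / q z)%C 0%C).
    { apply cont_div; auto. rewrite Hq0, Hf'0. intros E; apply (f_equal Re) in E; cbn in E; lra. }
    destruct (CQ eps He) as [d [Hd' K]]. unfold Cid in K.
    assert (Hm : 0 < Rmin d r) by (apply Rmin_pos; auto).
    exists (Rmin 0 (ln (Rmin d r))). intros u Hu.
    assert (U0 : Re u < 0) by (eapply Rlt_le_trans; [exact Hu|apply Rmin_l]).
    assert (U1 : Cmod (cexp u) < Rmin d r).
    { rewrite Cmod_cexp, <- (exp_ln _ Hm). apply exp_increasing. eapply Rlt_le_trans; [exact Hu|apply Rmin_r]. }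
    set (v := cexp u) in *. assert (Nv : v <> 0%C) by apply cexp_neq_0.
    assert (Sv : (v - 0 = v)%C) by ring.
    specialize (K v). rewrite Sv, Hq0, Hf'0 in K.
    specialize (K (Rlt_le_trans _ _ _ U1 (Rmin_l _ _))).
    specialize (Hq v). unfold Cid in Hq. rewrite Sv, Hf0 in Hq.
    specialize (Hq (Rlt_le_trans _ _ _ U1 (Rmin_r _ _))).
    assert (Nq : q v <> 0%C).
    { intros E. rewrite E in Hq. apply (Nf u U0). fold v. replace (f v) with (f v - 0)%C by ring. rewrite Hq; ring. }
    replace (P u - 1)%C with (f' v / q v - 1 / 1)%C; [exact K|].
    unfold P, p. fold v. replace (f v) with (f v - 0)%C by ring. rewrite Hq. field.
    split; auto. }
  pose proof (lift_translation F P DFF Pp Lim) as HT.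
  set (per := (Ci * RtoC (2 * PI))%C) in *.
  assert (Rper : Re per = 0) by (unfold per, Ci, Re; cbn; ring).
  pose proof (lift_translation_nat F per Rper HT) as HTn.
  destruct (cexp_surj z Nz) as [a Ha]. destruct (cexp_surj w Nw) as [b Hb].
  assert (Neg : forall a z, cexp a = z -> Cmod z < 1 -> Re a < 0).
  { intros a' z' E Hz'. rewrite <- E, Cmod_cexp, <- exp_0 in Hz'. apply exp_lt_inv, Hz'. }
  assert (Ra := Neg a z Ha Hz). assert (Rb := Neg b w Hb Hw).
  assert (Eexp : cexp (F a - F b) = 1%C).
  { rewrite <- Ha, <- Hb, (Ef a Ra), (Ef b Rb) in Efzw.
    set (k := f (cexp (RtoC (-1)))) in *.
    assert (Nk : k <> 0%C) by (apply Nf; rewrite Re_RtoC; lra).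
    assert (E2 : cexp (F a - F (RtoC (-1))) = cexp (F b - F (RtoC (-1)))).
    { replace (cexp (F a - F (RtoC (-1)))) with (k * cexp (F a - F (RtoC (-1))) / k)%C by (field; auto).
      rewrite Efzw. field. auto. }
    replace (F a - F b)%C with ((F a - F (RtoC (-1))) + - (F b - F (RtoC (-1))))%C by ring.
    rewrite cexp_plus, E2, cexp_opp. field. apply cexp_neq_0. }
  destruct (cexp_eq_1 _ Eexp) as [k Hk].
  (* Translating [b] by [n] periods makes the two values of [F] equal; injectivity then shows that
     [a] and [b] differ by periods. A negative multiple is treated by exchanging [a] and [b]. *)
  assert (Key : forall a b (n : nat), Re a < 0 -> Re b < 0 -> (F a - F b = RtoC (INR n) * per)%C -> cexp a = cexp b).
  { intros a' b' n Ha' Hb' E.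
    assert (EF : F a' = F (b' + RtoC (INR n) * per)%C).
    { rewrite HTn by auto. rewrite <- E. ring. }
    apply (half_plane_injective F P G G') in EF; auto.
    - rewrite EF, cexp_plus.
      assert (E1 : forall m, cexp (RtoC (INR m) * per) = 1%C).
      { induction m as [|m IH]; [cbn [INR]; replace (0 * per)%C with (RtoC 0) by ring; apply cexp_0|].
        rewrite S_INR, RtoC_plus. replace ((RtoC (INR m) + 1) * per)%C with (RtoC (INR m) * per + per)%C by ring.
        rewrite cexp_plus, IH. unfold per. rewrite cexp_2PI_i. ring. }
      rewrite E1. ring.
    - rewrite Re_plus, Re_mult, Re_RtoC, Im_RtoC, Rper. lra. }
  rewrite <- Ha, <- Hb.
  destruct (Z.le_gt_cases 0 k) as [K0|K0].
  - apply (Key a b (Z.to_nat k)); auto. rewrite Hk, INR_IZR_INZ, Z2Nat.id by lia.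
    unfold per. rewrite RtoC_mult. ring.
  - symmetry. apply (Key b a (Z.to_nat (- k))); auto. rewrite INR_IZR_INZ, Z2Nat.id by lia.
    replace (F b - F a)%C with (- (F a - F b))%C by ring. rewrite Hk, opp_IZR.
    unfold per. rewrite RtoC_mult, RtoC_opp. ring.
Qed.

(** * Numerical estimates *)

Lemma increments_le (f f' g g' : R -> R) (a b : R) :
  a <= b ->
  (forall t, a <= t <= b -> is_derive f t (f' t)) ->
  (forall t, a <= t <= b -> is_derive g t (g' t)) ->
  (forall t, a <= t <= b -> f' t <= g' t) ->
  f b - f a <= g b - g a.
Proof.
  intros Hab Hf Hg Hle.
  assert (D : forall t, a <= t <= b -> is_derive (fun t => g t - f t) t (g' t - f' t)).
  { intros t Ht. apply (is_derive_minus g f); auto. }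
  destruct (MVT_gen (fun t => g t - f t) a b (fun t => g' t - f' t)) as [c [Hc E]].
  - rewrite Rmin_left, Rmax_right by auto. intros; apply D; lra.
  - rewrite Rmin_left, Rmax_right by auto. intros x Hx.
    apply (is_derive_continuity_pt (fun t => g t - f t) x _ (D x Hx)).
  - rewrite Rmin_left, Rmax_right in Hc by auto. specialize (Hle c Hc).
    assert (0 <= (g' c - f' c) * (b - a)) by (apply Rmult_le_pos; lra). lra.
Qed.

Lemma exp_ge_cubic (y : R) : 0 <= y -> 1 + y + y * y / 2 + y * y * y / 6 <= exp y.
Proof.
  assert (Step : forall f f' : R -> R, f 0 = 1 -> (forall t, is_derive f t (f' t)) ->
    (forall t, 0 <= t -> f' t <= exp t) -> forall y, 0 <= y -> f y <= exp y).
  { intros f f' H0 Hf Hle z Hz.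
    pose proof (increments_le f f' exp exp 0 z Hz) as H. rewrite H0, exp_0 in H.
    assert (f z - 1 <= exp z - 1); [|lra].
    apply H; auto; [intros; auto_derive; auto; ring|intros; apply Hle; lra]. }
  assert (S1 : forall t, 0 <= t -> 1 + t <= exp t) by (intros; apply exp_ineq1_le).
  assert (S2 : forall t, 0 <= t -> 1 + t + t * t / 2 <= exp t).
  { apply (Step (fun t => 1 + t + t * t / 2) (fun t => 1 + t)); auto; [field|intros; auto_derive; auto; field]. }
  apply (Step (fun t => 1 + t + t * t / 2 + t * t * t / 6) (fun t => 1 + t + t * t / 2)); auto;
    [field|intros; auto_derive; auto; field].
Qed.

Lemma exp_opp_ge_cubic (y : R) : 0 <= y -> 1 - y + y * y / 2 - y * y * y / 6 <= exp (- y).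
Proof.
  assert (S2 : forall t, 0 <= t -> exp (- t) <= 1 - t + t * t / 2).
  { intros t Ht.
    pose proof (increments_le (fun t => t - t * t / 2) (fun t => 1 - t) (fun t => - exp (- t)) (fun t => exp (- t)) 0 t Ht) as H.
    cbn beta in H. rewrite Ropp_0, exp_0 in H.
    assert (t - t * t / 2 - (0 - 0 * 0 / 2) <= - exp (- t) - - 1); [|lra].
    apply H; intros; [auto_derive; auto; field|auto_derive; auto; ring|].
    pose proof (exp_ineq1_le (- t0)). lra. }
  intros Hy.
  pose proof (increments_le (fun t => - exp (- t)) (fun t => exp (- t))
    (fun t => t - t * t / 2 + t * t * t / 6) (fun t => 1 - t + t * t / 2) 0 y Hy) as H.
  cbn beta in H. rewrite Ropp_0, exp_0 in H.
  assert (- exp (- y) - - 1 <= y - y * y / 2 + y * y * y / 6 - (0 - 0 * 0 / 2 + 0 * 0 * 0 / 6)); [|lra].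
  apply H; intros; [auto_derive; auto; ring|auto_derive; auto; field|apply S2; lra].
Qed.

Lemma PI_bounds : 31415 / 10000 < PI < 31416 / 10000.
Proof.
  destruct (PI_2_3_7_ineq 2) as [H1 H2].
  unfold tg_alt, PI_2_3_7_tg, Ratan_seq in H1, H2. cbn in H1, H2. split; lra.
Qed.

Lemma exp_mult_INR (n : nat) (x : R) : exp (INR n * x) = exp x ^ n.
Proof.
  induction n as [|n IH]; [cbn; rewrite Rmult_0_l; apply exp_0|].
  rewrite S_INR, Rmult_plus_distr_r, Rmult_1_l, exp_plus, IH. cbn; ring.
Qed.

(** The true value is about 3.0696. An eighth of the exponent is small enough for the cubic Taylor
    polynomial to be accurate. *)
Lemma exp_quarter_period_bound : 3068 / 1000 < exp (357 / 500 * PI / 2) .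
Proof.
  pose proof PI_bounds.
  apply Rlt_trans with (exp (INR 8 * (14018 / 100000))).
  - rewrite exp_mult_INR.
    pose proof (exp_ge_cubic (14018 / 100000) ltac:(lra)) as E.
    apply Rlt_le_trans with ((115046 / 100000) ^ 8); [lra|apply pow_incr; lra].
  - apply exp_increasing. cbn. lra.
Qed.

(** The value, about 0.1108, is [exp (- L)] at the end [L = PI / (2 c)] of the integration interval;
    again the exponent is divided before Taylor polynomials are used. *)
Lemma exp_half_period_bounds :
  1106 / 10000 < exp (- (PI / (2 * (357 / 500)))) < 112 / 1000.
Proof.
  pose proof PI_bounds. replace (PI / (2 * (357 / 500))) with (PI * (250 / 357)) by field. split.
  - apply Rlt_trans with (exp (INR 16 * - (13751 / 100000))).
    + rewrite exp_mult_INR.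
      pose proof (exp_opp_ge_cubic (13751 / 100000) ltac:(lra)) as E.
      apply Rlt_le_trans with ((87150 / 100000) ^ 16); [lra|apply pow_incr; lra].
    + apply exp_increasing. cbn. lra.
  - rewrite exp_Ropp. apply (Rmult_lt_reg_r (exp (PI * (250 / 357)))); [apply exp_pos|].
    rewrite Rinv_l by (apply Rgt_not_eq, exp_pos).
    apply Rlt_trans with (112 / 1000 * exp (INR 8 * (2749 / 10000))).
    + rewrite exp_mult_INR.
      pose proof (exp_ge_cubic (2749 / 10000) ltac:(lra)) as E.
      assert ((1316 / 1000) ^ 8 <= exp (2749 / 10000) ^ 8) by (apply pow_incr; lra). lra.
    + apply Rmult_lt_compat_l; [lra|]. apply exp_increasing. cbn. lra.
Qed.

(* The bound is [2 x Q(x^2)] where [1 - (1 + X) Q(X) = (6 X^2 - 6 X + 1)^2 / 169],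
   a square which is small on [0, 1] and equals 1 at [X = -1]. *)
Lemma sech_lower (x : R) : 0 < x ->
  2 * (168 * x - 156 * x ^ 3 + 108 * x ^ 5 - 36 * x ^ 7) / 169 <= 2 / (/ x + x).
Proof.
  intros Hx.
  assert (P : 0 < 1 + x * x) by nra.
  replace (2 / (/ x + x)) with (2 * x / (1 + x * x)) by (field; split; lra).
  apply (Rmult_le_reg_r (1 + x * x)); [auto|].
  replace (2 * x / (1 + x * x) * (1 + x * x)) with (2 * x) by (field; lra).
  assert (E : 2 * x - 2 * (168 * x - 156 * x ^ 3 + 108 * x ^ 5 - 36 * x ^ 7) / 169 * (1 + x * x)
    = 2 * x / 169 * (6 * x ^ 4 - 6 * x ^ 2 + 1) ^ 2) by field.
  assert (0 <= 2 * x / 169 * (6 * x ^ 4 - 6 * x ^ 2 + 1) ^ 2).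
  { apply Rmult_le_pos; [lra|apply pow2_ge_0]. }
  lra.
Qed.

(** The real part of [exp ((- a + i c) t) / (- a + i c)]. *)
Definition damped (c a t : R) : R :=
  exp (- (a * t)) * (c * sin (c * t) - a * cos (c * t)) / (a * a + c * c).

Lemma is_derive_damped (c a t : R) : 0 < a ->
  is_derive (damped c a) t (exp (- (a * t)) * cos (c * t)).
Proof.
  intros Ha. unfold damped. auto_derive; [auto|]. field. nra.
Qed.

(* [PI] is exceeded by about half a percent only. *)
Lemma angle_increment (A A' : R -> R) (L : R) :
  L = PI / (2 * (357 / 500)) ->
  (forall t, 0 <= t <= L -> is_derive A t (A' t)) ->
  (forall t, 0 <= t <= L ->
     A' t = exp (357 / 500 * PI / 2) * (cos (357 / 500 * t) * (2 / (exp t + exp (- t))))) ->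
  PI < A L - A 0 < 2 * PI.
Proof.
  intros HL DA EA. pose proof PI_bounds as HPI.
  set (c := 357 / 500) in *.
  assert (HcL : c * L = PI / 2) by (rewrite HL; unfold c; field).
  assert (HL0 : 0 < L < 22 / 10 + 1 / 100) by (unfold c in HcL; lra).
  pose proof exp_quarter_period_bound as HE. fold c in HE.
  set (E := exp (c * PI / 2)) in *.
  pose proof exp_half_period_bounds as HX. fold c in HX. rewrite <- HL in HX.
  set (x := exp (- L)) in *.
  assert (Cos : forall t, 0 <= t <= L -> 0 <= cos (c * t)).
  { intros t Ht. apply cos_ge_0; unfold c in *; lra. }
  assert (Inv : forall t, exp t = / exp (- t)) by (intros t; rewrite exp_Ropp, Rinv_inv; auto).
  assert (Pw : forall n t, exp (- (INR n * t)) = exp (- t) ^ n).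
  { intros n t. rewrite <- exp_mult_INR. f_equal. ring. }
  split.
  (* A primitive of [E * cos (c t)] times the polynomial minorant of [1 / cosh t] in [exp (- t)];
     its increment over [[0, L]] is explicit because [c * L = PI / 2]. *)
  - set (Lam := fun t => E * (2 * (168 * damped c 1 t - 156 * damped c 3 t + 108 * damped c 5 t - 36 * damped c 7 t) / 169)).
    assert (Low : Lam L - Lam 0 <= A L - A 0).
    { apply (increments_le Lam (fun t => E * (2 * (168 * (exp (- (1 * t)) * cos (c * t)) - 156 * (exp (- (3 * t)) * cos (c * t))
          + 108 * (exp (- (5 * t)) * cos (c * t)) - 36 * (exp (- (7 * t)) * cos (c * t))) / 169)) A A' 0 L); auto; [lra| |].
      - intros t Ht. unfold Lam.
        pose proof (is_derive_damped c 1 t ltac:(lra)) as D1. pose proof (is_derive_damped c 3 t ltac:(lra)) as D3.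
        pose proof (is_derive_damped c 5 t ltac:(lra)) as D5. pose proof (is_derive_damped c 7 t ltac:(lra)) as D7.
        evar_last.
        + apply is_derive_scal, (is_derive_ext (fun t => 2 / 169 * (168 * damped c 1 t - 156 * damped c 3 t + 108 * damped c 5 t - 36 * damped c 7 t))).
          * intros s. simpl. field.
          * apply is_derive_scal, (is_derive_minus (V := R_NormedModule)); [|apply is_derive_scal, D7].
            apply (is_derive_plus (V := R_NormedModule)); [|apply is_derive_scal, D5].
            apply (is_derive_minus (V := R_NormedModule)); apply is_derive_scal; [exact D1|exact D3].
        + unfold minus, plus, opp; simpl. field.
      - intros t Ht. rewrite EA by auto. apply Rmult_le_compat_l; [lra|].
        pose proof (Pw 1%nat t) as P1. pose proof (Pw 3%nat t) as P3. pose proof (Pw 5%nat t) as P5. pose proof (Pw 7%nat t) as P7.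
        replace (INR 1) with 1 in P1 by (cbn; ring). replace (INR 3) with 3 in P3 by (cbn; ring).
        replace (INR 5) with 5 in P5 by (cbn; ring). replace (INR 7) with 7 in P7 by (cbn; ring).
        rewrite P1, P3, P5, P7. rewrite (Inv t).
        pose proof (sech_lower (exp (- t)) (exp_pos _)) as S.
        specialize (Cos t Ht). set (X := exp (- t)) in *.
        replace (2 * (168 * (X ^ 1 * cos (c * t)) - 156 * (X ^ 3 * cos (c * t)) + 108 * (X ^ 5 * cos (c * t)) - 36 * (X ^ 7 * cos (c * t))) / 169)
          with (cos (c * t) * (2 * (168 * X - 156 * X ^ 3 + 108 * X ^ 5 - 36 * X ^ 7) / 169)) by field.
        apply Rmult_le_compat_l; auto. }
    assert (DL : forall n, damped c (INR n) L = x ^ n * c / (INR n * INR n + c * c)).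
    { intros n. unfold damped. rewrite HcL, sin_PI2, cos_PI2, Pw. fold x. f_equal. ring. }
    assert (D0 : forall n, damped c (INR n) 0 = - INR n / (INR n * INR n + c * c)).
    { intros n. unfold damped. rewrite !Rmult_0_r, sin_0, cos_0, Ropp_0, exp_0. f_equal. ring. }
    assert (LE : Lam L - Lam 0 = E * (2 * (168 * ((1 + c * x) / (1 + c * c)) - 156 * ((3 + c * x ^ 3) / (9 + c * c))
        + 108 * ((5 + c * x ^ 5) / (25 + c * c)) - 36 * ((7 + c * x ^ 7) / (49 + c * c))) / 169)).
    { unfold Lam.
      pose proof (DL 1%nat) as L1. pose proof (DL 3%nat) as L3. pose proof (DL 5%nat) as L5. pose proof (DL 7%nat) as L7.
      pose proof (D0 1%nat) as M1. pose proof (D0 3%nat) as M3. pose proof (D0 5%nat) as M5. pose proof (D0 7%nat) as M7.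
      replace (INR 1) with 1 in * by (cbn; ring). replace (INR 3) with 3 in * by (cbn; ring).
      replace (INR 5) with 5 in * by (cbn; ring). replace (INR 7) with 7 in * by (cbn; ring).
      rewrite L1, L3, L5, L7, M1, M3, M5, M7. unfold c. field. }
    assert (X3 : x ^ 3 <= (112 / 1000) ^ 3) by (apply pow_incr; lra).
    assert (X5 : 0 <= x ^ 5) by (apply pow_le; lra).
    assert (X7 : x ^ 7 <= (112 / 1000) ^ 7) by (apply pow_incr; lra).
    set (V := 2 * (168 * ((1 + c * x) / (1 + c * c)) - 156 * ((3 + c * x ^ 3) / (9 + c * c))
        + 108 * ((5 + c * x ^ 5) / (25 + c * c)) - 36 * ((7 + c * x ^ 7) / (49 + c * c))) / 169) in *.
    assert (HV : 1028 / 1000 < V) by (unfold V, c; lra).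
    assert (HEV : 3068 / 1000 * (1028 / 1000) < E * V) by (apply Rmult_gt_0_lt_compat; lra).
    lra.
  (* A crude bound suffices here: [cos <= 1] and [1 / cosh t <= 2 * exp (- t)] limit the turn to
     [2 * E * (1 - x)], which is less than 5.8. *)
  - assert (Up : A L - A 0 <= - (2 * E * exp (- L)) - - (2 * E * exp (- 0))).
    { apply (increments_le A A' (fun t => - (2 * E * exp (- t))) (fun t => 2 * E * exp (- t))); auto; [lra| |].
      - intros t Ht. auto_derive; [auto|ring].
      - intros t Ht. rewrite EA by auto.
        replace (2 * E * exp (- t)) with (E * (1 * (2 * exp (- t)))) by ring.
        apply Rmult_le_compat_l; [lra|].
        pose proof (exp_pos t). pose proof (exp_pos (- t)).
        apply Rmult_le_compat; auto; [apply Rdiv_le_0_compat; lra|apply COS_bound|].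
        rewrite (Inv t) in *. set (X := exp (- t)) in *.
        apply (Rmult_le_reg_r (/ X + X)); [lra|].
        replace (2 / (/ X + X) * (/ X + X)) with 2 by (field; split; nra).
        replace (2 * X * (/ X + X)) with (2 + 2 * X * X) by (field; lra). nra. }
    rewrite Ropp_0, exp_0 in Up. fold x in Up.
    assert (HE2 : E < 32 / 10).
    (* [3125 / 10000] is the inverse of [32 / 10]. *)
    { assert (Q : 3125 / 10000 < exp (- (c * PI / 2))).
      { apply Rlt_trans with (exp (INR 16 * - (7011 / 100000))).
        - rewrite exp_mult_INR. pose proof (exp_ineq1_le (- (7011 / 100000))).
          apply Rlt_le_trans with ((92989 / 100000) ^ 16); [lra|apply pow_incr; lra].
        - apply exp_increasing. unfold c. cbn. lra. }
      rewrite exp_Ropp in Q. fold E in Q.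
      apply (Rmult_lt_compat_r E) in Q; [|lra]. rewrite Rinv_l in Q by lra. lra. }
    assert (2 * E * x > 2 * 3 * (1106 / 10000)) by nra. lra.
Qed.

(** * The upper bound *)

(** The disc corresponds to [|Im u| < PI / 2]. The doubled strip has the line [Im u = - PI / 2],
    which corresponds to half of the unit circle, in its interior; within it [sinh] vanishes only at
    0 and [exp u] is never -1. *)
Definition strip (u : C) : Prop := Rabs (Im u) < PI.
Definition csinh (u : C) : C := ((cexp u - cexp (- u)) / 2)%C.
Definition spiral (c : R) (u : C) : C := cexp (Ci * RtoC c * u).
Definition half_tanh (u : C) : C := ((cexp u - 1) / (cexp u + 1))%C.

(* In the coordinate [u = log ((1 + z) / (1 - z))] one has [z = half_tanh u] and
   [dz / z = du / sinh u]; with [z f' / f = spiral c u] the function [log (f / z)]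
   has derivative [kernel c] with respect to [u]. *)
Definition kernel (c : R) (u : C) : C :=
  if Ceq_dec u 0%C then (Ci * RtoC c)%C else ((spiral c u - 1) / csinh u)%C.

Lemma strip_starlike : starlike_region strip 0%C.
Proof.
  pose proof PI_RGT_0. unfold strip. split; [rewrite Im_RtoC, Rabs_R0; auto|split].
  - intros z Hz. exists (PI - Rabs (Im z)); split; [lra|]. intros w Hw.
    pose proof (Im_le_Cmod (w - z)) as T. rewrite Im_minus in T.
    pose proof (Rabs_triang (Im w - Im z) (Im z)) as T2.
    replace (Im w - Im z + Im z) with (Im w) in T2 by ring. lra.
  - intros z s Hz Hs. rewrite Im_plus, Im_mult, Im_RtoC, Re_RtoC, Im_RtoC, Im_minus, Im_RtoC.
    replace (0 + (s * (Im z - 0) + 0 * Re (z - 0))) with (s * Im z) by ring.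
    rewrite Rabs_mult, (Rabs_pos_eq s) by lra. pose proof (Rabs_pos (Im z)). nra.
Qed.

Lemma strip_cexp_neq_m1 (u : C) : strip u -> (cexp u + 1 <> 0)%C.
Proof.
  intros Hu E. unfold strip in Hu. apply Rabs_def2 in Hu.
  assert (E1 : cexp (u + Ci * RtoC PI) = 1%C).
  { rewrite cexp_plus. replace (cexp (Ci * RtoC PI)) with (RtoC (-1)).
    - replace (cexp u) with (cexp u + 1 - 1)%C by ring. rewrite E. ring.
    - apply C_eq_intro; unfold cexp, Ci, RtoC, Re, Im; cbn.
      + replace (0 * 0 + 1 * PI) with PI by ring. replace (0 * PI - 1 * 0) with 0 by ring. rewrite exp_0, cos_PI. ring.
      + replace (0 * 0 + 1 * PI) with PI by ring. rewrite sin_PI. ring. }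
  destruct (cexp_eq_1 _ E1) as [k Hk]. apply (f_equal Im) in Hk.
  rewrite Im_plus, !Im_mult, !Re_RtoC, !Im_RtoC in Hk.
  replace (Re Ci) with 0 in Hk by reflexivity. replace (Im Ci) with 1 in Hk by reflexivity.
  assert (Hk2 : Im u = (2 * IZR k - 1) * PI) by lra.
  pose proof PI_RGT_0.
  destruct (Z.le_gt_cases k 0) as [H0|H0].
  - apply IZR_le in H0. nra.
  - assert (H1 : (1 <= k)%Z) by lia. apply IZR_le in H1. nra.
Qed.

Lemma small_multiple_of_PI (k : Z) : Rabs (IZR k * PI) < PI -> k = 0%Z.
Proof.
  intros H. apply Rabs_def2 in H. pose proof PI_RGT_0 as HPI.
  destruct (Z.lt_trichotomy k 0) as [H0|[H0|H0]]; auto; exfalso.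
  - assert (H1 : (k <= -1)%Z) by lia. apply IZR_le in H1. nra.
  - assert (H1 : (1 <= k)%Z) by lia. apply IZR_le in H1. nra.
Qed.

Lemma strip_csinh_neq_0 (u : C) : strip u -> u <> 0%C -> csinh u <> 0%C.
Proof.
  intros Hu Nu E. unfold strip in Hu. apply Rabs_def2 in Hu.
  assert (E1 : cexp (2 * u) = 1%C).
  { replace (2 * u)%C with (u + u)%C by ring. rewrite cexp_plus.
    assert (E2 : cexp u = cexp (- u)).
    { replace (cexp u) with (2 * csinh u + cexp (- u))%C by (unfold csinh; field). rewrite E; ring. }
    rewrite E2 at 1. rewrite <- cexp_plus. replace (- u + u)%C with (RtoC 0) by ring. apply cexp_0. }
  destruct (cexp_eq_1 _ E1) as [k Hk]. pose proof PI_RGT_0.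
  assert (Hi := f_equal Im Hk). assert (Hr := f_equal Re Hk).
  rewrite !Im_mult, !Re_RtoC, !Im_RtoC in Hi. rewrite !Re_mult, !Re_RtoC, !Im_RtoC in Hr.
  replace (Re Ci) with 0 in * by reflexivity. replace (Im Ci) with 1 in * by reflexivity.
  assert (Hk2 : Im u = IZR k * PI) by lra.
  assert (K0 : k = 0%Z) by (apply small_multiple_of_PI, Rabs_def1; lra).
  subst k. apply Nu, C_eq_intro; rewrite ?Re_RtoC, ?Im_RtoC; lra.
Qed.

Lemma cder_opp (z : C) : cder (fun w => - w)%C z (RtoC (-1)).
Proof. eapply der_ext; [| |apply (der_scal Cid (fun w => w) (-1)), cder_id]; [intros; cbn; ring|ring]. Qed.

Lemma cder_csinh (u : C) : cder csinh u ((cexp u + cexp (- u)) / 2)%C.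
Proof.
  eapply der_ext; [| |apply (der_scal Cid (fun u => cexp u - cexp (- u))%C (/ 2)), der_minus;
    [apply cder_cexp|apply (der_comp Cid (fun w => - w)%C cexp); [apply cder_opp|apply cder_cexp]]].
  - intros y. unfold csinh. field.
  - field.
Qed.

Lemma cder_spiral (c : R) (u : C) : cder (spiral c) u (Ci * RtoC c * spiral c u)%C.
Proof.
  eapply der_ext; [| |apply (der_comp Cid (fun w => Ci * RtoC c * w)%C cexp); [apply der_scal, cder_id|apply cder_cexp]].
  - reflexivity.
  - unfold spiral. ring.
Qed.

Lemma cder_half_tanh (u : C) : strip u -> u <> 0%C -> cder half_tanh u (half_tanh u / csinh u)%C.
Proof.
  intros Hu Nu. pose proof (strip_cexp_neq_m1 u Hu) as N1. pose proof (strip_csinh_neq_0 u Hu Nu) as N2.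
  eapply der_ext; [| |apply der_div; [apply der_minus; [apply cder_cexp|apply der_const]|
    apply der_plus; [apply cder_cexp|apply der_const]|exact N1]].
  - reflexivity.
  - unfold half_tanh, csinh in *. rewrite cexp_opp in *. pose proof (cexp_neq_0 u) as N0.
    set (x := cexp u) in *.
    assert (N3 : (x - 1 <> 0)%C).
    { intros E. apply N2. replace ((x - / x) / 2)%C with ((x - 1) * (x + 1) / (2 * x))%C by (field; auto). rewrite E. field; auto. }
    field. repeat split; auto.
    replace (x * x - 1)%C with ((x - 1) * (x + 1))%C by ring. apply Cmult_neq_0; auto.
Qed.

(** At 0 the kernel is the quotient of [(spiral c u - 1) / u] by [csinh u / u], two difference
    quotients that extend analytically. *)
Lemma kernel_cder (c : R) (u : C) : strip u -> exists l, cder (kernel c) u l.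
Proof.
  intros Hu. destruct (Ceq_dec u 0%C) as [->|Nu].
  - set (q1 := fun u => if Ceq_dec u 0%C then (Ci * RtoC c)%C else ((spiral c u - 1) / u)%C).
    set (q2 := fun u => if Ceq_dec u 0%C then RtoC 1 else (csinh u / u)%C).
    assert (S0 : spiral c 0%C = 1%C) by (unfold spiral; rewrite Cmult_0_r; apply cexp_0).
    assert (H0 : csinh 0%C = 0%C).
    { unfold csinh. replace (- 0)%C with (RtoC 0) by ring. rewrite cexp_0. field. }
    destruct (removable_quotient (spiral c) q1 0%C 1) as [l1 D1].
    { lra. } { intros w _. eexists; apply cder_spiral. }
    { intros w _. unfold q1. rewrite S0. destruct (Ceq_dec w 0%C) as [->|N]; [rewrite S0; ring|field; auto]. }
    { unfold q1. destruct (Ceq_dec 0%C 0%C) as [_|N]; [|congruence].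
      eapply der_ext; [| |apply cder_spiral]; [reflexivity|rewrite S0; ring]. }
    destruct (removable_quotient csinh q2 0%C 1) as [l2 D2].
    { lra. } { intros w _. eexists; apply cder_csinh. }
    { intros w _. unfold q2. rewrite H0. destruct (Ceq_dec w 0%C) as [->|N]; [rewrite H0; ring|field; auto]. }
    { unfold q2. destruct (Ceq_dec 0%C 0%C) as [_|N]; [|congruence].
      eapply der_ext; [| |apply cder_csinh]; [reflexivity|]. replace (- 0)%C with (RtoC 0) by ring. rewrite cexp_0. field. }
    assert (Q20 : q2 0%C = 1%C) by (unfold q2; destruct (Ceq_dec 0%C 0%C); congruence).
    pose proof PI_RGT_0 as HPI.
    eexists. apply (der_local Cid (fun u => q1 u / q2 u)%C (kernel c) 0%C _ PI HPI).
    + unfold Cid. intros y Hy. unfold q1, q2, kernel. destruct (Ceq_dec y 0%C) as [E|N]; [field|].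
      assert (csinh y <> 0%C).
      { apply strip_csinh_neq_0; auto. unfold strip. eapply Rle_lt_trans; [apply Im_le_Cmod|].
        replace (y - 0)%C with y in Hy by ring. exact Hy. }
      field. auto.
    + apply der_div; [exact D1|exact D2|]. rewrite Q20. intros E; apply (f_equal Re) in E; cbn in E; lra.
  - eexists. apply (der_local Cid (fun u => (spiral c u - 1) / csinh u)%C (kernel c) u _ (Cmod u)).
    + apply Cmod_gt_0; auto.
    + unfold Cid; intros y Hy. unfold kernel. destruct (Ceq_dec y 0%C) as [->|Ny]; [|auto].
      replace (0 - u)%C with (- u)%C in Hy by ring. rewrite Cmod_opp in Hy. lra.
    + apply der_div; [apply der_minus; [apply cder_spiral|apply der_const]|apply cder_csinh|apply strip_csinh_neq_0; auto].
Qed.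

(* The extremal function commutes with this reflection, hence takes the same value at
   [u] and [reflect u] as soon as that value is imaginary. *)
Definition reflect (u : C) : C := (- Cconj u)%C.

Lemma reflect_involutive (u : C) : reflect (reflect u) = u.
Proof. unfold reflect. rewrite Copp_conj, Cconj_conj. ring. Qed.

Lemma Cconj_RtoC (x : R) : Cconj x = x.
Proof. apply C_eq_intro; unfold Cconj, Re, Im; cbn; ring. Qed.

Lemma Re_reflect (u : C) : Re (reflect u) = - Re u. Proof. reflexivity. Qed.
Lemma Im_reflect (u : C) : Im (reflect u) = Im u.
Proof. unfold reflect, Cconj, Im; cbn. ring. Qed.

Lemma cder_conj_reflect (f : C -> C) (u l : C) :
  cder f (reflect u) l -> cder (fun w => Cconj (f (reflect w))) u (- Cconj l)%C.
Proof.
  intros H eps He. destruct (H eps He) as [d [Hd K]]. exists d; split; [auto|].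
  unfold Cid in *. intros y Hy.
  assert (E : (reflect y - reflect u = - Cconj (y - u))%C) by (unfold reflect; rewrite Cminus_conj; ring).
  specialize (K (reflect y)). rewrite E, Cmod_opp, Cmod_conj in K. specialize (K Hy).
  rewrite <- Cmod_conj in K.
  replace (Cconj (f (reflect y) - f (reflect u) - l * - Cconj (y - u)))
    with (Cconj (f (reflect y)) - Cconj (f (reflect u)) - - Cconj l * (y - u))%C in K; [exact K|].
  rewrite !Cminus_conj, Cmult_conj, Copp_conj, !Cminus_conj, !Cconj_conj. ring.
Qed.

Lemma kernel_reflect (c : R) (u : C) : strip u -> (- Cconj (kernel c (reflect u)) = kernel c u)%C.
Proof.
  intros Hu. unfold kernel.
  destruct (Ceq_dec u 0%C) as [->|Nu]; destruct (Ceq_dec (reflect _) 0%C) as [E|N].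
  - apply C_eq_intro; unfold Ci, Cconj, Re, Im; cbn; ring.
  - exfalso. apply N. apply C_eq_intro; unfold reflect, Cconj, Re, Im; cbn; ring.
  - exfalso. apply Nu. rewrite <- (reflect_involutive u), E. apply C_eq_intro; unfold reflect, Cconj, Re, Im; cbn; ring.
  - pose proof (strip_csinh_neq_0 u Hu Nu) as NS.
    assert (E1 : spiral c (reflect u) = Cconj (spiral c u)).
    { unfold spiral. rewrite <- cexp_conj. f_equal. apply C_eq_intro; unfold reflect, Ci, Cconj, Re, Im; cbn; ring. }
    assert (E2 : csinh (reflect u) = (- Cconj (csinh u))%C).
    { unfold csinh, reflect. replace (- - Cconj u)%C with (Cconj u) by ring.
      rewrite <- Copp_conj, !cexp_conj.
      apply C_eq_intro; unfold Cconj, Re, Im; cbn; field. }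
    rewrite E1, E2, Cdiv_conj.
    + rewrite Cminus_conj, Copp_conj, !Cconj_conj. rewrite Cconj_RtoC.
      field. auto.
    + intros E. apply NS. rewrite <- (Cconj_conj (csinh u)).
      replace (Cconj (csinh u)) with (- - Cconj (csinh u))%C by ring. rewrite E.
      apply C_eq_intro; unfold Cconj, Re, Im; cbn; ring.
Qed.

Lemma half_tanh_reflect (u : C) : strip u -> half_tanh (reflect u) = reflect (half_tanh u).
Proof.
  intros Hu. pose proof (strip_cexp_neq_m1 u Hu) as N1. pose proof (cexp_neq_0 u) as N0.
  pose proof (Cconj_RtoC 1) as C1.
  assert (E : cexp (reflect u) = (/ Cconj (cexp u))%C) by (unfold reflect; rewrite cexp_opp, cexp_conj; auto).
  unfold half_tanh. rewrite E. unfold reflect. rewrite Cdiv_conj, Cminus_conj, Cplus_conj, C1 by auto.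
  assert (M0 : Cconj (cexp u) <> 0%C) by (rewrite <- cexp_conj; apply cexp_neq_0).
  assert (M1 : (Cconj (cexp u) + 1 <> 0)%C).
  { rewrite <- C1, <- Cplus_conj. intros E'. apply N1. rewrite <- (Cconj_conj (cexp u + 1)), E'.
    apply C_eq_intro; unfold Cconj, Re, Im; cbn; ring. }
  field. repeat split; auto.
Qed.

(** By the symmetry of the kernel, [Cconj (K (reflect u))] is another primitive that vanishes at 0,
    hence equals [K u]. *)
Lemma kernel_primitive (c : R) : exists K : C -> C,
  K 0%C = 0%C /\ (forall u, strip u -> cder K u (kernel c u)) /\
  (forall u, strip u -> K (reflect u) = Cconj (K u)).
Proof.
  pose proof strip_starlike as HS.
  destruct (primitive_exists strip 0%C (kernel c) HS) as [K [K0 DK]]; [intros; apply kernel_cder; auto|].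
  assert (SR : forall u, strip u -> strip (reflect u)) by (intros u Hu; unfold strip; rewrite Im_reflect; exact Hu).
  exists K. split; [auto|split; [auto|]].
  intros u Hu.
  assert (E : (K u - Cconj (K (reflect u)) = K 0 - Cconj (K (reflect 0)))%C).
  { apply (constant_of_cder_0 strip 0%C u (fun u => K u - Cconj (K (reflect u)))%C HS); auto.
    intros z Hz. replace (RtoC 0) with (kernel c z - - Cconj (kernel c (reflect z)))%C by (rewrite kernel_reflect by auto; ring).
    apply der_minus; [auto|]. apply cder_conj_reflect. apply DK, SR, Hz. }
  replace (reflect 0) with (RtoC 0) in E by (apply C_eq_intro; unfold reflect, Cconj, Re, Im; cbn; ring).
  rewrite K0 in E. rewrite Cconj_RtoC in E.
  rewrite <- (Cconj_conj (K (reflect u))). f_equal.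
  replace (Cconj (K (reflect u))) with (K u - (K u - Cconj (K (reflect u))))%C by ring. rewrite E. ring.
Qed.

Definition lifted (K : C -> C) (u : C) : C := (half_tanh u * cexp (K u))%C.

(** The logarithmic derivatives add up: [1 / sinh] from [half_tanh] and [(spiral - 1) / sinh] from
    [cexp (K u)]. *)
Lemma cder_lifted (c : R) (K : C -> C) (u : C) :
  (forall u, strip u -> cder K u (kernel c u)) -> strip u -> u <> 0%C ->
  cder (lifted K) u (spiral c u / csinh u * lifted K u)%C.
Proof.
  intros DK Hu Nu.
  eapply der_ext; [| |apply der_mult; [apply (cder_half_tanh u Hu Nu)|apply (der_comp Cid K cexp); [apply DK, Hu|apply cder_cexp]]].
  - reflexivity.
  - unfold lifted, kernel. destruct (Ceq_dec u 0%C) as [E|_]; [congruence|].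
    pose proof (strip_csinh_neq_0 u Hu Nu). field. auto.
Qed.

(* Along the line [Im u = - PI / 2] the argument of the function turns by more than
   [PI] between the imaginary axis and [u = PI / (2 c) - i PI / 2]. *)
Lemma lifted_negative (K : C -> C) :
  (forall u, strip u -> cder K u (kernel (357 / 500) u)) ->
  (forall u, strip u -> K (reflect u) = Cconj (K u)) ->
  Re (lifted K (PI / (2 * (357 / 500)), - (PI / 2))) < 0.
Proof.
  intros DK HK. pose proof PI_RGT_0 as HPI.
  set (c := 357 / 500) in *. set (L := PI / (2 * c)).
  set (u0 := (0, - (PI / 2)) : C).
  (* The lower half of the strip contains the line and avoids the pole 0 of the logarithmic
     derivative [m], which therefore has a primitive there. *)
  set (V := fun u : C => - PI < Im u < 0).
  assert (VS : starlike_region V u0).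
  { unfold V. split; [unfold u0, Im; cbn; lra|split].
    - intros z Hz. exists (Rmin (- Im z) (Im z + PI)); split; [apply Rmin_pos; lra|]. intros w Hw.
      pose proof (Im_le_Cmod (w - z)) as T. rewrite Im_minus in T.
      pose proof (Rmin_l (- Im z) (Im z + PI)). pose proof (Rmin_r (- Im z) (Im z + PI)).
      assert (T2 : Rabs (Im w - Im z) < Rmin (- Im z) (Im z + PI)) by lra. apply Rabs_def2 in T2. lra.
    - intros z s Hz Hs. rewrite Im_plus, Im_mult, Im_RtoC, Re_RtoC, Im_minus.
      replace (Im u0) with (- (PI / 2)) by reflexivity. nra. }
  assert (Vstrip : forall u, V u -> strip u /\ u <> 0%C).
  { intros u [H1 H2]. split; [apply Rabs_def1; lra|]. intros E. rewrite E, Im_RtoC in H2. lra. }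
  set (m := fun u => (spiral c u / csinh u)%C).
  assert (Dm : forall u, V u -> exists l, cder m u l).
  { intros u Hu. destruct (Vstrip u Hu) as [Hs Nu]. eexists.
    apply der_div; [apply cder_spiral|apply cder_csinh|apply strip_csinh_neq_0; auto]. }
  destruct (primitive_exists V u0 m VS Dm) as [W [W0 DW]].
  assert (EL : forall u, V u -> lifted K u = (lifted K u0 * cexp (W u - W u0))%C).
  { apply (exp_of_log_derivative V u0 (lifted K) (fun u => m u * lifted K u)%C W VS).
    - intros u Hu. destruct (Vstrip u Hu) as [Hs Nu]. apply (cder_lifted c); auto.
    - intros u Hu. exists (m u). split; [apply DW, Hu|auto]. }
  set (line := fun t : R => (t, - (PI / 2)) : C).
  assert (VL : forall t, V (line t)) by (intros t; unfold V, line, Im; cbn; lra).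
  assert (Dline : forall t, rder line t 1%C).
  { intros t. apply (rder_pair (fun t => t) (fun _ => - (PI / 2)) t 1 0); auto_derive; auto. }
  set (A := fun t => Im (W (line t))).
  assert (DA : forall t, is_derive A t (Im (m (line t)))).
  { intros t. replace (m (line t)) with (m (line t) * 1)%C by ring.
    apply (rder_Im (fun t => W (line t))). apply (der_comp RtoC line W); [apply Dline|apply DW, VL]. }
  (* On the line [sinh (t - i PI / 2) = - i cosh t], and the spiral is [exp (c PI / 2)] times
     [cis (c t)]. *)
  assert (EA : forall t, Im (m (line t)) = exp (c * PI / 2) * (cos (c * t) * (2 / (exp t + exp (- t))))).
  { intros t.
    assert (E1 : spiral c (line t) = (RtoC (exp (c * PI / 2)) * cis (c * t))%C).
    { unfold spiral. rewrite cexp_polar.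
      replace (Re (Ci * RtoC c * line t)) with (c * PI / 2) by (unfold line, Ci, Re; cbn; field).
      replace (Im (Ci * RtoC c * line t)) with (c * t) by (unfold line, Ci, Im; cbn; field).
      reflexivity. }
    assert (E2 : csinh (line t) = (- Ci * RtoC ((exp t + exp (- t)) / 2))%C).
    { unfold csinh, line, cexp. apply C_eq_intro; unfold Ci, Re, Im; cbn;
      rewrite ?Ropp_involutive, ?cos_neg, ?sin_neg, ?cos_PI2, ?sin_PI2; field. }
    pose proof (exp_pos t). pose proof (exp_pos (- t)).
    assert (NC : RtoC ((exp t + exp (- t)) / 2) <> 0%C) by (intros E; apply RtoC_inj in E; lra).
    assert (NI : (- Ci <> 0)%C) by (intros E; apply (f_equal Im) in E; unfold Ci, Im in E; cbn in E; lra).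
    assert (E3 : m (line t) = (Ci * (RtoC (exp (c * PI / 2)) * cis (c * t) * RtoC (/ ((exp t + exp (- t)) / 2))))%C).
    { unfold m. rewrite E1, E2, RtoC_inv by lra.
      assert (EI : (/ (- Ci) = Ci)%C).
      { replace Ci with ((- Ci) * Ci * / (- Ci))%C at 2 by (field; intros E; apply NI; rewrite E; ring).
        replace (- Ci * Ci)%C with (RtoC 1) by (apply C_eq_intro; unfold Ci, Re, Im; cbn; ring). ring. }
      rewrite <- EI at 2. field. split; auto. intros E; apply NI; rewrite E; ring. }
    rewrite E3. unfold cis, Ci, Im; cbn. field. lra. }
  pose proof (angle_increment A (fun t => Im (m (line t))) L eq_refl (fun t _ => DA t) (fun t _ => EA t)) as Ang.
  change (Re (lifted K (line L)) < 0).
  rewrite (EL (line L) (VL L)). fold u0.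
  (* [u0] is fixed by the reflection, so [K u0] is real, while [half_tanh u0] is
     [tanh (- i PI / 4) = - i]. *)
  assert (H0 : lifted K u0 = (- Ci * RtoC (exp (Re (K u0))))%C).
  { assert (Rf : reflect u0 = u0) by (apply C_eq_intro; rewrite ?Re_reflect, ?Im_reflect; unfold u0, Re, Im; cbn; ring).
    pose proof (HK u0 (proj1 (Vstrip _ (VL 0)))) as HC. rewrite Rf in HC.
    assert (KI : Im (K u0) = 0).
    { apply (f_equal Im) in HC. rewrite im_conj in HC. lra. }
    unfold lifted. rewrite (cexp_polar (K u0)), KI.
    replace (cis 0) with (RtoC 1) by (unfold cis; rewrite cos_0, sin_0; auto).
    assert (EH : half_tanh u0 = (- Ci)%C).
    { assert (EX : cexp u0 = (- Ci)%C).
      { unfold u0, cexp, Ci. apply C_eq_intro; unfold Re, Im; cbn; rewrite exp_0, ?cos_neg, ?sin_neg, ?cos_PI2, ?sin_PI2; ring. }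
      unfold half_tanh. rewrite EX.
      assert (N : (- Ci + 1 <> 0)%C) by (intros E; apply (f_equal Re) in E; unfold Ci, Re in E; cbn in E; lra).
      assert (EC : (- Ci - 1 = - Ci * (- Ci + 1))%C) by (apply C_eq_intro; unfold Ci, Re, Im; cbn; ring).
      rewrite EC. field. auto. }
    rewrite EH. ring. }
  rewrite H0, cexp_polar. unfold A in Ang. fold u0 in Ang.
  change (line 0) with u0 in Ang. rewrite <- Im_minus in Ang.
  set (al := Im (W (line L) - W u0)) in *.
  set (r1 := exp (Re (K u0))). set (r2 := exp (Re (W (line L) - W u0))).
  replace (Re (- Ci * RtoC r1 * (RtoC r2 * cis al))) with (r1 * r2 * sin al) by (unfold Ci, cis, Re; cbn; ring).
  assert (Sn : sin al < 0) by (apply sin_lt_0; lra).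
  assert (0 < r1 * r2) by (apply Rmult_lt_0_compat; apply exp_pos). nra.
Qed.

Lemma Re_cexp (z : C) : Re (cexp z) = exp (Re z) * cos (Im z). Proof. reflexivity. Qed.

Lemma unit_disc_starlike : starlike_region unit_disc 0%C.
Proof.
  unfold unit_disc. split; [rewrite Cmod_0; lra|split].
  - intros z Hz. exists (1 - Cmod z); split; [lra|]. intros w Hw.
    pose proof (Cmod_triangle (w - z) z) as T. replace (w - z + z)%C with w in T by ring. lra.
  - intros z s Hz Hs. replace (0 + RtoC s * (z - 0))%C with (RtoC s * z)%C by ring.
    rewrite Cmod_mult, Cmod_R, Rabs_pos_eq by lra. pose proof (Cmod_ge_0 z). nra.
Qed.

(** The branch is controlled by continuity: [(1 + z) / (1 - z)] has positive real part, so
    [cos (Im (U z)) > 0], and along a radius starting from [U 0 = 0] the imaginary part cannot reach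
    [PI / 2] or [- PI / 2]. *)
Lemma cayley_log : exists U : C -> C, U 0%C = 0%C /\
  forall z, unit_disc z -> cder U z (2 / ((1 - z) * (1 + z)))%C /\
    cexp (U z) = ((1 + z) / (1 - z))%C /\ Rabs (Im (U z)) < PI / 2.
Proof.
  pose proof unit_disc_starlike as HS. pose proof PI_RGT_0 as HPI.
  destruct (primitive_exists unit_disc 0%C (fun z => 2 / ((1 - z) * (1 + z)))%C HS) as [U [U0 DU]].
  { intros z Hz. destruct (unit_disc_neq z Hz) as [N1 N2]. eexists.
    apply der_div; [apply der_const|apply der_mult; [apply der_minus|apply der_plus]; (apply der_const || apply cder_id)|apply Cmult_neq_0; auto]. }
  exists U. split; [auto|].
  assert (EU : forall z, unit_disc z -> cexp (U z) = ((1 + z) / (1 - z))%C).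
  { intros z Hz.
    rewrite (exp_of_log_derivative unit_disc 0%C (fun z => (1 + z) / (1 - z))%C (fun z => 2 / ((1 - z) * (1 - z)))%C U HS); auto.
    - rewrite U0. replace (U z - 0)%C with (U z) by ring. field.
    - intros w Hw. destruct (unit_disc_neq w Hw) as [N1 N2].
      eapply der_ext; [| |apply der_div; [apply der_plus; [apply der_const|apply cder_id]|apply der_minus; [apply der_const|apply cder_id]|exact N1]].
      + reflexivity.
      + cbn beta. field. auto.
    - intros w Hw. destruct (unit_disc_neq w Hw) as [N1 N2]. eexists. split; [apply DU, Hw|]. field. auto. }
  assert (Cpos : forall z, unit_disc z -> 0 < cos (Im (U z))).
  { intros z Hz. pose proof (cayley_Re_pos z Hz) as H. rewrite <- EU in H by auto.
    rewrite Re_cexp in H. pose proof (exp_pos (Re (U z))). nra. }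
  intros z Hz. split; [apply DU, Hz|split; [apply EU, Hz|]].
  assert (Seg : forall s, 0 <= s <= 1 -> unit_disc (RtoC s * z)).
  { intros s Hs. destruct HS as [_ [_ HS]]. specialize (HS z s Hz Hs).
    replace (0 + RtoC s * (z - 0))%C with (RtoC s * z)%C in HS by ring. exact HS. }
  assert (Ds : forall s, rder (fun s => RtoC s * z)%C s z).
  { intros s. eapply der_ext; [| |apply (der_scal RtoC RtoC z s), (der_id RtoC)]; [intros; cbn; ring|ring]. }
  assert (No : forall sg, (sg = 1 \/ sg = -1) -> sg * Im (U z) < PI / 2).
  { intros sg Hsg. apply Rnot_le_lt. intros Hge.
    assert (CI : forall s, 0 <= s <= 1 -> continuity_pt (fun s => sg * Im (U (RtoC s * z)%C) - PI / 2) s).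
    { intros s Hs. apply (continuity_pt_minus (fun s => sg * Im (U (RtoC s * z)%C)) (fun _ => PI / 2));
        [|apply continuity_pt_const; intros x y; reflexivity].
      eapply is_derive_continuity_pt. apply is_derive_scal, (rder_Im (fun s => U (RtoC s * z)%C)).
      apply (der_comp RtoC (fun s => RtoC s * z)%C U); [apply Ds|apply DU, Seg, Hs]. }
    assert (Z : exists s, 0 <= s <= 1 /\ sg * Im (U (RtoC s * z)%C) = PI / 2).
    { destruct (Rle_lt_or_eq_dec _ _ Hge) as [Hgt|Heq].
      - destruct (Ranalysis5.IVT_interv (fun s => sg * Im (U (RtoC s * z)%C) - PI / 2) 0 1 CI) as [s [Hs Es]].
        + lra.
        + replace (0 * z)%C with (RtoC 0) by ring. rewrite U0, Im_RtoC. lra.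
        + replace (1 * z)%C with z by ring. lra.
        + exists s. split; [auto|lra].
      - exists 1. split; [lra|]. replace (1 * z)%C with z by ring. lra. }
    destruct Z as [s [Hs Es]]. specialize (Cpos _ (Seg s Hs)).
    replace (Im (U (RtoC s * z)%C)) with (sg * (PI / 2)) in Cpos by (destruct Hsg; subst sg; lra).
    destruct Hsg; subst sg; [rewrite Rmult_1_l, cos_PI2 in Cpos|replace (-1 * (PI / 2)) with (- (PI / 2)) in Cpos by ring; rewrite cos_neg, cos_PI2 in Cpos]; lra. }
  pose proof (No 1 ltac:(auto)). pose proof (No (-1) ltac:(auto)). apply Rabs_def1; lra.
Qed.

Lemma half_tanh_in_disc (u : C) : Rabs (Im u) < PI / 2 -> unit_disc (half_tanh u).
Proof.
  intros Hu. unfold unit_disc, half_tanh. apply Rabs_def2 in Hu.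
  assert (Cp : 0 < cos (Im u)) by (apply cos_gt_0; lra).
  assert (Rp : 0 < Re (cexp u)) by (rewrite Re_cexp; apply Rmult_lt_0_compat; [apply exp_pos|auto]).
  assert (S : Cmod (cexp u - 1) * Cmod (cexp u - 1) < Cmod (cexp u + 1) * Cmod (cexp u + 1)).
  { rewrite !Cmod_sqr, Re_minus, Re_plus, Im_minus, Im_plus, Re_RtoC, Im_RtoC. nra. }
  pose proof (Cmod_ge_0 (cexp u - 1)). pose proof (Cmod_ge_0 (cexp u + 1)).
  assert (P : 0 < Cmod (cexp u + 1)) by nra.
  rewrite Cmod_div by (apply Cmod_gt_0; auto).
  apply (Rmult_lt_reg_r (Cmod (cexp u + 1))); [auto|].
  replace (Cmod (cexp u - 1) / Cmod (cexp u + 1) * Cmod (cexp u + 1)) with (Cmod (cexp u - 1)) by (field; lra). nra.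
Qed.

Lemma cexp_inj_half_strip (u v : C) :
  Rabs (Im u) < PI / 2 -> Rabs (Im v) < PI / 2 -> cexp u = cexp v -> u = v.
Proof.
  intros Hu Hv E. pose proof PI_RGT_0. apply Rabs_def2 in Hu. apply Rabs_def2 in Hv.
  assert (E1 : cexp (u - v) = 1%C).
  { replace (u - v)%C with (u + - v)%C by ring. rewrite cexp_plus, E, cexp_opp. field. apply cexp_neq_0. }
  destruct (cexp_eq_1 _ E1) as [k Hk].
  assert (Hi := f_equal Im Hk). rewrite Im_minus, Im_mult, Re_RtoC, Im_RtoC in Hi.
  replace (Re Ci) with 0 in Hi by reflexivity. replace (Im Ci) with 1 in Hi by reflexivity.
  assert (K0 : k = 0%Z) by (apply small_multiple_of_PI, Rabs_def1; lra).
  subst k. replace u with (u - v + v)%C by ring. rewrite Hk. rewrite Rmult_0_l. ring.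
Qed.

Lemma Cmod_spiral (c : R) (u : C) : Cmod (spiral c u) = exp (- (c * Im u)).
Proof.
  unfold spiral. rewrite Cmod_cexp. f_equal. rewrite !Re_mult, !Im_mult, Re_RtoC, Im_RtoC.
  replace (Re Ci) with 0 by reflexivity. replace (Im Ci) with 1 by reflexivity. ring.
Qed.

(* The intermediate value theorem between the positive real axis and the boundary
   point of [lifted_negative]. *)
Lemma lifted_imaginary_point (K : C -> C) :
  K 0%C = 0%C ->
  (forall u, strip u -> cder K u (kernel (357 / 500) u)) ->
  (forall u, strip u -> K (reflect u) = Cconj (K u)) ->
  exists u, 0 < Re u /\ Rabs (Im u) < PI / 2 /\ Re (lifted K u) = 0.
Proof.
  intros K0 DK HK. pose proof PI_RGT_0 as HPI.
  pose proof (lifted_negative K DK HK) as Neg.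
  set (L := PI / (2 * (357 / 500))) in *.
  assert (HL : 0 < L) by (apply Rdiv_lt_0_compat; lra).
  set (us := (L, - (PI / 2)) : C) in *.
  assert (Cl : forall u, strip u -> ccont (lifted K) u).
  { intros u Hu. apply cont_mult.
    - apply cont_div; [apply cont_minus|apply cont_plus|apply strip_cexp_neq_m1, Hu];
        (apply cont_const || apply (der_cont _ _ _ _ (cder_cexp u))).
    - apply (cont_comp Cid K cexp); [apply (der_cont _ _ _ _ (DK u Hu))|apply (der_cont _ _ _ _ (cder_cexp _))]. }
  assert (Sus : strip us) by (unfold strip, us, Im; cbn; rewrite Rabs_Ropp, Rabs_pos_eq; lra).
  destruct (Cl us Sus (- Re (lifted K us)) ltac:(lra)) as [d [Hd Kd]]. unfold Cid in Kd.
  (* [us] corresponds to a point of the unit circle; raising it by [h] enters the image of the disc,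
     and [h < d] preserves the sign of the real part. *)
  set (h := Rmin (d / 2) (PI / 4)).
  assert (Hh : 0 < h) by (apply Rmin_pos; lra).
  assert (Hh1 : h <= d / 2) by apply Rmin_l. assert (Hh2 : h <= PI / 4) by apply Rmin_r.
  set (u2 := (L, - (PI / 2) + h) : C).
  assert (N2 : Re (lifted K u2) < 0).
  { specialize (Kd u2). replace (u2 - us)%C with (Ci * RtoC h)%C in Kd
      by (apply C_eq_intro; unfold u2, us, Ci, Re, Im; cbn; ring).
    rewrite Cmod_mult, Cmod_Ci, Cmod_R, Rabs_pos_eq in Kd by lra.
    specialize (Kd ltac:(lra)). pose proof (Re_le_Cmod (lifted K u2 - lifted K us)) as T.
    rewrite Re_minus in T. lra. }
  assert (S0 : strip 0%C) by apply strip_starlike.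
  destruct (der_cont _ _ _ _ (DK 0%C S0) 1 ltac:(lra)) as [d' [Hd' K']]. unfold Cid in K'.
  (* So close to 0 one has [|Im (K x)| < 1 < PI / 2], and [half_tanh x] is positive, which makes the
     real part of [lifted K] positive. *)
  set (x := d' / 2). assert (Hx : 0 < x < d') by (unfold x; lra).
  assert (P1 : 0 < Re (lifted K (RtoC x))).
  { specialize (K' (RtoC x)). rewrite K0 in K'.
    replace (RtoC x - 0)%C with (RtoC x) in K' by ring. rewrite Cmod_R, Rabs_pos_eq in K' by lra.
    specialize (K' ltac:(lra)). replace (K (RtoC x) - 0)%C with (K (RtoC x)) in K' by ring.
    pose proof (Im_le_Cmod (K (RtoC x))) as T. assert (T2 : Rabs (Im (K (RtoC x))) < 1) by lra. apply Rabs_def2 in T2.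
    assert (Ex : 1 < exp x) by (rewrite <- exp_0; apply exp_increasing; lra).
    assert (EH : half_tanh (RtoC x) = RtoC ((exp x - 1) / (exp x + 1))).
    { unfold half_tanh. rewrite cexp_RtoC, RtoC_div, RtoC_minus, RtoC_plus by lra. reflexivity. }
    unfold lifted. rewrite EH, Re_mult, Re_RtoC, Im_RtoC, Re_cexp.
    pose proof PI2_1. assert (0 < cos (Im (K (RtoC x)))) by (apply cos_gt_0; lra).
    assert (0 < (exp x - 1) / (exp x + 1)) by (apply Rdiv_lt_0_compat; lra).
    pose proof (exp_pos (Re (K (RtoC x)))).
    assert (0 < (exp x - 1) / (exp x + 1) * (exp (Re (K (RtoC x))) * cos (Im (K (RtoC x)))))
      by (apply Rmult_lt_0_compat; [auto|apply Rmult_lt_0_compat; auto]). lra. }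
  set (w := fun s : R => (RtoC x + RtoC s * (u2 - RtoC x))%C).
  assert (Rw : forall s, Re (w s) = x + s * (L - x)) by (intros s; unfold w, u2, Re; cbn; ring).
  assert (Iw : forall s, Im (w s) = s * (- (PI / 2) + h)) by (intros s; unfold w, u2, Im; cbn; ring).
  assert (Bw : forall s, 0 <= s <= 1 -> 0 < Re (w s) /\ Rabs (Im (w s)) < PI / 2).
  { intros s Hs. rewrite Rw, Iw. split; [nra|]. apply Rabs_def1; nra. }
  assert (CI : forall s, 0 <= s <= 1 -> continuity_pt (fun s => - Re (lifted K (w s))) s).
  { intros s Hs. apply (continuity_pt_opp (fun s => Re (lifted K (w s)))).
    apply continuity_pt_filterlim, (rcont_Re (fun s => lifted K (w s))).
    apply (cont_comp RtoC w (lifted K)); [apply (der_cont _ _ _ _ (rder_segment (RtoC x) u2 s))|].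
    apply Cl. unfold strip. pose proof (Bw s Hs). lra. }
  destruct (Ranalysis5.IVT_interv (fun s => - Re (lifted K (w s))) 0 1 CI) as [s [Hs Es]].
  - lra.
  - replace (w 0) with (RtoC x) by (unfold w; ring). lra.
  - replace (w 1) with u2 by (unfold w; ring). lra.
  - exists (w s). destruct (Bw s Hs). split; [auto|split; [auto|lra]].
Qed.

Lemma univalence_fails : ~ univalence_property (357 / 500 * PI).
Proof.
  intros Prop0. pose proof PI_RGT_0 as HPI. set (c := 357 / 500) in *.
  destruct (kernel_primitive c) as [K [K0 [DK HK]]].
  destruct cayley_log as [U [U0 HU]].
  assert (SU : forall z, unit_disc z -> strip (U z)).
  { intros z Hz. destruct (HU z Hz) as [_ [_ B]]. unfold strip. lra. }
  set (f := fun z => (z * cexp (K (U z)))%C).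
  set (f' := fun z => (cexp (K (U z)) + z * (cexp (K (U z)) * (kernel c (U z) * (2 / ((1 - z) * (1 + z))))))%C).
  assert (Df : has_deriv_on_D f f').
  { intros z Hz. apply is_derive_cder. destruct (HU z Hz) as [D [_ _]].
    eapply der_ext; [| |apply der_mult; [apply cder_id|apply (der_comp Cid (fun z => K (U z)) cexp);
      [apply (der_comp Cid U K); [exact D|apply DK, SU, Hz]|apply cder_cexp]]].
    - reflexivity.
    - unfold f'. ring. }
  assert (E0 : cexp (K (U 0%C)) = 1%C) by (rewrite U0, K0; apply cexp_0).
  assert (f0 : f 0%C = 0%C) by (unfold f; ring).
  assert (f'0 : f' 0%C = 1%C) by (unfold f'; rewrite E0; ring).
  assert (fnz : forall z, inD z -> z <> 0%C -> f z <> 0%C).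
  { intros z Hz Nz. unfold f. apply Cmult_neq_0; [auto|apply cexp_neq_0]. }
  assert (Bd : forall z, inD z -> exp (- (c * PI / 2)) < Cmod (zf'_over_f f f' z) < exp (c * PI / 2)).
  { intros z Hz. unfold zf'_over_f. destruct (Ceq_dec z 0%C) as [->|Nz].
    - rewrite Cmod_1, <- exp_0. assert (0 < c * PI) by (apply Rmult_lt_0_compat; unfold c; lra).
      split; apply exp_increasing; lra.
    - destruct (HU z Hz) as [_ [EU BU]]. destruct (unit_disc_neq z Hz) as [N1 N2].
      assert (NU : U z <> 0%C).
      { intros E. rewrite E, cexp_0 in EU. apply Nz.
        replace z with (((1 + z) / (1 - z) * (1 - z) - (1 - z)) / 2)%C by (field; auto).
        rewrite <- EU. field. }
      (* With [sinh (U z) = 2 z / ((1 - z) (1 + z))], the factor [z * U'] cancels the denominator of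
         the kernel and [z f' / f = 1 + (spiral - 1)]. *)
      assert (EQ : (z * f' z / f z)%C = spiral c (U z)).
      { pose proof (strip_csinh_neq_0 (U z) (SU z Hz) NU) as NS.
        assert (ES : csinh (U z) = (2 * z / ((1 - z) * (1 + z)))%C).
        { unfold csinh. rewrite cexp_opp, EU. field. auto. }
        unfold f, f', kernel. destruct (Ceq_dec (U z) 0%C) as [E|_]; [congruence|].
        rewrite ES. pose proof (cexp_neq_0 (K (U z))). field. repeat split; auto. }
      rewrite EQ, Cmod_spiral. apply Rabs_def2 in BU.
      assert (c * Im (U z) < c * (PI / 2)) by (apply Rmult_lt_compat_l; unfold c; lra).
      assert (c * - (PI / 2) < c * Im (U z)) by (apply Rmult_lt_compat_l; unfold c; lra).
      split; apply exp_increasing; lra. }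
  specialize (Prop0 f f' Df f0 f'0 fnz Bd).
  assert (UH : forall u, Rabs (Im u) < PI / 2 -> U (half_tanh u) = u).
  { intros u Hu. pose proof (half_tanh_in_disc u Hu) as Hd. destruct (HU _ Hd) as [_ [EU BU]].
    apply cexp_inj_half_strip; auto. rewrite EU.
    assert (N : (cexp u + 1 <> 0)%C) by (apply strip_cexp_neq_m1; unfold strip; lra).
    destruct (unit_disc_neq _ Hd) as [N1 _]. unfold half_tanh in *. field. split; [exact N|].
    intros E. apply N1.
    replace (1 - (cexp u - 1) / (cexp u + 1))%C with ((cexp u + 1 - (cexp u - 1)) / (cexp u + 1))%C by (field; auto).
    rewrite E. field; auto. }
  assert (FL : forall u, Rabs (Im u) < PI / 2 -> f (half_tanh u) = lifted K u).
  { intros u Hu. unfold f, lifted. rewrite UH; auto. }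
  destruct (lifted_imaginary_point K K0 DK HK) as [u [Ru [Iu Eu]]].
  assert (Su : strip u) by (unfold strip; lra).
  assert (Iu' : Rabs (Im (reflect u)) < PI / 2) by (rewrite Im_reflect; auto).
  assert (Same : f (half_tanh u) = f (half_tanh (reflect u))).
  { rewrite !FL by auto.
    assert (E : lifted K (reflect u) = reflect (lifted K u)).
    { unfold lifted. rewrite half_tanh_reflect, HK, cexp_conj by auto. unfold reflect. rewrite Cmult_conj. ring. }
    rewrite E. apply C_eq_intro; rewrite ?Re_reflect, ?Im_reflect; lra. }
  apply Prop0 in Same; [|apply half_tanh_in_disc; auto|apply half_tanh_in_disc; auto].
  apply (f_equal U) in Same. rewrite !UH in Same by auto.
  apply (f_equal Re) in Same. rewrite Re_reflect in Same. lra.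
Qed.

(** * The supremum *)

Lemma univalence_property_le (d d' : R) : d' <= d -> univalence_property d -> univalence_property d'.
Proof.
  intros Hd H f f' Df f0 f'0 fnz Bd. apply (H f f' Df f0 f'0 fnz).
  assert (Mono : forall x y, x <= y -> exp x <= exp y).
  { intros x y [Hxy|Hxy]; [apply Rlt_le, exp_increasing, Hxy|subst; lra]. }
  intros z Hz. specialize (Bd z Hz).
  pose proof (Mono (- (d / 2)) (- (d' / 2)) ltac:(lra)). pose proof (Mono (d' / 2) (d / 2) ltac:(lra)). lra.
Qed.

Theorem theorem1p1 :
  exists delta0 : R, is_lub delta_set delta0 /\ PI / 3 < delta0 < 5 * PI / 7.
Proof.
  pose proof PI_RGT_0 as HPI.
  assert (Low : delta_set (167 / 500 * PI)) by (split; [lra|apply univalence_lower]).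
  assert (Up : is_upper_bound delta_set (357 / 500 * PI)).
  (* The property passes to smaller numbers, so its failure at [357 / 500 * PI] bounds the whole
     set. *)
  { intros d [_ Hd]. apply Rnot_lt_le. intros Hlt.
    apply univalence_fails, (univalence_property_le d); [lra|auto]. }
  destruct (completeness delta_set) as [d0 Hd0].
  - exists (357 / 500 * PI). exact Up.
  - exists (167 / 500 * PI). exact Low.
  - exists d0. split; [exact Hd0|]. destruct Hd0 as [H1 H2].
    specialize (H1 _ Low). specialize (H2 _ Up). lra.
Qed.
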